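(* Let $f:\mathbb{T}^2\to\mathbb{T}^2$ be an area-preserving weakly mixing $C^\infty$-diffeomorphism with sublinear growth of the derivative. Let $T_\varphi:\mathbb{T}^2\to\mathbb{T}^2$, $T_\varphi(x_1,x_2)=(x_1+\alpha,x_2+\varphi(x_1))$, where $x\mapsto x+\alpha$ is an ergodic rotation on the circle and $\varphi:\mathbb{T}\to\mathbb{T}$ is a $C^\infty$-function with non-zero topological degree. Then the product diffeomorphism $f\times T_\varphi:\mathbb{T}^4\to\mathbb{T}^4$ is ergodic and has linear uniform growth of the derivative. Moreover, it is not metrically isomorphic to any $3$-steps skew product.
   Context: $\mathbb{T}^d=\mathbb{R}^d/\mathbb{Z}^d$ with Lebesgue measure; area-preserving, weakly mixing, ergodic and metrically isomorphic (measure-theoretically isomorphic) are with respect to Lebesgue measure. A $C^1$-diffeomorphism $f:\mathbb{T}^2\to\mathbb{T}^2$ has sublinear growth of the derivative if $Df^n/n$ tends uniformly to zero as $n\to\infty$. A diffeomorphism $F$ of $\mathbb{T}^4$ has linear uniform growth of the derivative if $n^{-1}DF^n$ converges uniformly to a function that is not identically zero. A $3$-steps skew product is an automorphism of $\mathbb{T}^4$ (preserving Lebesgue measure) of the form $$(x_1,x_2,x_3,x_4)\longmapsto(x_1+\alpha',\ \varepsilon_1x_2+\beta(x_1),\ \varepsilon_2x_3+\gamma(x_1,x_2),\ \varepsilon_3x_4+\delta(x_1,x_2,x_3)),$$ where $\varepsilon_i=\pm1$ for $i=1,2,3$, $\alpha'\in\mathbb{T}$, and $\beta,\gamma,\delta$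 are measurable $\mathbb{T}$-valued functions. *)

(* Defs.v *)
(* MathComp-Analysis, over an arbitrary realType R. *)
From HB Require Import structures.
From mathcomp Require Import all_boot all_order all_algebra.
From mathcomp Require Import all_classical all_reals all_analysis.

Set Implicit Arguments.
Unset Strict Implicit.
Unset Printing Implicit Defensive.

Import Order.TTheory GRing.Theory Num.Theory.
Import numFieldNormedType.Exports.

Local Open Scope classical_set_scope.
Local Open Scope ring_scope.

Section circle.
Variable R : realType.

(* The additive group R/Z.  The clone is needed because Num.int is a qualifier,
   whereas quotients are taken by bundled additive subgroups. *)
Definition circle :=
  Quotient.quot (GRing.ZmodClosed.clone R (@archimedean.Num.int_num_subdef R) _).
HB.instance Definition _ := GRing.Zmodule.on circle.
HB.instance Definition _ := isPointed.Build circle 0.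

Definition circle_proj (x : R) : circle := \pi_circle%qT x.

Lemma circle_projP (x y : R) :
  circle_proj x = circle_proj y <-> x - y \is a Num.int.
Proof.
have -> : (x - y \is a Num.int) = (circle_proj x == circle_proj y).
  by rewrite eqmodE.
by split=> /eqP.
Qed.

Lemma circle_projD : {morph circle_proj : x y / x + y}.
Proof. by move=> x y; rewrite /circle_proj !piE. Qed.

(* The Borel sets of R/Z, i.e. the final sigma-algebra for the projection. *)
Definition circle_measurable : set (set circle) :=
  [set A | measurable (circle_proj @^-1` A)].

Let circle_measurable0 : circle_measurable set0.
Proof. by rewrite /circle_measurable/= preimage_set0. Qed.

Let circle_measurableC A : circle_measurable A -> circle_measurable (~` A).
Proof. by rewrite /circle_measurable/= preimage_setC; exact: measurableC. Qed.

Let circle_measurableU (F : (set circle)^nat) :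
  (forall i, circle_measurable (F i)) -> circle_measurable (\bigcup_i F i).
Proof.
move=> mF; rewrite /circle_measurable/= preimage_bigcup.
exact: bigcupT_measurable.
Qed.

HB.instance Definition _ := @isMeasurable.Build default_measure_display circle
  circle_measurable circle_measurable0 circle_measurableC circle_measurableU.

Lemma measurable_circle_proj : measurable_fun [set: R] circle_proj.
Proof. by move=> _ A mA; rewrite setTI. Qed.


Definition circle_measure : set circle -> \bar R :=
  pushforward (mrestr (@lebesgue_measure R)
                 (measurable_itv `[0, 1[ : measurable (`[0%R, 1%R[ : set R)))
    circle_proj.

Let circle_measure0 : circle_measure set0 = 0%E.
Proof. by rewrite /circle_measure /pushforward preimage_set0 measure0. Qed.

Let circle_measure_ge0 A : (0 <= circle_measure A)%E.
Proof. by rewrite /circle_measure /pushforward. Qed.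

Let circle_measure_sigma_additive : semi_sigma_additive circle_measure.
Proof.
move=> F mF tF mUF; rewrite /circle_measure /pushforward preimage_bigcup.
apply: measure_semi_sigma_additive; first exact: mF.
- by apply/trivIsetP => i j _ _ ij; rewrite -preimage_setI;
    move/trivIsetP : tF => /(_ _ _ Logic.I Logic.I ij) ->; rewrite preimage_set0.
- by rewrite -preimage_bigcup; exact: mUF.
Qed.

HB.instance Definition _ := isMeasure.Build _ _ _ circle_measure
  circle_measure0 circle_measure_ge0 circle_measure_sigma_additive.

Let circle_measureT : circle_measure setT = 1%E.
Proof.
rewrite /circle_measure /pushforward /mrestr preimage_setT setTI.
by rewrite lebesgue_measure_itv/= lte_fin ltr01 sube0.
Qed.

HB.instance Definition _ :=
  Measure_isProbability.Build _ _ _ circle_measure circle_measureT.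

End circle.

Arguments circle_measure {R}.

(* T^4 is bracketed as T^2 x T^2, so that the product map below is literally a
   self-map of T^4; (x1, x2, x3, x4) is encoded as ((x1, x2), (x3, x4)). *)
Notation torus2 R := (circle R * circle R)%type.
Notation torus3 R := (circle R * circle R * circle R)%type.
Notation torus4 R := (torus2 R * torus2 R)%type.

Notation torus2_measure R :=
  (@circle_measure R \x @circle_measure R)%E.
Notation torus4_measure R :=
  (torus2_measure R \x torus2_measure R)%E.

Definition torus2_proj (R : realType) (v : 'rV[R]_2) : torus2 R :=
  (circle_proj (v 0 0), circle_proj (v 0 1)).

Definition torus4_proj (R : realType) (v : 'rV[R]_4) : torus4 R :=
  ((circle_proj (v 0 0), circle_proj (v 0 1)),
   (circle_proj (v 0 2), circle_proj (v 0 3))).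

(* Only meaningful for finite-dimensional V: on R^n, F is C^(k+1) iff it is
   differentiable and all its directional derivatives are C^k. *)
Fixpoint Ck (R : realType) (V W : normedModType R) (k : nat) (F : V -> W)
    : Prop :=
  if k is k'.+1 then
    (forall x, differentiable F x) /\ (forall v, Ck k' (fun x => 'D_v F x))
  else continuous F.

Definition lifts (V W X Y : Type) (p : V -> X) (q : W -> Y)
    (F : V -> W) (f : X -> Y) : Prop :=
  forall v, f (p v) = q (F v).

(* Differentiability on tori is expressed on lifts to the universal cover
   p : R^d -> T^d, which is a local diffeomorphism; every continuous map between
   tori has a continuous lift, unique up to an additive integer vector. *)
Definition class_Ck (R : realType) (V W : normedModType R) (X Y : Type)
    (p : V -> X) (q : W -> Y) (k : nat) (f : X -> Y) : Prop :=
  exists F : V -> W, lifts p q F f /\ Ck k F.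

Definition class_Coo (R : realType) (V W : normedModType R) (X Y : Type)
    (p : V -> X) (q : W -> Y) (f : X -> Y) : Prop :=
  exists F : V -> W, lifts p q F f /\ forall k, Ck k F.

Definition diffeo_C1 (R : realType) (V : normedModType R) (X : Type)
    (p : V -> X) (f : X -> X) : Prop :=
  class_Ck p p 1 f /\
  exists g : X -> X, [/\ cancel f g, cancel g f & class_Ck p p 1 g].

Definition diffeo_Coo (R : realType) (V : normedModType R) (X : Type)
    (p : V -> X) (f : X -> X) : Prop :=
  class_Coo p p f /\
  exists g : X -> X, [/\ cancel f g, cancel g f & class_Coo p p g].

(* D is the derivative of f: D x is the matrix of the tangent map of f at x in
   the standard trivialization of the tangent bundle (acting on row vectors). *)
Definition is_torus_derivative (R : realType) (d : nat) (X : Type)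
    (p : 'rV[R]_d -> X) (f : X -> X) (D : X -> 'M[R]_d) : Prop :=
  exists F : 'rV[R]_d -> 'rV[R]_d,
    [/\ lifts p p F f,
        forall v, differentiable F v
      & forall v, D (p v) = 'J F v].

Definition derivative_growth (R : realType) (d : nat) (X : choiceType)
    (p : 'rV[R]_d -> X) (f : X -> X) (g : X -> 'M[R]_d) : Prop :=
  exists D : nat -> X -> 'M[R]_d,
    (forall n, is_torus_derivative p (iter n f) (D n)) /\
    {uniform, (fun n x => n%:R^-1 *: D n x) @ \oo --> g}.

Definition sublinear_growth (R : realType) (d : nat) (X : choiceType)
    (p : 'rV[R]_d -> X) (f : X -> X) : Prop :=
  diffeo_C1 p f /\ derivative_growth p f (fun=> 0).

Definition linear_uniform_growth (R : realType) (d : nat) (X : choiceType)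
    (p : 'rV[R]_d -> X) (f : X -> X) : Prop :=
  diffeo_C1 p f /\
  exists g : X -> 'M[R]_d, derivative_growth p f g /\ exists x, g x != 0.

Definition topological_degree (R : realType) (phi : circle R -> circle R)
    (m : int) : Prop :=
  exists F : R -> R,
    [/\ continuous F,
        lifts (@circle_proj R) (@circle_proj R) F phi
      & forall t, F (t + 1) = F t + m%:~R].

Section ergodic_theory.
Context (d : measure_display) (X : measurableType d) (R : realType).
Variable mu : probability X R.
Implicit Type f : X -> X.

Definition measure_preserving f : Prop :=
  measurable_fun [set: X] f /\
  forall A, measurable A -> mu (f @^-1` A) = mu A.

Definition automorphism f : Prop :=
  measure_preserving f /\
  exists g : X -> X, [/\ measurable_fun [set: X] g, cancel f g & cancel g f].

Definition ergodic f : Prop :=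
  measure_preserving f /\
  forall A, measurable A -> f @^-1` A = A -> mu A = 0%E \/ mu A = 1%E.

Definition weakly_mixing f : Prop :=
  measure_preserving f /\
  forall A B, measurable A -> measurable B ->
    (fun n => n%:R^-1 * \sum_(k < n)
       `|fine (mu (A `&` iter k f @^-1` B)) - fine (mu A) * fine (mu B)|)
      @ \oo --> (0 : R).
End ergodic_theory.

(* An isomorphism between invariant sets of full measure, with inverse k. *)
Definition metrically_isomorphic (R : realType)
    (dX dY : measure_display) (X : measurableType dX) (Y : measurableType dY)
    (mu : probability X R) (nu : probability Y R)
    (f : X -> X) (g : Y -> Y) : Prop :=
  exists (X0 : set X) (Y0 : set Y) (h : X -> Y) (k : Y -> X),
    [/\ [/\ measurable X0, mu X0 = 1%E & f @` X0 `<=` X0],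
        [/\ measurable Y0, nu Y0 = 1%E & g @` Y0 `<=` Y0],
        [/\ measurable_fun X0 h, h @` X0 `<=` Y0
          & forall x, X0 x -> k (h x) = x],
        [/\ measurable_fun Y0 k, k @` Y0 `<=` X0
          & forall y, Y0 y -> h (k y) = y]
      & (forall B, measurable B -> mu (X0 `&` h @^-1` B) = nu B) /\
        (forall x, X0 x -> h (f x) = g (h x))].

Definition circle_rotation (R : realType) (alpha : circle R)
    (x : circle R) : circle R := x + alpha.

Definition torus2_skew (R : realType) (alpha : circle R)
    (phi : circle R -> circle R) (x : torus2 R) : torus2 R :=
  (x.1 + alpha, x.2 + phi x.1).

Definition product_map (X Y : Type) (f : X -> X) (g : Y -> Y) (x : X * Y)
  : X * Y := (f x.1, g x.2).

Definition skew_product3 (R : realType) (G : torus4 R -> torus4 R) : Prop :=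
  automorphism (torus4_measure R) G /\
  exists (alpha : circle R) (e1 e2 e3 : int) (beta : circle R -> circle R)
      (gamma : torus2 R -> circle R) (delta : torus3 R -> circle R),
    [/\ [/\ e1 = 1 \/ e1 = -1, e2 = 1 \/ e2 = -1 & e3 = 1 \/ e3 = -1],
        [/\ measurable_fun setT beta, measurable_fun setT gamma
          & measurable_fun setT delta]
      & forall x1 x2 x3 x4,
          G ((x1, x2), (x3, x4)) =
            ((x1 + alpha, x2 *~ e1 + beta x1),
             (x3 *~ e2 + gamma (x1, x2), x4 *~ e3 + delta (x1, x2, x3)))].

(* Main.v *)
(**
Every iterate of the product is the product of the iterates, and the iterates
of the skew shift have derivative (1, 0; S_n phi', 1) with S_n phi' the Birkhoff
sum of phi' over the rotation.  Since S_n phi' / n tends uniformly to the mean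
of phi', which is the degree of phi, while Df^n / n tends to 0, the growth is
linear with a constant nonzero limit.

For ergodicity it is enough to prove the Cesaro convergence of correlations
for products E x (arc x arc).  Along the second circle factor, the n-th iterate
of the skew shift translates by a function of x_1 with slope about n deg(phi),
which oscillates ever faster; hence the correlations of arcs behave like those
of the rotation alone, weighted by the lengths of the arcs in the fibre.
Averaging these against the correlations of f, which are constant up to a
density-zero set of times, gives the product of the measures.

A weakly mixing factor of a 3-steps skew product is trivial: it is independent
of the first coordinate, and inductively of the first two, three and four
coordinates, so it is independent of itself.  As f is a weakly mixing factor of
the product and is not trivial, the last claim follows.
*)

Require Import Defs.
From HB Require Import structures.
From mathcomp Require Import all_boot all_order all_algebra.
From mathcomp Require Import all_classical all_reals all_analysis.
From mathcomp Require Import measurable_realfun zify ring lra.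

Set Implicit Arguments.
Unset Strict Implicit.
Unset Printing Implicit Defensive.

Import Order.TTheory GRing.Theory Num.Theory.
Import numFieldNormedType.Exports.

Local Open Scope classical_set_scope.
Local Open Scope ring_scope.

(** The argument uses only means of bounded functions: neither Fourier series nor conditional
    expectations appear. The part of characters is taken by the indicators of the arcs starting at
    0, which generate the Borel sets and are Lipschitz in the mean under translation. This bound
    turns a statement about almost every translate of an arc into one about the arc itself.

    The fibre maps of a skew product may reflect, and depend on the base in a merely measurable way.
    This obstacle disappears on pairs of points over one base point: both are moved by the same
    affine map of the circle, so a quantity that depends only on their difference up to sign is
    preserved.

    Ergodicity of the rotation is given in the sense of measure, whereas the growth of the
    derivative is a uniform statement. The bridge is the density of one orbit together with the
    equicontinuity of the Birkhoff averages, which forces their oscillation to 0; the value of the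
    limit then comes from the mean value theorem over one period. *)

Section bounded_measurable.
Context d (X : measurableType d) (R : realType).
Implicit Types (F G : X -> R) (mu : probability X R).

(** * Means of bounded measurable functions *)

Definition bounded_meas F :=
  measurable_fun [set: X] F /\ exists M, forall x, `|F x| <= M.

Lemma bounded_meas_cst (c : R) : bounded_meas (fun _ : X => c).
Proof. by split=> //; exists `|c|. Qed.

Lemma bounded_meas_indic (A : set X) : measurable A -> bounded_meas (\1_A).
Proof.
move=> mA; split; first exact: measurable_indic.
by exists 1 => x; rewrite indicE; case: (_ \in _); rewrite ?normr1 ?normr0.
Qed.

Lemma bounded_measD F G : bounded_meas F -> bounded_meas G ->
  bounded_meas (fun x => F x + G x).
Proof.
move=> [mF [M FM]] [mG [N GN]]; split; first exact: measurable_funD.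
exists (M + N) => x; apply: le_trans (ler_normD _ _) _.
by rewrite lerD.
Qed.

Lemma bounded_measM F G : bounded_meas F -> bounded_meas G ->
  bounded_meas (fun x => F x * G x).
Proof.
move=> [mF [M FM]] [mG [N GN]]; split; first exact: measurable_funM.
exists (M * N) => x; rewrite normrM.
by rewrite ler_pM.
Qed.

Lemma bounded_measZ (c : R) F : bounded_meas F ->
  bounded_meas (fun x => c * F x).
Proof. by apply: bounded_measM; exact: bounded_meas_cst. Qed.

Lemma bounded_measN F : bounded_meas F -> bounded_meas (fun x => - F x).
Proof.
by move=> bF; under eq_fun do rewrite -mulN1r; exact: bounded_measZ.
Qed.

Lemma bounded_measB F G : bounded_meas F -> bounded_meas G ->
  bounded_meas (fun x => F x - G x).
Proof. by move=> bF bG; apply: bounded_measD => //; exact: bounded_measN. Qed.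

Lemma bounded_meas_norm F : bounded_meas F -> bounded_meas (fun x => `|F x|).
Proof.
move=> [mF [M FM]]; split; first exact: measurableT_comp.
by exists M => x; rewrite normr_id.
Qed.

Lemma bounded_meas_sum n (F : nat -> X -> R) :
  (forall i, bounded_meas (F i)) -> bounded_meas (fun x => \sum_(i < n) F i x).
Proof.
move=> bF; elim: n => [|n ih].
  by under eq_fun do rewrite big_ord0; exact: bounded_meas_cst.
by under eq_fun do rewrite big_ord_recr/=; exact: bounded_measD.
Qed.

Lemma bounded_meas_integrable mu F : bounded_meas F ->
  mu.-integrable [set: X] (EFin \o F).
Proof.
move=> [mF [M FM]]; apply: measurable_bounded_integrable => //.
  by apply: le_lt_trans (probability_le1 _ _) _; rewrite // ltry.
exists M; split; first exact: num_real.
by move=> x Mx y _; exact: le_trans (FM y) (ltW Mx).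
Qed.

Lemma mean_cst mu (c : R) : \int[mu]_x c = c.
Proof.
by rewrite Rintegral_cst// [X in fine X](probability_setT mu) mulr1.
Qed.

Lemma mean_indic mu (A : set X) : measurable A ->
  \int[mu]_x \1_A x = fine (mu A).
Proof. by move=> mA; rewrite /Rintegral integral_indic// setIT. Qed.

Lemma meanD mu F G : bounded_meas F -> bounded_meas G ->
  \int[mu]_x (F x + G x) = \int[mu]_x F x + \int[mu]_x G x.
Proof. by move=> bF bG; apply: RintegralD => //; exact: bounded_meas_integrable. Qed.

Lemma meanB mu F G : bounded_meas F -> bounded_meas G ->
  \int[mu]_x (F x - G x) = \int[mu]_x F x - \int[mu]_x G x.
Proof. by move=> bF bG; apply: RintegralB => //; exact: bounded_meas_integrable. Qed.

Lemma meanZ mu (c : R) F : bounded_meas F ->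
  \int[mu]_x (c * F x) = c * \int[mu]_x F x.
Proof. by move=> bF; apply: RintegralZl => //; exact: bounded_meas_integrable. Qed.

Lemma mean_sum mu n (F : nat -> X -> R) : (forall i, bounded_meas (F i)) ->
  \int[mu]_x (\sum_(i < n) F i x) = \sum_(i < n) \int[mu]_x F i x.
Proof.
move=> bF; elim: n => [|n ih].
  by under eq_Rintegral do rewrite big_ord0; rewrite mean_cst big_ord0.
under eq_Rintegral do rewrite big_ord_recr/=.
rewrite big_ord_recr/= meanD// ?ih//.
exact: bounded_meas_sum.
Qed.

Lemma mean_le mu F G : bounded_meas F -> bounded_meas G ->
  (forall x, F x <= G x) -> \int[mu]_x F x <= \int[mu]_x G x.
Proof.
by move=> bF bG FG; apply: le_Rintegral => //; exact: bounded_meas_integrable.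
Qed.

Lemma mean_norm mu F : bounded_meas F ->
  `|\int[mu]_x F x| <= \int[mu]_x `|F x|.
Proof.
by move=> bF; apply: le_normr_Rintegral => //; exact: bounded_meas_integrable.
Qed.

Lemma mean_ge0 mu F : (forall x, 0 <= F x) -> 0 <= \int[mu]_x F x.
Proof. by move=> F0; apply: Rintegral_ge0. Qed.

(** The pointwise bound [|F| <= e + F^2 / e] stands in for Cauchy-Schwarz: its right side has mean
    [e], for every [e > 0]. *)
Lemma mean_eq0_sq mu F (bF : bounded_meas F) :
  (\int[mu]_x (F x ^+ 2) = 0) -> \int[mu]_x `|F x| = 0.
Proof.
move=> F20; apply/eqP; rewrite eq_le mean_ge0// andbT.
apply/ler_addgt0Pl => e e0; rewrite addr0.
have bF2 : bounded_meas (fun x => F x ^+ 2).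
  by under eq_fun do rewrite expr2; exact: bounded_measM.
apply: (@le_trans _ _ (\int[mu]_x (e + e^-1 * F x ^+ 2))).
  apply: mean_le.
  - exact: bounded_meas_norm.
  - by apply: bounded_measD; [exact: bounded_meas_cst|exact: bounded_measZ].
  - move=> x; rewrite -(ler_pM2l e0) mulrDr mulrA divff ?gt_eqF// mul1r.
    rewrite -[F x ^+ 2]real_normK ?num_real//.
    have := sqr_ge0 (e - `|F x|); have := normr_ge0 (F x); nra.
rewrite meanD; last 2 first.
- exact: bounded_meas_cst.
- exact: bounded_measZ.
by rewrite mean_cst meanZ// F20 mulr0 addr0.
Qed.

(** Otherwise [e * \1_A <= |F|] and the mean of [|F|] would be positive. It serves to choose one
    good translation inside a small arc. *)
Lemma mean_lt_exists mu F (A : set X) (e : R) : bounded_meas F ->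
  measurable A -> (0 < mu A)%E -> 0 < e -> \int[mu]_x `|F x| = 0 ->
  exists2 x, A x & `|F x| <= e.
Proof.
move=> bF mA A0 e0 F0; apply/not_exists2P => h.
suff : 0 < \int[mu]_x `|F x| by rewrite F0 ltxx.
apply: (@lt_le_trans _ _ (\int[mu]_x (e * \1_A x))).
  rewrite meanZ; last exact: bounded_meas_indic.
  by rewrite mulr_gt0// mean_indic// fine_gt0// A0/= (le_lt_trans (probability_le1 _ _))// ltry.
apply: mean_le.
- by apply: bounded_measZ; exact: bounded_meas_indic.
- exact: bounded_meas_norm.
- move=> x; rewrite indicE; case: (boolP (x \in A)) => /=; last by rewrite mulr0.
  rewrite inE mulr1 => Ax; have [//|] := h x.
  by move=> /negP; rewrite -ltNge => /ltW.
Qed.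

End bounded_measurable.

(** * Maps between probability spaces and Fubini *)

Section preserving.
Context (R : realType).

(** The space may change, so that projections, regroupings of coordinates, factor maps and laws of
    pairs are all covered by one notion. *)
Definition preserves d1 d2 (X : measurableType d1) (Y : measurableType d2)
    (mu : probability X R) (nu : probability Y R) (p : X -> Y) :=
  measurable_fun [set: X] p /\
  forall A, measurable A -> mu (p @^-1` A) = nu A.

Lemma bounded_meas_comp d1 d2 (X : measurableType d1) (Y : measurableType d2)
    (p : X -> Y) (F : Y -> R) : measurable_fun [set: X] p ->
  bounded_meas F -> bounded_meas (fun x => F (p x)).
Proof.
move=> mp [mF [M FM]]; split; first exact: measurableT_comp.
by exists M.
Qed.

Lemma mean_preserves d1 d2 (X : measurableType d1) (Y : measurableType d2)
    (mu : probability X R) (nu : probability Y R) (p : X -> Y) (F : Y -> R) :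
  preserves mu nu p -> bounded_meas F ->
  \int[mu]_x F (p x) = \int[nu]_y F y.
Proof.
move=> [mp pE] bF; rewrite /Rintegral; congr fine.
have -> : (\int[nu]_y (F y)%:E = \int[pushforward mu p]_y (F y)%:E)%E.
  by apply: eq_measure_integral => A mA _; exact: esym (pE A mA).
rewrite integral_pushforward//.
- by apply/measurable_EFinP; exact: bF.1.
- rewrite preimage_setT; exact: (bounded_meas_integrable _ (bounded_meas_comp mp bF)).
Qed.

Lemma preserves_comp d1 d2 d3 (X : measurableType d1) (Y : measurableType d2)
    (Z : measurableType d3) (mu : probability X R) (nu : probability Y R)
    (la : probability Z R) (p : X -> Y) (q : Y -> Z) :
  preserves mu nu p -> preserves nu la q -> preserves mu la (q \o p).
Proof.
move=> [mp pE] [mq qE]; split; first exact: measurableT_comp.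
move=> A mA; rewrite comp_preimage pE ?qE//.
by rewrite -[_ @^-1` _]setTI; exact: mq.
Qed.

Context d1 d2 (X : measurableType d1) (Y : measurableType d2)
  (mu : probability X R) (nu : probability Y R).
Local Notation munu := (mu \x nu)%E.

Lemma mean_fubini (F : X * Y -> R) : bounded_meas F ->
  \int[munu]_z F z = \int[mu]_x \int[nu]_y F (x, y).
Proof.
move=> bF; rewrite /Rintegral -integral12_prod_meas1; last exact: bounded_meas_integrable.
rewrite /fubini_F; congr fine; apply: eq_integral => x _ /=.
rewrite fineK//; apply: integrable_fin_num => //.
apply: (bounded_meas_integrable nu (F := fun y => F (x, y))).
by apply: (bounded_meas_comp (p := pair x)).
Qed.

Lemma mean_fubini2 (F : X * Y -> R) : bounded_meas F ->
  \int[munu]_z F z = \int[nu]_y \int[mu]_x F (x, y).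
Proof.
move=> bF; rewrite /Rintegral -integral21_prod_meas1; last exact: bounded_meas_integrable.
rewrite /fubini_G; congr fine; apply: eq_integral => x _ /=.
rewrite fineK//; apply: integrable_fin_num => //.
apply: (bounded_meas_integrable mu (F := fun y => F (y, x))).
by apply: (bounded_meas_comp (p := fun y => (y, x))).
Qed.

Lemma bounded_meas_fubini (F : X * Y -> R) : bounded_meas F ->
  bounded_meas (fun x => \int[nu]_y F (x, y)).
Proof.
move=> bF; split.
  have -> : (fun x => \int[nu]_y F (x, y)) = fine \o fubini_F nu (EFin \o F).
    by apply/funext.
  apply: measurableT_comp => //.
  exact: measurable_fubini_F (bounded_meas_integrable munu bF).
have [mF [M FM]] := bF; exists M => x.
have bFx : bounded_meas (fun y => F (x, y)) by apply: (bounded_meas_comp (p := pair x)).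
apply: le_trans (mean_norm _ bFx) _.
rewrite -[leRHS](mean_cst nu); apply: mean_le => //.
- exact: bounded_meas_norm.
- exact: bounded_meas_cst.
Qed.

Lemma bounded_meas_fubini2 (F : X * Y -> R) : bounded_meas F ->
  bounded_meas (fun y => \int[mu]_x F (x, y)).
Proof.
move=> bF; split.
  have -> : (fun y => \int[mu]_x F (x, y)) = fine \o fubini_G mu (EFin \o F).
    by apply/funext.
  apply: measurableT_comp => //.
  exact: measurable_fubini_G (bounded_meas_integrable munu bF).
have [mF [M FM]] := bF; exists M => y.
have bFx : bounded_meas (fun x => F (x, y)).
  by apply: (bounded_meas_comp (p := fun x => (x, y))).
apply: le_trans (mean_norm _ bFx) _.
rewrite -[leRHS](mean_cst mu); apply: mean_le => //.
- exact: bounded_meas_norm.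
- exact: bounded_meas_cst.
Qed.

Lemma preserves_fst : preserves munu mu fst.
Proof.
split=> // A mA; have -> : fst @^-1` A = A `*` [set: Y].
  by apply/seteqP; split=> [[x y]|[x y] []].
rewrite [LHS](product_measure1E mu nu mA measurableT).
by rewrite [X in (_ * X)%E](probability_setT nu) mule1.
Qed.

Lemma preserves_snd : preserves munu nu snd.
Proof.
split=> // A mA; have -> : snd @^-1` A = [set: X] `*` A.
  by apply/seteqP; split=> [[x y]|[x y] []].
rewrite [LHS](product_measure1E mu nu measurableT mA).
by rewrite [X in (X * _)%E](probability_setT mu) mul1e.
Qed.

Lemma preserves_mean (p : X -> Y) : measurable_fun [set: X] p ->
  (forall A, measurable A -> \int[mu]_x \1_A (p x) = \int[nu]_y \1_A y) ->
  preserves mu nu p.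
Proof.
move=> mp h; split=> // A mA.
have mpA : measurable (p @^-1` A) by rewrite -[_ @^-1` _]setTI; exact: mp.
rewrite -[LHS]fineK ?fin_num_measure// -[RHS]fineK ?fin_num_measure//.
by rewrite -!mean_indic// -h.
Qed.

End preserving.

Section skew_preserves.
Context (R : realType) d1 d2 d3 d4 (A : measurableType d1) (B : measurableType d2)
  (A' : measurableType d3) (B' : measurableType d4)
  (mu : probability A R) (nu : probability B R)
  (mu' : probability A' R) (nu' : probability B' R).

(** By Fubini it is enough that almost nothing is mixed up: the base map preserves its measure and
    so does each fibre map; invertibility plays no part in this. *)
Lemma preserves_skew (s : A -> A') (t : A * B -> B') :
  preserves mu mu' s -> measurable_fun [set: A * B] t ->
  (forall a, preserves nu nu' (fun b => t (a, b))) ->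
  preserves (mu \x nu)%E (mu' \x nu')%E (fun x => (s x.1, t x)).
Proof.
move=> ps mt pt.
have mst : measurable_fun [set: A * B] (fun x => (s x.1, t x)).
  apply: measurable_fun_pair => //.
  by apply: (measurableT_comp (f := s)) => //; exact: ps.1.
apply: preserves_mean => // S mS.
have bS := bounded_meas_indic R mS.
rewrite mean_fubini; last exact: (bounded_meas_comp (p := fun x => (s x.1, t x))).
rewrite mean_fubini//= -(mean_preserves ps); last exact: (bounded_meas_fubini mu').
apply: eq_Rintegral => a _.
apply: (mean_preserves (F := fun b => \1_S (s a, b)) (pt a)).
exact: (bounded_meas_comp (p := pair (s a))).
Qed.

End skew_preserves.

Section assoc_preserves.
Context (R : realType) d1 d2 d3 (A : measurableType d1) (B : measurableType d2)
  (C : measurableType d3)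
  (mu : probability A R) (nu : probability B R) (la : probability C R).

(** The splitting of the torus into base and fibre changes from one level of the skew product to the
    next, while the bracketing of its coordinates is fixed; these two maps mediate. *)
Definition assocr (x : A * B * C) : A * (B * C) := (x.1.1, (x.1.2, x.2)).
Definition assocl (x : A * (B * C)) : A * B * C := ((x.1, x.2.1), x.2.2).

Lemma measurable_assocr : measurable_fun [set: A * B * C] assocr.
Proof.
apply: measurable_fun_pair; first exact: measurableT_comp.
apply: measurable_fun_pair => //; exact: measurableT_comp.
Qed.

Lemma measurable_assocl : measurable_fun [set: A * (B * C)] assocl.
Proof.
apply: measurable_fun_pair; last exact: measurableT_comp.
apply: measurable_fun_pair => //; exact: measurableT_comp.
Qed.

Lemma preserves_assocr :
  preserves ((mu \x nu) \x la)%E (mu \x (nu \x la))%E assocr.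
Proof.
apply: preserves_mean => [|S mS]; first exact: measurable_assocr.
have bS := bounded_meas_indic R mS.
have bS' := bounded_meas_comp measurable_assocr bS.
rewrite mean_fubini// mean_fubini; last exact: (bounded_meas_fubini (mu \x nu)%E la bS').
rewrite mean_fubini//; apply: eq_Rintegral => a _ /=.
rewrite mean_fubini//.
exact: (bounded_meas_comp (p := pair a)).
Qed.

Lemma preserves_assocl :
  preserves (mu \x (nu \x la))%E ((mu \x nu) \x la)%E assocl.
Proof.
apply: preserves_mean => [|S mS]; first exact: measurable_assocl.
have bS := bounded_meas_indic R mS.
have bS' := bounded_meas_comp measurable_assocl bS.
rewrite mean_fubini//= mean_fubini// mean_fubini; last first.
  exact: (bounded_meas_fubini (mu \x nu)%E la bS).
apply: eq_Rintegral => a _ /=.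
rewrite mean_fubini//.
apply: (bounded_meas_comp (p := fun z => ((a, z.1), z.2)) _ bS).
apply: measurable_fun_pair => //; exact: measurable_fun_pair.
Qed.

End assoc_preserves.

(** * The circle and its arcs *)

Section dynkin_classes.

Lemma trivIset_preimage I aT rT (D : set I) (f : aT -> rT) (F : I -> set rT) :
  trivIset D F -> trivIset D (fun i => f @^-1` F i).
Proof.
move=> tF i j Di Dj [x [Fi Fj]]; apply: (tF i j Di Dj).
by exists (f x).
Qed.

Lemma prod_dynkin d1 d2 (X : measurableType d1) (Y : measurableType d2)
    (P : set (set (X * Y))) : dynkin P ->
  (forall A B, measurable A -> measurable B -> P (A `*` B)) ->
  forall S, measurable S -> P S.
Proof.
move=> /dynkin_lambda_system lP PX S; rewrite measurable_prod_measurableType.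
apply: (lambda_system_subset (G := [set A `*` B | A in measurable & B in measurable])
  _ lP) => //.
- move=> _ _ [A mA [B mB <-]] [A' mA' [B' mB' <-]]; rewrite -setXI.
  exists (A `&` A'); first exact: measurableI.
  by exists (B `&` B') => //; exact: measurableI.
- by move=> _ [A mA [B mB <-]]; exact: PX.
Qed.

Context (R : realType).

Lemma real_dynkin (P : set (set R)) : dynkin P ->
  (forall v, P `]-oo, v[%classic) ->
  forall S, measurable S -> P S.
Proof.
move=> /dynkin_lambda_system lP PX S; rewrite [measurable]RGenInftyO.measurableE.
apply: (lambda_system_subset (G := @RGenInftyO.G R) _ lP) => //.
- move=> _ _ [x ->] [y ->]; exists (Num.min x y); apply/seteqP; split=> z /=.
    by rewrite !in_itv/= lt_min => -[-> ->].
  by rewrite !in_itv/= lt_min => /andP[].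
- by move=> _ [x ->]; exact: PX.
Qed.

End dynkin_classes.

(** * Translations and reflection of the line *)

Section lebesgue_invariance.
Context (R : realType).
Local Notation leb := (@lebesgue_measure R).

Lemma measurable_shift (c : R) : measurable_fun [set: R] (fun x => x + c).
Proof. exact: measurable_funD. Qed.

Lemma lebesgue_measure_shift (c : R) (A : set R) : measurable A ->
  leb ((fun x => x + c) @^-1` A) = leb A.
Proof.
move=> mA.
have mc : measurable_fun [set: measurableTypeR R]
    ((fun x => x + c) : measurableTypeR R -> measurableTypeR R).
  exact: (measurable_shift c).
pose sh : {mfun (measurableTypeR R) >-> (measurableTypeR R)} :=
  HB.pack (fun x : measurableTypeR R => x + c : measurableTypeR R)
    (isMeasurableFun.Build _ _ _ _ _ mc).
apply/esym; apply: (lebesgue_measure_unique (mu := pushforward leb sh)) => //.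
move=> _ [[a b] _ <-]; rewrite /pushforward/=.
transitivity (leb `]a - c, b - c]%classic); last first.
  by congr (leb _); apply/seteqP; split=> x /=; rewrite !in_itv/= ltrBlDr lerBrDr.
rewrite !lebesgue_measure_itv/= !lte_fin ltrD2r.
by case: ifP => // _; rewrite -!EFinB; congr EFin; ring.
Qed.

Lemma lebesgue_measure_opp (A : set R) : measurable A ->
  leb (-%R @^-1` A) = leb A.
Proof.
move=> mA.
have mc : measurable_fun [set: measurableTypeR R]
    (-%R : measurableTypeR R -> measurableTypeR R).
  exact: (measurableT_comp (f := -%R : R -> R)).
pose sh : {mfun (measurableTypeR R) >-> (measurableTypeR R)} :=
  HB.pack (fun x : measurableTypeR R => - x : measurableTypeR R)
    (isMeasurableFun.Build _ _ _ _ _ mc).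
apply/esym; apply: (lebesgue_measure_unique (mu := pushforward leb sh)) => //.
move=> _ [[a b] _ <-]; rewrite /pushforward/=.
transitivity (leb `[- b, - a[%classic); last first.
  by congr (leb _); apply/seteqP; split=> x /=; rewrite !in_itv/= lerNl ltrNr andbC.
rewrite !lebesgue_measure_itv/= !lte_fin ltrN2.
by case: ifP => // _; rewrite -!EFinB; congr EFin; ring.
Qed.

End lebesgue_invariance.

(** * Representatives, arcs and Haar measure *)

Section circle_theory.
Context (R : realType).
Local Notation T := (circle R).
Local Notation leb := (@lebesgue_measure R).
Local Notation pr := (@circle_proj R).
Local Notation mu := (@circle_measure R).

(** The representative in [[0, 1[]. It is a measurable section of the projection, along which
    [circle_measure] becomes Lebesgue measure on the unit interval. *)
Definition circle_frac (c : T) : R := repr c - (Num.floor (repr c))%:~R.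

Lemma circle_proj_int (n : int) : pr n%:~R = 0.
Proof.
have -> : 0 = pr 0 by rewrite /circle_proj !piE.
by apply/circle_projP; rewrite subr0 intr_int.
Qed.

Lemma circle_proj_addz x (n : int) : pr (x + n%:~R) = pr x.
Proof. by rewrite circle_projD circle_proj_int addr0. Qed.

Lemma circle_proj_add1 x : pr (x + 1) = pr x.
Proof. exact: (circle_proj_addz x 1). Qed.

Lemma circle_proj0 : pr 0 = 0. Proof. exact: (circle_proj_int 0). Qed.

Lemma circle_projN x : pr (- x) = - pr x.
Proof. by apply/eqP; rewrite -addr_eq0 -circle_projD addNr circle_proj0. Qed.

Lemma circle_fracK (c : T) : pr (circle_frac c) = c.
Proof. by rewrite /circle_frac -intrN circle_proj_addz /circle_proj reprK. Qed.

Lemma circle_frac_ge0 c : 0 <= circle_frac c. Proof. by rewrite subr_ge0 floor_le. Qed.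

Lemma circle_frac_lt1 c : circle_frac c < 1.
Proof. by rewrite ltrBlDl; have := floorD1_gt (repr c); rewrite intrD. Qed.

Lemma circle_proj_eq x y : pr x = pr y -> exists n : int, x = y + n%:~R.
Proof.
by move=> /circle_projP /intrP[n xyn]; exists n; rewrite -xyn addrC subrK.
Qed.

Lemma circle_frac_proj x : 0 <= x < 1 -> circle_frac (pr x) = x.
Proof.
move=> /andP[x0 x1]; have [n xn] := circle_proj_eq (circle_fracK (pr x)).
have := circle_frac_ge0 (pr x); have := circle_frac_lt1 (pr x); rewrite xn => h1 h2.
have : (n%:~R : R) < 1%:~R by lra.
have : (-1)%:~R < (n%:~R : R) by lra.
rewrite !ltr_int => n1 n2; have -> : n = 0 by lia.
by rewrite addr0.
Qed.

Lemma circle_fracD c x : 0 <= x < 1 ->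
  circle_frac (c + pr x) =
  if circle_frac c + x < 1 then circle_frac c + x else circle_frac c + x - 1.
Proof.
move=> /andP[x0 x1]; have c0 := circle_frac_ge0 c; have c1 := circle_frac_lt1 c.
have -> : c + pr x = pr (circle_frac c + x) by rewrite circle_projD circle_fracK.
case: ltP => cx; first by rewrite circle_frac_proj//; apply/andP; split; lra.
rewrite -[in LHS](subrK 1 (circle_frac c + x)) circle_proj_add1.
by rewrite circle_frac_proj//; apply/andP; split; lra.
Qed.

Lemma measurable_circle_frac : measurable_fun [set: T] circle_frac.
Proof.
move=> _ V mV; rewrite setTI /measurable/= /circle_measurable/=.
pose I01 : set R := `[0, 1[%classic.
have -> : pr @^-1` (circle_frac @^-1` V) =
    \bigcup_(n : int) ((fun x => x + (- n%:~R)) @^-1` (V `&` I01)).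
  apply/seteqP; split=> x /=.
    move=> Vx; have [n xn] := circle_proj_eq (circle_fracK (pr x)).
    exists (- n) => //=; rewrite intrN opprK -xn; split=> //.
    by rewrite /I01/= in_itv/= circle_frac_ge0 circle_frac_lt1.
  move=> [n _ /= [Vx]]; rewrite /I01/= in_itv/= => xn.
  by rewrite -(subrK n%:~R x) circle_proj_addz circle_frac_proj.
apply: countable_bigcupT_measurable => // n.
rewrite -[_ @^-1` _]setTI; apply: measurable_shift => //.
by apply: measurableI => //; exact: measurable_itv.
Qed.

Lemma measurable_proj_preimage (A : set T) : measurable A -> measurable (pr @^-1` A).
Proof. by []. Qed.

Lemma circle_measureE (A : set T) :
  mu A = leb ((pr @^-1` A) `&` `[0, 1[%classic).
Proof. by []. Qed.

Lemma circle_measure_frac (V : set R) :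
  mu (circle_frac @^-1` V) = leb (V `&` `[0, 1[%classic).
Proof.
rewrite circle_measureE; congr (leb _); apply/seteqP; split=> x /=;
  rewrite in_itv/= => -[Vx x01]; split=> //.
  by move: Vx; rewrite circle_frac_proj.
by rewrite circle_frac_proj.
Qed.

(** Only arcs that start at 0: they are nested, hence stable under intersection. The parameter is
    unrestricted; the arc is empty for [v <= 0] and the whole circle for [v >= 1]. *)
Definition circle_arc (v : R) : set T := [set c | circle_frac c < v].

Lemma circle_arcE v : circle_arc v = circle_frac @^-1` `]-oo, v[%classic.
Proof. by apply/seteqP; split=> c; rewrite /circle_arc/= in_itv. Qed.

Lemma measurable_circle_arc v : measurable (circle_arc v).
Proof. by rewrite circle_arcE -[_ @^-1` _]setTI; exact: measurable_circle_frac. Qed.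

(** Each set is the [circle_frac]-preimage of its own lift to the line, so the class can be pulled
    back to the line, where half-lines generate. *)
Lemma circle_dynkin (P : set (set T)) : dynkin P ->
  (forall v, P (circle_arc v)) -> forall A, measurable A -> P A.
Proof.
move=> [PT PC PU] Parc A mA.
have -> : A = circle_frac @^-1` (pr @^-1` A).
  by apply/seteqP; split=> c /=; rewrite circle_fracK.
apply: (real_dynkin (P := fun V => P (circle_frac @^-1` V))) => //.
- split; first by rewrite preimage_setT.
  + by move=> V PV; rewrite preimage_setC; exact: PC.
  + move=> F tF PF; rewrite preimage_bigcup; apply: PU => //.
    exact: trivIset_preimage.
Qed.

Lemma measurable_circle_add :
  measurable_fun [set: T * T] (fun x => x.1 + x.2).
Proof.
have -> : (fun x : T * T => x.1 + x.2) = pr \o (fun x => circle_frac x.1 + circle_frac x.2).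
  by apply/funext => x /=; rewrite circle_projD !circle_fracK.
apply: measurableT_comp; first exact: measurable_circle_proj.
by apply: measurable_funD; apply: measurableT_comp => //; exact: measurable_circle_frac.
Qed.

Lemma measurable_circle_opp : measurable_fun [set: T] (-%R).
Proof.
have -> : (-%R : T -> T) = pr \o (fun x => - circle_frac x).
  by apply/funext => x /=; rewrite circle_projN circle_fracK.
apply: measurableT_comp; first exact: measurable_circle_proj.
by apply: measurableT_comp => //; exact: measurable_circle_frac.
Qed.

Lemma measurable_circleD d (X : measurableType d) (f g : X -> T) :
  measurable_fun setT f -> measurable_fun setT g ->
  measurable_fun setT (fun x => f x + g x).
Proof.
move=> mf mg; apply: (measurableT_comp measurable_circle_add
  (g := fun x => (f x, g x))).
exact: measurable_fun_pair.
Qed.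

Lemma measurable_circleN d (X : measurableType d) (f : X -> T) :
  measurable_fun setT f -> measurable_fun setT (fun x => - f x).
Proof. by move=> mf; exact: measurableT_comp measurable_circle_opp _. Qed.

Lemma circle_measure_add (c : T) (A : set T) : measurable A ->
  mu ((fun x => x + c) @^-1` A) = mu A.
Proof.
move=> mA; rewrite -(circle_fracK c); set t := circle_frac c.
have t0 : 0 <= t := circle_frac_ge0 c.
have t1 : t < 1 := circle_frac_lt1 c.
have mB := measurable_proj_preimage mA; set B := pr @^-1` A in mB *.
have mI (a b : R) : measurable (B `&` `[a, b[%classic) by exact: measurableI.
rewrite !circle_measureE -/B.
have -> : pr @^-1` ((fun x => x + pr t) @^-1` A) `&` `[0, 1[%classic =
    (fun x => x + t) @^-1` (B `&` `[t, 1 + t[%classic).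
  apply/seteqP; split=> x /=; rewrite !in_itv/= /B/= circle_projD => -[Ax];
    (move=> /andP[x0 x1]; split=> //; apply/andP; split); lra.
rewrite lebesgue_measure_shift//.
(* The window [[t, 1 + t[] is cut at 1 and the piece beyond 1 is brought back by the period. *)
have cut (a b d : R) : a <= b <= d -> leb (B `&` `[a, d[%classic) =
    (leb (B `&` `[a, b[%classic) + leb (B `&` `[b, d[%classic))%E.
  move=> /andP[ab bd]; transitivity (leb ((B `&` `[a, b[%classic) `|` (B `&` `[b, d[%classic))).
    congr (leb _); rewrite -setIUr; congr (_ `&` _).
    apply/seteqP; split=> x /=; rewrite !in_itv/=.
      by move=> /andP[ax xd]; have [xb|xb] := ltP x b; [left|right];
        rewrite ?ax ?xd ?xb.
    by move=> [] /andP[h1 h2]; apply/andP; split; lra.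
  apply: measureU; [exact: mI|exact: mI|]; apply/seteqP; split=> x //=.
  by rewrite !in_itv/= => -[[_ /andP[_ x1]] [_ /andP[x1' _]]]; lra.
rewrite (cut t 1 (1 + t)) ?(cut 0 t 1); [|by apply/andP; split; lra..].
rewrite addeC; congr (_ + _)%E.
rewrite -[LHS](lebesgue_measure_shift 1 (mI 1 (1 + t))); congr (leb _).
apply/seteqP; split=> x /=; rewrite !in_itv/= /B/= circle_proj_add1 => -[Ax];
  (move=> /andP[x0 x1]; split=> //; apply/andP; split); lra.
Qed.

Lemma circle_measure_opp (A : set T) : measurable A ->
  mu (-%R @^-1` A) = mu A.
Proof.
move=> mA; have mB := measurable_proj_preimage mA; set B := pr @^-1` A in mB *.
rewrite !circle_measureE -/B.
(* Reflection turns [[0, 1[] into []-1, 0]]. Removing the null point 0 makes the window symmetric,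
   and a shift by 1 then matches the two sides. *)
have zero (S : set R) : measurable S -> leb (S `&` [set 0]) = 0%E.
  move=> mS; apply/eqP; rewrite eq_le measure_ge0 andbT.
  rewrite -(lebesgue_measure_set1 (0 : R)); apply: le_measure; rewrite ?inE//.
  exact: measurableI.
have split0 (S : set R) : measurable S ->
    leb (S `&` `[0, 1[%classic) = leb (S `&` `]0, 1[%classic).
  move=> mS; have -> : `[0, 1[%classic = [set 0] `|` `]0, 1[%classic :> set R.
    apply/seteqP; split=> x /=; rewrite !in_itv/=.
      by move=> /andP[]; rewrite le_eqVlt => /orP[/eqP<-|-> ->]; [left|right].
    by move=> [->|/andP[/ltW-> ->]]; rewrite ?lexx ?ltr01.
  rewrite setIUr; set I01 : set R := `]0, 1[%classic.
  transitivity (leb (S `&` [set 0%R]) + leb (S `&` I01))%E.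
    apply: measureU; [exact: measurableI|by apply: measurableI => //; exact: measurable_itv|].
    by apply/seteqP; split=> x //=; rewrite /I01/= in_itv/= => -[[_ ->] []]; rewrite ltxx.
  by rewrite zero// add0e.
have mNB : measurable (-%R @^-1` B).
  rewrite -[_ @^-1` _]setTI; suff : measurable_fun [set: R] (-%R : R -> R) by exact.
  exact: oppr_measurable.
have -> : pr @^-1` (-%R @^-1` A) = -%R @^-1` B.
  by apply/seteqP; split=> x /=; rewrite /B/= circle_projN.
rewrite !split0//.
have mI : measurable (B `&` `]0, 1[%classic) by exact: measurableI.
rewrite -(lebesgue_measure_shift 1 mI) -lebesgue_measure_opp.
  congr (leb _); apply/seteqP; split=> x /=; rewrite !in_itv/= /B/= circle_proj_add1 opprK.
    by move=> [Ax /andP[x0 x1]]; split=> //; apply/andP; split; lra.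
  by move=> [Ax /andP[x0 x1]]; split=> //; apply/andP; split; lra.
exact: measurableI.
Qed.

Lemma preserves_circle_affine (e : int) (c : T) : e = 1 \/ e = -1 ->
  preserves mu mu (fun x => x *~ e + c).
Proof.
have madd : measurable_fun [set: T] (fun x => x + c).
  by apply: measurable_circleD => //; exact: measurable_cst.
case=> ->.
  have -> : (fun x : T => x *~ 1 + c) = (fun x => x + c).
    by apply/funext => x; rewrite mulr1z.
  by split=> // A mA; exact: circle_measure_add.
have -> : (fun x : T => x *~ (-1) + c) = (fun x => x + c) \o -%R.
  by apply/funext => x; rewrite mulrN1z.
split; first by apply: measurableT_comp => //; exact: measurable_circle_opp.
move=> A mA; rewrite -[RHS](circle_measure_add c mA).
rewrite comp_preimage; apply: circle_measure_opp.
by rewrite -[_ @^-1` _]setTI; exact: madd.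
Qed.

Lemma preserves_circle_add (c : T) : preserves mu mu (fun x => x + c).
Proof.
have := preserves_circle_affine c (or_introl erefl).
by have -> : (fun x : T => x *~ 1 + c) = (fun x => x + c)
  by apply/funext => x; rewrite mulr1z.
Qed.

(** A translation by [h] changes the indicator only where the moved point crosses one of the two
    ends of the arc, [v] or 0. *)
Lemma circle_arc_lipschitz (v h : R) :
  \int[mu]_y `|\1_(circle_arc v) (y + pr h) - \1_(circle_arc v) y| <= 2 * `|h|.
Proof.
have bS (c : T) : bounded_meas (fun y : T => (\1_(circle_arc v) (y + c) : R)).
  apply: (bounded_meas_comp (p := fun y : T => y + c) (preserves_circle_add c).1).
  exact: (bounded_meas_indic _ (measurable_circle_arc v)).
have bS0 : bounded_meas (fun y : T => (\1_(circle_arc v) y : R)).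
  exact: (bounded_meas_indic _ (measurable_circle_arc v)).
(* Substituting [y + h] for [y] exchanges the two terms of the difference and changes the sign of
   [h]. *)
wlog h0 : h / 0 <= h.
  move=> H; have [|h0] := leP 0 h; first exact: H.
  rewrite -normrN; have h1 : 0 <= - h by lra.
  apply: le_trans (H _ h1); rewrite le_eqVlt; apply/orP; left; apply/eqP.
  rewrite -(mean_preserves (F := fun y : T =>
      `|\1_(circle_arc v) (y + pr (- h)) - \1_(circle_arc v) y|)
    (preserves_circle_add (pr h))).
    apply: eq_Rintegral => y _; rewrite -addrA -circle_projD subrr circle_proj0 addr0.
    by rewrite distrC.
  by apply: bounded_meas_norm; exact: bounded_measB.
rewrite (ger0_norm h0); have [h1|h1] := ltP h 1; last first.
  apply: (@le_trans _ _ (\int[mu]_y (1 : R))); last by rewrite mean_cst; lra.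
  apply: mean_le; [by apply: bounded_meas_norm; exact: bounded_measB|exact: bounded_meas_cst|].
  move=> y; rewrite !indicE.
  by do 2 case: (_ \in _); rewrite /= ?subrr ?subr0 ?sub0r ?normrN ?normr1 ?normr0.
(* The points that cross [a] during the translation; the end 0 of the arc is reached through
   [a = 1]. *)
pose I (a : R) : set T := circle_frac @^-1` `[a - h, a[%classic.
have mI a : measurable (I a) by rewrite -[I a]setTI; exact: measurable_circle_frac.
have mIh a : fine (mu (I a)) <= h.
  have -> : h = fine (leb `[a - h, a[%classic).
    rewrite lebesgue_measure_itv/= lte_fin; case: ltP => ah /=; first by ring.
    by lra.
  apply: fine_le; rewrite ?fin_num_measure//.
    rewrite lebesgue_measure_itv/=; case: ifP => //.
  rewrite [leLHS]circle_measure_frac; apply: le_measure; rewrite ?inE//.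
  exact: measurableI.
apply: (@le_trans _ _ (\int[mu]_y (\1_(I v) y + \1_(I 1) y))); last first.
  rewrite meanD; [|exact: bounded_meas_indic|exact: bounded_meas_indic].
  by rewrite !mean_indic//; have := mIh v; have := mIh 1; lra.
apply: mean_le; [by apply: bounded_meas_norm; exact: bounded_measB| |].
  by apply: bounded_measD; exact: bounded_meas_indic.
move=> y; rewrite !indicE.
have y0 := circle_frac_ge0 y; have y1 := circle_frac_lt1 y.
have -> : (y \in I v) = (v - h <= circle_frac y < v).
  by apply/idP/idP; rewrite inE /I/= in_itv.
have -> : (y \in I 1) = (1 - h <= circle_frac y < 1).
  by apply/idP/idP; rewrite inE /I/= in_itv.
have -> : (y + pr h \in circle_arc v) = (circle_frac (y + pr h) < v) by apply/idP/idP; rewrite inE.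
have -> : (y \in circle_arc v) = (circle_frac y < v) by apply/idP/idP; rewrite inE.
rewrite circle_fracD ?h0//.
case: ifPn; rewrite -?leNgt => yh.
  have [h2|h2] := ltP (circle_frac y) v; have [h3|h3] := ltP (circle_frac y + h) v;
  rewrite /= ?subrr ?normr0 ?addr_ge0 ?ler0n//; last by lra.
  have -> : v - h <= circle_frac y by lra.
  by rewrite sub0r normrN normr1 lerDl ler0n.
have -> : 1 - h <= circle_frac y by lra.
rewrite y1/=.
have [h2|h2] := ltP (circle_frac y) v; have [h3|h3] := ltP (circle_frac y + h - 1) v;
  rewrite /= ?subrr ?subr0 ?sub0r ?normrN ?normr1 ?normr0 ?addr_ge0 ?ler0n ?lerDr ?ler0n//.
Qed.

End circle_theory.

(** * Independence as a product law *)

Section independence.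
Context (R : realType).

Lemma preserves_id d (X : measurableType d) (mu : probability X R) :
  preserves mu mu id.
Proof. by split; first exact: measurable_id. Qed.

Lemma indic_preimage_apply (X Y : Type) (p : X -> Y) (A : set Y) x :
  \1_(p @^-1` A) x = \1_A (p x) :> R.
Proof.
by rewrite !indicE; congr (nat_of_bool _)%:R; apply/idP/idP; rewrite !inE.
Qed.

(** With [W] the whole space this compares two laws; with [W] an event it is the class of sets on
    which [p] is independent of [W]. Both uses occur. *)
Lemma dynkin_indep d1 d2 (X : measurableType d1) (A : measurableType d2)
    (mu : probability X R) (al : probability A R) (p : X -> A) (W : set X) :
  measurable_fun [set: X] p -> measurable W ->
  dynkin [set S | measurable S /\
    mu (p @^-1` S `&` W) = (al S * mu W)%E].
Proof.
move=> mp mW; split => /=.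
- by split=> //; rewrite preimage_setT setTI probability_setT mul1e.
- move=> S [mS SE]; split; first exact: measurableC.
  have mpS : measurable (p @^-1` S) by rewrite -[_ @^-1` _]setTI; exact: mp.
  rewrite preimage_setC setIC -setDE.
  transitivity (mu W - mu (W `&` p @^-1` S))%E.
    apply: measureD => //.
    by apply: le_lt_trans (probability_le1 mu mW) _; rewrite ltry.
  rewrite setIC SE; transitivity ((1 - al S) * mu W)%E.
    by rewrite muleBl ?fin_num_adde_defr ?fin_num_measure// mul1e.
  by congr (_ * _)%E; exact: esym (probability_setC _ _).
- move=> F tF PF; split; first by apply: bigcupT_measurable => i; have [] := PF i.
  rewrite preimage_bigcup setI_bigcupl measure_bigcup//=; last 2 first.
  + move=> i _; apply: measurableI => //; rewrite -[_ @^-1` _]setTI; apply: mp => //.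
    by have [] := PF i.
  + apply: trivIset_setIr; exact: trivIset_preimage.
  rewrite measure_bigcup//=; last by move=> i _; have [] := PF i.
  have muWfin : mu W \is a fin_num by exact: fin_num_measure.
  rewrite muleC -(fineK muWfin) -nneseriesZl//.
  by apply: eq_eseriesr => i _; rewrite (fineK muWfin) muleC; have [] := PF i.
Qed.

(** Independence of [p] and [q] is expressed throughout by the pair having a product law; here it is
    recovered from rectangles. *)
Lemma preserves_pair d1 d2 d3 (X : measurableType d1) (A : measurableType d2)
    (B : measurableType d3) (mu : probability X R) (al : probability A R)
    (be : probability B R) (p : X -> A) (q : X -> B) :
  measurable_fun setT p -> measurable_fun setT q ->
  (forall S S', measurable S -> measurable S' ->
    mu (p @^-1` S `&` q @^-1` S') = (al S * be S')%E) ->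
  preserves mu (al \x be)%E (fun x => (p x, q x)).
Proof.
move=> mp mq h; have mpq := measurable_fun_pair mp mq; split=> // S mS.
have := @prod_dynkin _ _ A B _ (dynkin_indep mu (al \x be)%E mpq measurableT).
move=> /(_ _ S mS)[|_]; last by rewrite setIT probability_setT mule1.
move=> S1 S2 mS1 mS2; split; first exact: measurableX.
by rewrite setIT probability_setT mule1 [RHS]product_measure1E// -h.
Qed.

Lemma preserves_pairE d1 d2 d3 (X : measurableType d1) (A : measurableType d2)
    (B : measurableType d3) (mu : probability X R) (al : probability A R)
    (be : probability B R) (p : X -> A) (q : X -> B) S S' :
  preserves mu (al \x be)%E (fun x => (p x, q x)) ->
  measurable S -> measurable S' ->
  mu (p @^-1` S `&` q @^-1` S') = (al S * be S')%E.
Proof.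
move=> [_ h] mS mS'; rewrite -[RHS]product_measure1E// -[RHS]h//.
exact: measurableX.
Qed.

Lemma mean_prod d1 d2 (X : measurableType d1) (Y : measurableType d2)
    (mu : probability X R) (nu : probability Y R) (F : X -> R) (G : Y -> R) :
  bounded_meas F -> bounded_meas G ->
  \int[(mu \x nu)%E]_x (F x.1 * G x.2) = (\int[mu]_x F x) * \int[nu]_y G y.
Proof.
move=> bF bG; rewrite mean_fubini; last first.
  apply: bounded_measM; first exact: (bounded_meas_comp (p := fst)).
  exact: (bounded_meas_comp (p := snd)).
rewrite mulrC -meanZ//; apply: eq_Rintegral => x _ /=.
by rewrite meanZ// mulrC.
Qed.

End independence.

(** * Weakly mixing factors of circle extensions *)

Section toeplitz.
Context (R : realType).

(** Each lag [k] occurs for at most [2 N] pairs; the induction adds one row and one column. It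
    bounds the double sum that arises from squaring an ergodic sum, whose terms depend only on the
    lag. *)
Lemma toeplitz_sum_le (b : nat -> R) (b0 : forall k, 0 <= b k) (N : nat) :
  \sum_(j < N) \sum_(l < N) b `|j - l|%N <= 2 * N%:R * \sum_(k < N) b k.
Proof.
elim: N => [|N ih]; first by rewrite !big_ord0 mulr0.
have row : \sum_(l < N) b `|N - l|%N <= \sum_(k < N.+1) b k.
  rewrite big_ord_recl/= -[leLHS]add0r lerD//.
  rewrite (reindex_inj rev_ord_inj)/=; apply: ler_sum => k _.
  by rewrite le_eqVlt; apply/orP; left; apply/eqP; congr b; rewrite /bump; have := ltn_ord k; lia.
rewrite big_ord_recr/=.
under eq_bigr do rewrite big_ord_recr/=.
rewrite big_split/= [X in _ + X]big_ord_recr/=.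
have -> : `|N - N|%N = 0%N by lia.
have -> : \sum_(i < N) b `|i - N|%N = \sum_(i < N) b `|N - i|%N.
  by apply: eq_bigr => i _; congr b; lia.
have b00 : b 0%N + \sum_(k < N) b k.+1 = \sum_(k < N.+1) b k.
  by rewrite big_ord_recl.
have row' : \sum_(l < N) b `|N - l|%N = \sum_(k < N) b k.+1.
  rewrite (reindex_inj rev_ord_inj)/=; apply: eq_bigr => k _.
  by congr b; have := ltn_ord k; lia.
have mono : \sum_(k < N) b k <= \sum_(k < N.+1) b k.
  by rewrite big_ord_recr/= lerDl.
have mono2 : N%:R * \sum_(k < N) b k <= N%:R * \sum_(k < N.+1) b k.
  exact: ler_wpM2l.
rewrite row' -natr1; have := b0 0%N.
move: ih mono2 b00; set A := \sum_(j < N) _; set S := \sum_(k < N) b k.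
set S1 := \sum_(k < N.+1) b k; set S2 := \sum_(k < N) b k.+1.
move=> ih mono2 b00 b00'; lra.
Qed.

End toeplitz.

(* A weakly mixing factor that is independent of the base of a circle
   extension is independent of the whole extension.  With [chi] a centred
   indicator on the factor, the energy
     int_z int_p int_p' chi(q(z,p)) chi(q(z,p')) kappa(s p, s p'),
     kappa(a, b) = int_t 1_D(a + t) 1_D(b + t),
   is invariant under [chi |-> chi \o f], so it is also the mean of the
   energies of the iterates; Cauchy-Schwarz and weak mixing make it vanish.
   It is on the other hand the L2 norm of the conditional expectations of
   [chi] against the translates of 1_D. *)
Section circle_extension.
Context (R : realType) (d1 d2 d3 : measure_display).
Context (Z : measurableType d1) (P : measurableType d2) (Y : measurableType d3).
Context (muZ : probability Z R) (muP : probability P R) (nu : probability Y R).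
Local Notation T := (circle R).
Local Notation mu := (@circle_measure R).
Local Notation M := (muZ \x muP)%E.
Let L : probability (Z * (P * P))%type R := (muZ \x (muP \x muP))%E.
(** [P] carries every coordinate above the base [Z]. Only its circle coordinate [s] has to move by
    an affine map depending on the base; the other coordinates may be moved by any
    measure-preserving fibre maps. *)
Context (f : Y -> Y) (q : Z * P -> Y) (s : P -> T) (g : Z -> Z)
  (G : Z * P -> P) (gam : Z -> T) (e : int) (X0 : set (Z * P)).
Hypothesis f_wm : weakly_mixing nu f.
Hypothesis mq : measurable_fun setT q.
Hypothesis ps : preserves muP mu s.
Hypothesis pg : preserves muZ muZ g.
Hypothesis mG : measurable_fun setT G.
Hypothesis pG : forall z, preserves muP muP (fun p => G (z, p)).
Hypothesis e1 : e = 1 \/ e = -1.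
Hypothesis sG : forall z p, s (G (z, p)) = s p *~ e + gam z.
Hypothesis mX0 : measurable X0.
Hypothesis X01 : M X0 = 1%E.
(** An isomorphism yields the factor relation only on a set of full measure. *)
Hypothesis qG : forall x, X0 x -> q (g x.1, G x) = f (q x).
Hypothesis indep : preserves M (muZ \x nu)%E (fun x => (x.1, q x)).

Let pf : preserves nu nu f.
Proof. exact: f_wm.1. Qed.

Let piter k : preserves nu nu (iter k f).
Proof.
elim: k => [|k ih]; first exact: preserves_id.
exact: (preserves_comp ih pf).
Qed.

Let p1 (x : Z * (P * P)) : Z * P := (x.1, x.2.1).
Let p2 (x : Z * (P * P)) : Z * P := (x.1, x.2.2).

Let pp1 : preserves L M p1.
Proof.
apply: (preserves_skew (s := id) (t := fun x : Z * (P * P) => x.2.1)).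
- exact: preserves_id.
- exact: measurableT_comp.
- by move=> z; exact: preserves_fst.
Qed.

Let pp2 : preserves L M p2.
Proof.
apply: (preserves_skew (s := id) (t := fun x : Z * (P * P) => x.2.2)).
- exact: preserves_id.
- exact: measurableT_comp.
- by move=> z; exact: preserves_snd.
Qed.

(** The map induced on pairs of points over a common base point; it is well defined because the base
    moves on its own. *)
Let Gam (x : Z * (P * P)) : Z * (P * P) := (g x.1, (G (p1 x), G (p2 x))).

Let pGam : preserves L L Gam.
Proof.
apply: (preserves_skew (s := g) (t := fun x => (G (p1 x), G (p2 x)))) => //.
  apply: measurable_fun_pair.
    exact: measurableT_comp mG pp1.1.
  exact: measurableT_comp mG pp2.1.
move=> z; apply: (preserves_skew (s := fun p => G (z, p))
  (t := fun x : P * P => G (z, x.2))) => //.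
by apply: (measurableT_comp (pG z).1).
Qed.

(** As [q] is independent of the base, the fibre mean [r] of [U] has mean [a] against every test
    function. Testing against 1 and against [r] itself gives [a^2] for the mean of [r^2], with no
    recourse to [r] being almost everywhere constant. *)
Lemma mean_fiber_sq (U : Y -> R) : bounded_meas U ->
  \int[L]_x (U (q (p1 x)) * U (q (p2 x))) = (\int[nu]_y U y) ^+ 2.
Proof.
move=> bU; set a := \int[nu]_y U y.
have bUq : bounded_meas (fun x => U (q x)) by exact: (bounded_meas_comp mq bU).
pose r z := \int[muP]_p U (q (z, p)).
have br : bounded_meas r by exact: (bounded_meas_fubini muZ muP bUq).
have key (F : Z -> R) : bounded_meas F ->
    \int[muZ]_z (F z * r z) = a * \int[muZ]_z F z.
  move=> bF.
  have bFU : bounded_meas (fun x : Z * Y => F x.1 * U x.2).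
    apply: bounded_measM.
      by apply: (bounded_meas_comp (p := fst)).
    by apply: (bounded_meas_comp (p := snd)).
  transitivity (\int[M]_x (F x.1 * U (q x))).
    rewrite mean_fubini; last exact: (bounded_meas_comp indep.1 bFU).
    apply: eq_Rintegral => z _ /=; rewrite meanZ//.
    exact: (bounded_meas_comp (p := pair z) _ bUq).
  rewrite (mean_preserves indep bFU) mean_fubini//=.
  rewrite -meanZ//; apply: eq_Rintegral => z _.
  by rewrite meanZ// mulrC.
have rr : \int[muZ]_z (r z * r z) = a * a.
  rewrite key//; congr (_ * _).
  have := key _ (bounded_meas_cst Z 1).
  by rewrite mean_cst mulr1 => <-; apply: eq_Rintegral => z _; rewrite mul1r.
rewrite expr2 -rr mean_fubini; last first.
  by apply: bounded_measM;
    [exact: (bounded_meas_comp pp1.1 bUq)|exact: (bounded_meas_comp pp2.1 bUq)].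
apply: eq_Rintegral => z _.
have bUz : bounded_meas (fun p => U (q (z, p))) by exact: (bounded_meas_comp (p := pair z) _ bUq).
rewrite mean_fubini/=; last first.
  apply: bounded_measM.
    by apply: (bounded_meas_comp (p := fst) (F := fun p => U (q (z, p)))).
  by apply: (bounded_meas_comp (p := snd) (F := fun p => U (q (z, p)))).
rewrite /p1/p2/= -[in RHS]meanZ//; apply: eq_Rintegral => p _.
by rewrite meanZ// mulrC.
Qed.

Section energy.
Context (v : R).
Let D : set T := circle_arc v.
Let mD : measurable D. Proof. exact: measurable_circle_arc. Qed.

Let kap (a b : T) : R := \int[mu]_t (\1_D (a + t) * \1_D (b + t)).

Let bD d (X : measurableType d) (h : X -> T) : measurable_fun setT h ->
  bounded_meas (fun x => (\1_D (h x) : R)).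
Proof. by move=> mh; apply: (bounded_meas_comp mh); exact: bounded_meas_indic. Qed.

Let bDD a b : bounded_meas (fun t : T => (\1_D (a + t) * \1_D (b + t) : R)).
Proof.
by apply: bounded_measM; apply: bD; apply: measurable_circleD => //; exact: measurable_cst.
Qed.

Let kap01 a b : 0 <= kap a b <= 1.
Proof.
apply/andP; split; first by apply: mean_ge0 => t; rewrite mulr_ge0.
rewrite -[leRHS](mean_cst mu); apply: mean_le => //; exact: bounded_meas_cst.
Qed.

Let kap_shift a b c : kap (a + c) (b + c) = kap a b.
Proof.
rewrite /kap -[RHS](mean_preserves (preserves_circle_add c))//.
by apply: eq_Rintegral => t _; rewrite -!addrA (addrC c t).
Qed.

(** The substitution of [t + (a + b)] for [t] exchanges the roles of [a] and [b]. This is what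
    absorbs the reflections [e = -1]. *)
Let kap_opp a b : kap (- a) (- b) = kap a b.
Proof.
rewrite /kap -[LHS](mean_preserves (preserves_circle_add (a + b)))//.
apply: eq_Rintegral => t _.
have -> : - a + (t + (a + b)) = b + t.
  by rewrite addrC -addrA [a + b]addrC addrK addrC.
have -> : - b + (t + (a + b)) = a + t by rewrite addrC -addrA addrK addrC.
by rewrite mulrC.
Qed.

(** Two points over the same [z] receive the same translation [gam z] and the same sign, so their
    difference is kept up to sign. *)
Let kapG z p p' : kap (s (G (z, p))) (s (G (z, p'))) = kap (s p) (s p').
Proof.
rewrite !sG kap_shift; case: e1 => ->; first by rewrite !mulr1z.
by rewrite !mulrN1z kap_opp.
Qed.

Let bkap3 : bounded_meas (fun x : (P * P) * T =>
  (\1_D (s x.1.1 + x.2) * \1_D (s x.1.2 + x.2) : R)).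
Proof.
apply: bounded_measM; apply: bD; apply: measurable_circleD => //.
  by apply: (measurableT_comp ps.1); exact: measurableT_comp.
by apply: (measurableT_comp ps.1); exact: measurableT_comp.
Qed.

Let bkap2 : bounded_meas (fun x : P * P => kap (s x.1) (s x.2)).
Proof. exact: (bounded_meas_fubini (muP \x muP)%E mu bkap3). Qed.

Let bkap : bounded_meas (fun x : Z * (P * P) => kap (s x.2.1) (s x.2.2)).
Proof. exact: (bounded_meas_comp (p := snd) _ bkap2). Qed.

Let energy (U : Y -> R) : R :=
  \int[L]_x (U (q (p1 x)) * U (q (p2 x)) * kap (s x.2.1) (s x.2.2)).

Let bU1 (U : Y -> R) : bounded_meas U -> bounded_meas (fun x => U (q (p1 x))).
Proof. by move=> bU; exact: (bounded_meas_comp pp1.1 (bounded_meas_comp mq bU)). Qed.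

Let bU2 (U : Y -> R) : bounded_meas U -> bounded_meas (fun x => U (q (p2 x))).
Proof. by move=> bU; exact: (bounded_meas_comp pp2.1 (bounded_meas_comp mq bU)). Qed.

Let benergy (U : Y -> R) : bounded_meas U -> bounded_meas (fun x =>
  U (q (p1 x)) * U (q (p2 x)) * kap (s x.2.1) (s x.2.2)).
Proof.
by move=> bU; apply: bounded_measM => //; apply: bounded_measM; [exact: bU1|exact: bU2].
Qed.

(** Change of variables along [Gam]. The two integrands agree unless one of the two points lies
    outside [X0], which is a null event for each of them. *)
Let energy_invariant (U : Y -> R) : bounded_meas U -> (forall y, `|U y| <= 1) ->
  energy (U \o f) = energy U.
Proof.
move=> bU U1; have bUf : bounded_meas (U \o f) by exact: (bounded_meas_comp pf.1 bU).
rewrite /energy -[RHS](mean_preserves pGam (benergy bU)).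
apply/eqP; rewrite -subr_eq0 -meanB; [|exact: benergy|]; last first.
  exact: (bounded_meas_comp pGam.1 (benergy bU)).
set F := (X in \int[L]_x X x); have bF : bounded_meas F.
  by apply: bounded_measB; [exact: benergy|exact: (bounded_meas_comp pGam.1 (benergy bU))].
rewrite -normr_le0; apply: le_trans (mean_norm _ bF) _.
have mN : measurable (~` X0) by exact: measurableC.
have N0 : \int[M]_x \1_(~` X0) x = 0.
  rewrite mean_indic//; suff : M (~` X0) = 0%E by move=> h; rewrite [X in fine X]h.
  transitivity (1 - M X0)%E; first exact: (probability_setC M mX0).
  by rewrite [X in (1 - X)%E]X01 subee.
have bN := bounded_meas_indic R mN.
have bN1 := bounded_meas_comp pp1.1 bN; have bN2 := bounded_meas_comp pp2.1 bN.
(* The factor 2 bounds the difference of two integrands of absolute value at most 1. *)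
apply: (@le_trans _ _ (\int[L]_x (2 * (\1_(~` X0) (p1 x) + \1_(~` X0) (p2 x))))); last first.
  rewrite meanZ; last exact: bounded_measD.
  by rewrite meanD// (mean_preserves pp1 bN) (mean_preserves pp2 bN) N0 addr0 mulr0.
apply: mean_le.
- exact: bounded_meas_norm.
- by apply: bounded_measZ; exact: bounded_measD.
move=> x; have bd a b k : `|a| <= 1 -> `|b| <= 1 -> 0 <= k <= 1 -> `|a * b * k| <= 1 :> R.
  move=> a1 b1 /andP[k0 k1]; rewrite !normrM -[leRHS]mulr1 ler_pM//.
    by rewrite -[leRHS]mulr1 ler_pM.
  by rewrite ger0_norm.
have F2 : `|F x| <= 2.
  apply: le_trans (ler_normB _ _) _.
  by rewrite -[2%:R]/(1 + 1) lerD//; apply: bd; rewrite ?U1 ?kap01.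
rewrite !indicE; have [p1X|p1X] := boolP (p1 x \in ~` X0).
  by apply: le_trans F2 _; rewrite -[leLHS]mulr1 ler_pM2l// lerDl ler0n.
have [p2X|p2X] := boolP (p2 x \in ~` X0).
  by apply: le_trans F2 _; rewrite -[leLHS]mulr1 ler_pM2l// lerDr ler0n.
rewrite addr0 mulr0 normr_le0 subr_eq0; apply/eqP.
have {}p1X : X0 (p1 x) by apply: contrapT => h; move/negP : p1X; apply; rewrite inE.
have {}p2X : X0 (p2 x) by apply: contrapT => h; move/negP : p2X; apply; rewrite inE.
by rewrite /= -(qG p1X) -(qG p2X) /= kapG.
Qed.

Let corr (U : Y -> R) k : R := \int[nu]_y (U y * U (iter k f y)).

Let bUk (U : Y -> R) k : bounded_meas U -> bounded_meas (fun y => U (iter k f y)).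
Proof. exact: (bounded_meas_comp (piter k).1). Qed.

Let corr_iter (U : Y -> R) j l : bounded_meas U ->
  \int[nu]_y (U (iter j f y) * U (iter l f y)) = corr U `|j - l|%N.
Proof.
move=> bU; wlog jl : j l / (j <= l)%N.
  move=> H; have [/H//|/ltnW/H] := leqP j l.
  rewrite distnC => <-; apply: eq_Rintegral => y _; exact: mulrC.
have -> : `|j - l|%N = (l - j)%N by lia.
rewrite /corr -[RHS](mean_preserves (piter j)); last by apply: bounded_measM => //; exact: bUk.
by apply: eq_Rintegral => y _; rewrite -iterD subnK.
Qed.

Let corr_le1 (U : Y -> R) k : bounded_meas U -> (forall y, `|U y| <= 1) -> `|corr U k| <= 1.
Proof.
move=> bU U1; have bUU : bounded_meas (fun y => U y * U (iter k f y)).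
  by apply: bounded_measM => //; exact: bUk.
apply: le_trans (mean_norm _ bUU) _.
rewrite -[leRHS](mean_cst nu); apply: mean_le.
- exact: bounded_meas_norm.
- exact: bounded_meas_cst.
- by move=> y; rewrite normrM -[leRHS]mulr1 ler_pM.
Qed.

Let energy_iter (U : Y -> R) k : bounded_meas U -> (forall y, `|U y| <= 1) ->
  energy (fun y => U (iter k f y)) = energy U.
Proof.
move=> bU U1; elim: k => // k <-.
rewrite -(energy_invariant (bUk k bU))//.
by congr energy; apply/funext => y /=; rewrite -iterS iterSr.
Qed.

(** The energy equals the mean of the energies of the first [N] iterates, hence is at most the mean
    of [|S| / N]. Expanding [S^2] produces squares of correlations of [U], counted by lags. The free
    parameter [r] comes from [|S| <= r N + S^2 / (r N)]. *)
Let energy_le (U : Y -> R) (N : nat) (r : R) :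
  bounded_meas U -> (forall y, `|U y| <= 1) -> (0 < N)%N -> 0 < r ->
  `|energy U| <= r + r^-1 * (2 * (N%:R^-1 * \sum_(k < N) `|corr U k|)).
Proof.
move=> bU U1 N0 r0; have N0' : 0 < N%:R :> R by rewrite ltr0n.
pose W j (x : Z * (P * P)) := U (iter j f (q (p1 x))) * U (iter j f (q (p2 x))).
have bW j : bounded_meas (W j).
  by apply: bounded_measM; [exact: (bU1 (bUk j bU))|exact: (bU2 (bUk j bU))].
pose S x := \sum_(j < N) W j x.
have bS : bounded_meas S by exact: bounded_meas_sum.
have bSk : bounded_meas (fun x => S x * kap (s x.2.1) (s x.2.2)) by exact: bounded_measM.
have bSS : bounded_meas (fun x => S x * S x) by exact: bounded_measM.
have ES : N%:R * energy U = \int[L]_x (S x * kap (s x.2.1) (s x.2.2)).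
  under eq_Rintegral do rewrite /S mulr_suml.
  rewrite (mean_sum _ N (F := fun j x => W j x * kap (s x.2.1) (s x.2.2))); last first.
    by move=> i; exact: bounded_measM.
  have -> : N%:R * energy U = \sum_(j < N) energy U by rewrite sumr_const card_ord mulr_natl.
  by apply: eq_bigr => j _; exact: esym (energy_iter j bU U1).
have ESS : \int[L]_x (S x * S x) <= 2 * N%:R * \sum_(k < N) `|corr U k|.
  under eq_Rintegral do rewrite /S big_distrlr/=.
  rewrite (mean_sum _ N (F := fun j x => \sum_(l < N) (W j x * W l x))); last first.
    move=> j; apply: (bounded_meas_sum N (F := fun l x => W j x * W l x)) => l.
    exact: bounded_measM.
  apply: le_trans (toeplitz_sum_le (fun k => normr_ge0 (corr U k)) N).
  apply: ler_sum => j _.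
  rewrite (mean_sum _ N (F := fun l x => W j x * W l x)); last first.
    by move=> l; exact: bounded_measM.
  apply: ler_sum => l _; rewrite -(corr_iter j l bU).
  have bV : bounded_meas (fun y => U (iter j f y) * U (iter l f y)).
    by apply: bounded_measM; exact: bUk.
  have -> : \int[L]_x (W j x * W l x) =
      (\int[nu]_y (U (iter j f y) * U (iter l f y))) ^+ 2.
    by rewrite -mean_fiber_sq//; apply: eq_Rintegral => x _; rewrite /W; ring.
  (* A squared correlation is at most its absolute value, so weak mixing with absolute values is
     enough. *)
  rewrite corr_iter// -real_normK ?num_real// expr2 -[leRHS]mulr1 ler_pM//.
  exact: corr_le1.
rewrite -(ler_pM2l N0') -[X in X * _ <= _](gtr0_norm N0') -normrM ES.
apply: le_trans (mean_norm _ bSk) _.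
apply: (@le_trans _ _ (\int[L]_x (r * N%:R + (r * N%:R)^-1 * (S x * S x)))).
  apply: mean_le.
  - exact: bounded_meas_norm.
  - by apply: bounded_measD; [exact: bounded_meas_cst|exact: bounded_measZ].
  move=> x; apply: (@le_trans _ _ `|S x|).
    have /andP[k0 k1] := kap01 (s x.2.1) (s x.2.2).
    by rewrite normrM (ger0_norm k0) -[leRHS]mulr1 ler_pM.
  have rN : 0 < r * N%:R by exact: mulr_gt0.
  rewrite -(ler_pM2l rN); set a := r * N%:R in rN *.
  rewrite mulrDr (mulrA a a^-1) divff ?gt_eqF// mul1r -(expr2 (S x)).
  rewrite -[S x ^+ 2]real_normK ?num_real//.
  by have := sqr_ge0 (a - `|S x|); have := normr_ge0 (S x); nra.
rewrite meanD; [|exact: bounded_meas_cst|exact: bounded_measZ].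
rewrite mean_cst meanZ// mulrDr [N%:R * r]mulrC lerD2l.
have -> : N%:R * (r^-1 * (2 * (N%:R^-1 * \sum_(k < N) `|corr U k|))) =
    (r * N%:R)^-1 * (2 * N%:R * \sum_(k < N) `|corr U k|).
  by field; rewrite !gt_eqF.
by rewrite ler_pM2l// invr_gt0 mulr_gt0.
Qed.

Let energy_eq0 (U : Y -> R) : bounded_meas U -> (forall y, `|U y| <= 1) ->
  (fun n => n%:R^-1 * \sum_(k < n) `|corr U k|) @ \oo --> (0 : R) ->
  energy U = 0.
Proof.
move=> bU U1 cU; apply/eqP; rewrite -normr_le0; apply/ler_addgt0Pr => r r0.
rewrite add0r; have r2 : 0 < r / 2 by rewrite divr_gt0.
(* With [r / 2] as parameter of [energy_le], this bound on the Cesaro mean makes the second term at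
   most [r / 2]. *)
have del0 : 0 < (r / 2) ^+ 2 / 2 by rewrite divr_gt0// exprn_gt0.
move/cvgrPdist_le : cU => /(_ _ del0)[N _ /(_ N.+1 (leqnSn N))].
rewrite sub0r normrN /= => hN.
apply: le_trans (energy_le bU U1 (ltn0Sn N) r2) _.
have {}hN := le_trans (ler_norm _) hN.
set A := N.+1%:R^-1 * _ in hN *.
have : (r / 2)^-1 * (2 * A) <= (r / 2)^-1 * (r / 2) ^+ 2.
  by rewrite ler_pM2l ?invr_gt0//; move: hN; lra.
rewrite expr2 (mulKf (lt0r_neq0 r2)) => h; lra.

Qed.

Let slice (U : Y -> R) (x : Z * T) : R :=
  \int[muP]_p (U (q (x.1, p)) * \1_D (s p + x.2)).

Let bslice3 (U : Y -> R) : bounded_meas U -> bounded_meas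
  (fun x : (Z * T) * P => U (q (x.1.1, x.2)) * \1_D (s x.2 + x.1.2)).
Proof.
move=> bU; apply: bounded_measM.
  apply: (bounded_meas_comp (p := fun x : (Z * T) * P => (x.1.1, x.2)) _
    (bounded_meas_comp mq bU)).
  by apply: measurable_fun_pair => //; exact: measurableT_comp.
apply: bD; apply: measurable_circleD; last exact: measurableT_comp.
by apply: (measurableT_comp ps.1).
Qed.

Let bslice (U : Y -> R) : bounded_meas U -> bounded_meas (slice U).
Proof. by move=> bU; exact: (bounded_meas_fubini (muZ \x mu)%E muP (bslice3 bU)). Qed.

(** The square of a slice is an integral over two fibre points; integrating the translation first
    leaves [kap]. *)
Let energy_slice (U : Y -> R) : bounded_meas U ->
  energy U = \int[(muZ \x mu)%E]_x (slice U x ^+ 2).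
Proof.
move=> bU; have bs2 : bounded_meas (fun x => slice U x ^+ 2).
  by under eq_fun do rewrite expr2; apply: bounded_measM; exact: bslice.
rewrite mean_fubini// /energy mean_fubini; last exact: benergy.
apply: eq_Rintegral => z _ /=; rewrite /slice/= /p1 /p2/=.
pose u p := U (q (z, p)).
have bu : bounded_meas u by exact: (bounded_meas_comp (p := pair z) _ (bounded_meas_comp mq bU)).
have buu : bounded_meas (fun x : P * P => u x.1 * u x.2).
  apply: bounded_measM; first exact: (bounded_meas_comp (p := fst)).
  exact: (bounded_meas_comp (p := snd)).
have bH : bounded_meas (fun x : (P * P) * T => u x.1.1 * u x.1.2 *
    (\1_D (s x.1.1 + x.2) * \1_D (s x.1.2 + x.2))).
  by apply: bounded_measM => //; exact: (bounded_meas_comp (p := fst) _ buu).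
pose PPT : probability ((P * P) * T)%type R := ((muP \x muP) \x mu)%E.
transitivity (\int[PPT]_x (u x.1.1 * u x.1.2 *
    (\1_D (s x.1.1 + x.2) * \1_D (s x.1.2 + x.2)))).
  rewrite [RHS]mean_fubini//; apply: eq_Rintegral => -[p p'] _ /=.
  by rewrite meanZ.
rewrite [LHS]mean_fubini2//; apply: eq_Rintegral => t _ /=.
have bt : bounded_meas (fun p => u p * \1_D (s p + t)).
  apply: bounded_measM => //; apply: bD; apply: measurable_circleD; first exact: ps.1.
  exact: measurable_cst.
rewrite expr2 -mean_prod//; apply: eq_Rintegral => x _ /=; exact: mulrACA.
Qed.

(** The vanishing energy only says that the slices vanish for almost every translation [t], whereas
    [t = 0] is wanted. Averaged over [C], the slice is a Lipschitz function [B] of [t], by the bound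
    for translated arcs, so it vanishes at 0 as well. *)
Lemma slice_eq0 (U : Y -> R) (C : set Z) : bounded_meas U -> measurable C ->
  (forall y, `|U y| <= 1) ->
  (fun n => n%:R^-1 * \sum_(k < n) `|\int[nu]_y (U y * U (iter k f y))|) @ \oo
    --> (0 : R) ->
  \int[M]_x (\1_C x.1 * U (q x) * \1_(circle_arc v) (s x.2)) = 0.
Proof.
move=> bU mC U1 cU.
have bs := bslice bU; have bC := bounded_meas_indic R mC.
have abs0 : \int[(muZ \x mu)%E]_x `|slice U x| = 0.
  by apply: mean_eq0_sq => //; rewrite -energy_slice// energy_eq0.
pose B (t : T) := \int[muZ]_z (\1_C z * slice U (z, t)).
have bCs : bounded_meas (fun x : Z * T => \1_C x.1 * slice U x).
  by apply: bounded_measM => //; exact: (bounded_meas_comp (p := fst) _ bC).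
have bB : bounded_meas B by exact: (bounded_meas_fubini2 muZ mu bCs).
have B0 : \int[mu]_t `|B t| = 0.
  apply/eqP; rewrite eq_le mean_ge0// andbT -abs0 mean_fubini2; last exact: bounded_meas_norm.
  have bs' : bounded_meas (fun t : T => \int[muZ]_z `|slice U (z, t)|).
    exact: (bounded_meas_fubini2 muZ mu (bounded_meas_norm bs)).
  apply: mean_le => //; first exact: bounded_meas_norm.
  move=> t; have bst : bounded_meas (fun z => slice U (z, t)).
    exact: (bounded_meas_comp (p := fun z => (z, t)) _ bs).
  apply: le_trans (mean_norm _ _) _; first exact: bounded_measM.
  apply: mean_le; [by apply: bounded_meas_norm; exact: bounded_measM|exact: bounded_meas_norm|].
  move=> z; rewrite normrM indicE; case: (_ \in _); rewrite /= ?normr1 ?mul1r ?normr0 ?mul0r//.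
have bM (t : T) : bounded_meas (fun x : Z * P => \1_C x.1 * U (q x) * \1_D (s x.2 + t)).
  apply: bounded_measM.
    by apply: bounded_measM;
      [exact: (bounded_meas_comp (p := fst) _ bC)|exact: bounded_meas_comp mq bU].
  apply: bD; apply: measurable_circleD; last exact: measurable_cst.
  by apply: (measurableT_comp ps.1).
have BE t : B t = \int[M]_x (\1_C x.1 * U (q x) * \1_D (s x.2 + t)).
  rewrite mean_fubini//; apply: eq_Rintegral => z _ /=.
  rewrite /slice/= -meanZ.
    by apply: eq_Rintegral => p _; rewrite mulrA.
  exact: (bounded_meas_comp (p := pair (z, t)) _ (bslice3 bU)).
transitivity (B 0).
  by rewrite BE; apply: eq_Rintegral => x _; rewrite addr0.
have lip h : `|B (circle_proj h) - B 0| <= 2 * `|h|.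
  rewrite !BE -meanB//; apply: le_trans (mean_norm _ _) _; first exact: bounded_measB.
  pose W (y : T) : R := `|\1_D (y + circle_proj h) - \1_D y|.
  have bW : bounded_meas W.
    apply: bounded_meas_norm; apply: bounded_measB; last exact: bounded_meas_indic.
    by apply: bD; apply: measurable_circleD => //; exact: measurable_cst.
  have bWs : bounded_meas (fun x : Z * P => W (s x.2)).
    exact: (bounded_meas_comp (p := snd) _ (bounded_meas_comp ps.1 bW)).
  apply: (@le_trans _ _ (\int[M]_x W (s x.2))).
    apply: mean_le => //; first by apply: bounded_meas_norm; exact: bounded_measB.
    move=> x; rewrite addr0 -mulrBr normrM ler_piMl// normrM mulr_ile1//.
    by rewrite indicE; case: (_ \in _); rewrite /= ?normr1 ?normr0.
  have -> : \int[M]_x W (s x.2) = \int[mu]_y W y.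
    rewrite (mean_preserves (F := fun p => W (s p)) (preserves_snd muZ muP)); last first.
      exact: (bounded_meas_comp ps.1 bW).
    exact: mean_preserves.
  exact: circle_arc_lipschitz.
apply/eqP; rewrite -normr_le0; apply/ler_addgt0Pr => r r0; rewrite add0r.
(* The arc of length [r3] has positive measure, so it contains some [t] with [|B t| <= r / 3];
   moving from [t] to 0 costs at most [2 * r / 3]. *)
pose r3 := Num.min (r / 3) 1; have r30 : 0 < r3 by rewrite lt_min divr_gt0//=.
have Apos : (0 < mu (circle_arc r3))%E.
  rewrite circle_arcE circle_measure_frac.
  have -> : `]-oo, r3[%classic `&` `[0, 1[%classic = `[0, r3[%classic :> set R.
    apply/seteqP; split=> x /=; rewrite !in_itv/=; first by move=> [-> /andP[->]].
    move=> /andP[-> xr]; split=> //=; apply: lt_le_trans xr _.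
    by rewrite ge_min lexx orbT.
  by rewrite lebesgue_measure_itv/= lte_fin r30 oppr0 adde0 lte_fin.
have r90 : 0 < r / 3 by rewrite divr_gt0.
have [t At Bt] := mean_lt_exists bB (measurable_circle_arc r3) Apos r90 B0.
have := lip (circle_frac t); rewrite circle_fracK (ger0_norm (circle_frac_ge0 t)) => lipt.
have tr : circle_frac t < r / 3 by apply: lt_le_trans At _; rewrite ge_min lexx.
have -> : B 0 = B t - (B t - B 0) by rewrite opprB addrC subrK.
apply: le_trans (ler_normB _ _) _; lra.
Qed.

End energy.

(** Turns the correlations of the centred indicator into the terms that weak mixing controls. *)
Let mean_corr (E : set Y) k : measurable E ->
  \int[nu]_y ((\1_E y - fine (nu E)) * (\1_E (iter k f y) - fine (nu E))) =
  fine (nu (E `&` iter k f @^-1` E)) - fine (nu E) * fine (nu E) :> R.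
Proof.
move=> mE; set c := fine (nu E).
have bE := bounded_meas_indic R mE.
have bEk : bounded_meas (fun y => (\1_E (iter k f y) : R)).
  exact: (bounded_meas_comp (piter k).1 bE).
have mEk : measurable (iter k f @^-1` E).
  by rewrite -[_ @^-1` _]setTI; apply: (piter k).1.
have -> : \int[nu]_y ((\1_E y - c) * (\1_E (iter k f y) - c)) =
   \int[nu]_y ((\1_(E `&` iter k f @^-1` E) y + - c * \1_E (iter k f y)) +
     (- c * \1_E y + c * c)).
  apply: eq_Rintegral => y _; rewrite indicI /=.
  rewrite indic_preimage_apply.
  set a := \1_E y; set b := \1_E _; ring.
have bI : bounded_meas (\1_(E `&` iter k f @^-1` E) : Y -> R).
  by apply: bounded_meas_indic; exact: measurableI.
rewrite meanD; last 2 first.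
- by apply: bounded_measD => //; exact: bounded_measZ.
- by apply: bounded_measD; [exact: bounded_measZ|exact: bounded_meas_cst].
rewrite meanD//; last exact: bounded_measZ.
rewrite meanD; [|exact: bounded_measZ|exact: bounded_meas_cst].
rewrite mean_cst !meanZ// (mean_preserves (piter k) bE) !mean_indic//; last exact: measurableI.
rewrite -/c; set A := fine _; ring.
Qed.

(** It suffices to treat events [C], [D], [E] with [D] an arc. For the centred indicator of [E], the
    vanishing in [slice_eq0] is exactly the independence of [E] from [C] and [D] jointly. *)
Lemma circle_extension_indep :
  preserves M ((muZ \x mu) \x nu)%E (fun x => ((x.1, s x.2), q x)).
Proof.
have ms2 : measurable_fun [set: Z * P] (fun x => s x.2).
  by apply: (measurableT_comp ps.1).
have mzs : measurable_fun [set: Z * P] (fun x => (x.1, s x.2)).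
  exact: measurable_fun_pair.
apply: preserves_pair => // S E mS mE.
have mqE : measurable (q @^-1` E) by rewrite -[_ @^-1` _]setTI; exact: mq.
have qE : M (q @^-1` E) = nu E.
  have := preserves_pairE indep measurableT mE.
  by rewrite preimage_setT setTI probability_setT mul1e.
rewrite -qE; have [] // := prod_dynkin (dynkin_indep M (muZ \x mu)%E mzs mqE) _ mS.
move=> C D mC mD; split; first exact: measurableX.
have mC' : measurable (fst @^-1` C : set (Z * P)).
  by rewrite -[_ @^-1` _]setTI; apply: measurable_fst.
have mCq : measurable (fst @^-1` C `&` q @^-1` E) by exact: measurableI.
have CqE : M (fst @^-1` C `&` q @^-1` E) = (muZ C * nu E)%E.
  exact: preserves_pairE indep mC mE.
suff arcs v : [set S0 | measurable S0 /\ M ((fun x => s x.2) @^-1` S0 `&`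
    (fst @^-1` C `&` q @^-1` E)) = (mu S0 * M (fst @^-1` C `&` q @^-1` E))%E]
    (circle_arc v).
  have [_ h] := circle_dynkin (dynkin_indep M mu ms2 mCq) arcs mD.
  have -> : (fun x : Z * P => (x.1, s x.2)) @^-1` (C `*` D) `&` q @^-1` E =
     (fun x => s x.2) @^-1` D `&` (fst @^-1` C `&` q @^-1` E).
    by apply/seteqP; split=> x /= [] => [[? ?] ?|? [? ?]].
  transitivity (mu D * (muZ C * nu E))%E.
    by rewrite [LHS]h; congr (_ * _)%E; exact: CqE.
  transitivity (muZ C * mu D * nu E)%E; first by rewrite muleCA muleA.
  congr (_ * _)%E; first exact: esym (product_measure1E _ _ mC mD).
  exact: esym qE.
split; first exact: measurable_circle_arc.
set D' := circle_arc v; have mD' : measurable D' := measurable_circle_arc v.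
pose c := fine (nu E); pose U y : R := \1_E y - c.
have bE := bounded_meas_indic R mE.
have bU : bounded_meas U by apply: bounded_measB => //; exact: bounded_meas_cst.
have c01 : 0 <= c <= 1.
  apply/andP; split; first exact: fine_ge0.
  by rewrite -lee_fin fineK ?fin_num_measure//; exact: probability_le1.
have U1 y : `|U y| <= 1.
  by rewrite /U indicE ler_norml; case: (_ \in _); rewrite /=; apply/andP; split; lra.
have := @slice_eq0 v U C bU mC U1.
under eq_fun do under eq_bigr do rewrite mean_corr//.
move=> /(_ (f_wm.2 E E mE mE)); rewrite -/D'.
have bC : bounded_meas (fun x : Z * P => (\1_C x.1 : R)).
  by apply: (bounded_meas_comp (p := fst)) => //; exact: bounded_meas_indic.
have bs : bounded_meas (fun x : Z * P => (\1_D' (s x.2) : R)).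
  by apply: (bounded_meas_comp ms2) => //; exact: bounded_meas_indic.
have bqE : bounded_meas (fun x : Z * P => (\1_E (q x) : R)).
  by apply: (bounded_meas_comp mq).
set I := (fun x => s x.2) @^-1` D' `&` (fst @^-1` C `&` q @^-1` E).
have mI : measurable I.
  by apply: measurableI => //; rewrite -[_ @^-1` _]setTI; exact: ms2.
have -> : \int[M]_x (\1_C x.1 * U (q x) * \1_D' (s x.2)) =
    \int[M]_x (\1_I x - c * (\1_C x.1 * \1_D' (s x.2))).
  apply: eq_Rintegral => x _; rewrite /U /I !indicI /=.
  rewrite !indic_preimage_apply.
  set a1 := \1_C _; set a2 := \1_E _; set a3 := \1_D' _; ring.
rewrite meanB; [|exact: bounded_meas_indic|by apply: bounded_measZ; exact: bounded_measM].
rewrite meanZ; last exact: bounded_measM.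
rewrite mean_indic//.
rewrite (mean_prod muZ muP (F := fun z => \1_C z) (G := fun p => \1_D' (s p))); last 2 first.
- exact: bounded_meas_indic.
- by apply: (bounded_meas_comp ps.1); exact: bounded_meas_indic.
rewrite (mean_preserves ps); last exact: bounded_meas_indic.
rewrite !mean_indic// => /eqP; rewrite subr_eq0 => /eqP IE.
have fK d (W : measurableType d) (m : probability W R) A : measurable A ->
    m A = (fine (m A))%:E by move=> mA; rewrite fineK// fin_num_measure.
pose Mp : probability (Z * P)%type R := M.
transitivity (fine (M I))%:E; first exact: (fK _ _ Mp I mI).
transitivity (mu D' * (muZ C * nu E))%E; last by congr (_ * _)%E; exact: esym CqE.
rewrite (fK _ _ mu D' mD') (fK _ _ muZ C mC) (fK _ _ nu E mE) -!EFinM; congr EFin.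
by rewrite IE -/c; set a := fine (muZ C); set b := fine (mu D'); rewrite mulrC -mulrA mulrCA.
Qed.

End circle_extension.

Ltac measurable_coord :=
  repeat first [exact: measurable_id | exact: measurable_cst
    | apply: measurable_fun_pair | exact: measurable_fst | exact: measurable_snd
    | apply: (measurableT_comp measurable_fst)
    | apply: (measurableT_comp measurable_snd)].

(** * The levels of a 3-steps skew product *)

Section levels.
Context (R : realType).
Local Notation T := (circle R).
Local Notation mu := (@circle_measure R).

Lemma preserves_descend d1 d2 d3 (X : measurableType d1) (A : measurableType d2)
    (B : measurableType d3) (la : probability X R) (al : probability A R)
    (be : probability B R) (p : X -> A) (h : A -> B) :
  preserves la al p -> measurable_fun setT h -> preserves la be (h \o p) ->
  preserves al be h.
Proof.
move=> [mp pE] mh [_ hE]; split=> // S mS.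
rewrite -hE// comp_preimage pE// -[_ @^-1` _]setTI; exact: mh.
Qed.

(** The dynamics and the factor [q] stay on one space [X], while [rho] presents [X] as base times
    fibre. Since [rho] is only required to preserve measure, the base may also be a single point. *)
Lemma circle_extension_indep_transfer d1 d2 d3 d4 (X : measurableType d1)
    (Z : measurableType d2) (P : measurableType d3) (Y : measurableType d4)
    (muX : probability X R) (muZ : probability Z R) (muP : probability P R)
    (nu : probability Y R) (rho : Z * P -> X) (base : X -> Z) (co : X -> T)
    (s : P -> T) (GX : X -> X) (g : Z -> Z) (G : Z * P -> P) (gam : Z -> T)
    (e : int) (f : Y -> Y) (q : X -> Y) (X0 : set X) :
  preserves (muZ \x muP)%E muX rho ->
  measurable_fun setT base -> measurable_fun setT co ->
  (forall x, base (rho x) = x.1) -> (forall x, co (rho x) = s x.2) ->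
  preserves muP mu s -> preserves muZ muZ g ->
  measurable_fun setT G -> (forall z, preserves muP muP (fun p => G (z, p))) ->
  (e = 1 \/ e = -1) ->
  (forall z p, s (G (z, p)) = s p *~ e + gam z) ->
  (forall x, rho (g x.1, G x) = GX (rho x)) ->
  weakly_mixing nu f -> measurable_fun setT q ->
  measurable X0 -> muX X0 = 1%E -> (forall x, X0 x -> q (GX x) = f (q x)) ->
  preserves muX (muZ \x nu)%E (fun x => (base x, q x)) ->
  preserves muX ((muZ \x mu) \x nu)%E (fun x => ((base x, co x), q x)).
Proof.
move=> prho mb mc bE cE ps pg mG pG e1 sG rG fwm mq mX0 X01 qG ind.
apply: (preserves_descend prho).
  by apply: measurable_fun_pair => //; exact: measurable_fun_pair.
have -> : (fun x => ((base x, co x), q x)) \o rho =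
    (fun x => ((x.1, s x.2), q (rho x))).
  by apply/funext => x /=; rewrite bE cE.
apply: (circle_extension_indep (f := f) (g := g) (G := G) (gam := gam) (e := e)
  (X0 := rho @^-1` X0)) => //.
- exact: measurableT_comp mq prho.1.
- by rewrite -[_ @^-1` _]setTI; exact: prho.1.
- by rewrite [LHS](prho.2 _ mX0).
- by move=> x X0x; rewrite rG qG.
- have -> : (fun x => (x.1, q (rho x))) = (fun x => (base x, q x)) \o rho.
    by apply/funext => x /=; rewrite bE.
  exact: preserves_comp prho ind.
Qed.

Lemma skew_product3_weakly_mixing_factor d (Y : measurableType d)
    (nu : probability Y R) (f : Y -> Y) (G : torus4 R -> torus4 R)
    (q : torus4 R -> Y) (X0 : set (torus4 R)) :
  skew_product3 G -> weakly_mixing nu f ->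
  preserves (torus4_measure R) nu q ->
  measurable X0 -> torus4_measure R X0 = 1%E ->
  (forall x, X0 x -> q (G x) = f (q x)) ->
  forall E, measurable E -> (nu E = nu E * nu E)%E.
Proof.
move=> [[pG _] [al [i1 [i2 [i3 [be [ga [de [[h1 h2 h3] [mbe mga mde] GE]]]]]]]]].
move=> fwm pq mX0 X01 qG.
have mq := pq.1.
have M11 : measurable_fun [set: torus4 R] (fun x => x.1.1) by exact: measurableT_comp.
have M12 : measurable_fun [set: torus4 R] (fun x => x.1.2) by exact: measurableT_comp.
have M21 : measurable_fun [set: torus4 R] (fun x => x.2.1) by exact: measurableT_comp.
have M22 : measurable_fun [set: torus4 R] (fun x => x.2.2) by exact: measurableT_comp.
pose t2 (x : T * T) : T := x.2 *~ i1 + be x.1.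
pose t3 (x : torus2 R * T) : T := x.2 *~ i2 + ga x.1.
pose t4 (x : torus3 R * T) : T := x.2 *~ i3 + de x.1.
have mt d' (W : measurableType d') (b : W -> T) i : i = 1 \/ i = -1 ->
    measurable_fun setT b -> measurable_fun [set: W * T] (fun x => x.2 *~ i + b x.1).
  move=> hi mb; apply: measurable_circleD; last exact: measurableT_comp.
  case: hi => ->.
    have -> : (fun x : W * T => x.2 *~ 1) = snd by apply/funext => x; rewrite mulr1z.
    exact: measurable_snd.
  have -> : (fun x : W * T => x.2 *~ (-1)) = (fun x => - x.2).
    by apply/funext => x; rewrite mulrN1z.
  exact: measurable_circleN.
have mt2 : measurable_fun setT t2 by exact: mt.
have mt3 : measurable_fun setT t3 by exact: mt.
have mt4 : measurable_fun setT t4 by exact: mt.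
have pg1 : preserves mu mu (fun x => x + al) by exact: preserves_circle_add.
have pg2 : preserves (torus2_measure R) (torus2_measure R) (fun x => (x.1 + al, t2 x)).
  apply: (preserves_skew (s := fun x : T => x + al) (t := t2)) => // a.
  exact: (preserves_circle_affine (be a) h1).
have pg3 : preserves (torus2_measure R \x mu)%E (torus2_measure R \x mu)%E
    (fun x => ((x.1.1 + al, t2 x.1), t3 x)).
  apply: (preserves_skew (s := fun x : torus2 R => (x.1 + al, t2 x)) (t := t3)) => // a.
  exact: (preserves_circle_affine (ga a) h2).
(* The rotation is treated as a circle extension of a one-point space with its Dirac mass; there
   independence of [q] from the base is trivial. *)
have J1 : preserves (torus4_measure R) (mu \x nu)%E (fun x => (x.1.1, q x)).
  have J0 : preserves (torus4_measure R) (dirac tt \x nu)%E (fun x => (tt, q x)).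
    apply: preserves_pair => // S S' mS mS'.
    transitivity ((\1_S tt)%:E * nu S')%E; last by [].
    rewrite indicE; have [ttS|ttS] := boolP (tt \in S).
      rewrite mul1e -(pq.2 _ mS'); congr (torus4_measure R _).
      by apply/seteqP; split=> x /=; [case|move=> ?; split=> //; exact: set_mem ttS].
    pose M4 : probability (torus4 R) R := torus4_measure R.
    rewrite mul0e -[RHS](measure0 M4); congr (torus4_measure R _).
    apply/seteqP; split=> x //= [ttS' _]; move/negP: ttS; apply; exact: mem_set ttS'.
  have K : preserves (torus4_measure R) ((dirac tt \x mu) \x nu)%E
      (fun x => ((tt, x.1.1), q x)).
    apply: (circle_extension_indep_transfer (muP := torus4_measure R) (rho := snd)
      (s := fun x => x.1.1) (GX := G) (g := id) (G := fun x => G x.2)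
      (gam := fun=> al) (e := 1) (f := f) (X0 := X0)) => //.
    + exact: preserves_snd.
    + by move=> [[] x].
    + exact: (preserves_comp (preserves_fst _ _) (preserves_fst _ _)).
    + by apply: (measurableT_comp pG.1).
    + by left.
    + by move=> z [[x1 x2] [x3 x4]]; rewrite GE/= mulr1z.
  (* Forgets the one-point coordinate. *)
  have := preserves_comp K (preserves_skew (s := snd) (t := snd)
    (preserves_snd (dirac tt) mu) measurable_snd (fun=> preserves_id nu)).
  by [].
have J2 : preserves (torus4_measure R) (torus2_measure R \x nu)%E
    (fun x => (x.1, q x)).
  have -> : (fun x : torus4 R => (x.1, q x)) = (fun x => ((x.1.1, x.1.2), q x)).
    by apply/funext => -[[? ?] ?].
  apply: (circle_extension_indep_transfer (muP := (mu \x torus2_measure R)%E)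
      (rho := @assocl _ _ _ T T (torus2 R))
      (s := fst) (GX := G) (g := fun x : T => x + al)
      (G := fun x : T * (T * torus2 R) => (t2 (x.1, x.2.1), (t3 ((x.1, x.2.1), x.2.2.1),
                      t4 ((x.1, x.2.1, x.2.2.1), x.2.2.2))))
      (gam := be) (e := i1) (f := f) (X0 := X0)
      (preserves_assocl mu mu (torus2_measure R)) M11 M12 _ _
      (preserves_fst mu (torus2_measure R)) pg1 _ _ h1 _ _ fwm mq mX0 X01 qG J1).
  + by [].
  + by [].
  + apply: measurable_fun_pair.
      by apply: (measurableT_comp mt2
        (g := fun x : T * (T * torus2 R) => (x.1, x.2.1))); measurable_coord.
    apply: measurable_fun_pair.
      by apply: (measurableT_comp mt3
        (g := fun x : T * (T * torus2 R) => ((x.1, x.2.1), x.2.2.1))); measurable_coord.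
    by apply: (measurableT_comp mt4
      (g := fun x : T * (T * torus2 R) => ((x.1, x.2.1, x.2.2.1), x.2.2.2))); measurable_coord.
  + move=> z; apply: (preserves_skew (s := fun p => t2 (z, p))
      (t := fun x => (t3 (z, x.1, x.2.1), t4 (z, x.1, x.2.1, x.2.2)))).
    * exact: (preserves_circle_affine (be z) h1).
    * apply: measurable_fun_pair.
        by apply: (measurableT_comp mt3
          (g := fun x : T * torus2 R => ((z, x.1), x.2.1))); measurable_coord.
      by apply: (measurableT_comp mt4
        (g := fun x : T * torus2 R => ((z, x.1, x.2.1), x.2.2))); measurable_coord.
    * move=> a; apply: (preserves_skew (s := fun p => t3 (z, a, p))
        (t := fun x => t4 (z, a, x.1, x.2))).
      - exact: (preserves_circle_affine (ga (z, a)) h2).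
      - by apply: (measurableT_comp mt4
          (g := fun x : torus2 R => ((z, a, x.1), x.2))); measurable_coord.
      - by move=> b; exact: (preserves_circle_affine (de (z, a, b)) h3).
  + by [].
  + by move=> [x1 [x2 [x3 x4]]]; rewrite /assocl/= GE.
have J3 : preserves (torus4_measure R) ((torus2_measure R \x mu) \x nu)%E
    (fun x => ((x.1, x.2.1), q x)).
  apply: (circle_extension_indep_transfer (muP := torus2_measure R)
      (rho := id) (s := fst) (GX := G) (g := fun x : torus2 R => (x.1 + al, t2 x))
      (G := fun x : torus2 R * torus2 R => (t3 (x.1, x.2.1), t4 ((x.1, x.2.1), x.2.2)))
      (gam := ga) (e := i2) (f := f) (X0 := X0)
      (preserves_id (torus4_measure R)) measurable_fst M21 _ _
      (preserves_fst mu mu) pg2 _ _ h2 _ _ fwm mq mX0 X01 qG J2).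
  + by [].
  + by [].
  + apply: measurable_fun_pair.
      by apply: (measurableT_comp mt3
        (g := fun x : torus4 R => (x.1, x.2.1))); measurable_coord.
    by apply: (measurableT_comp mt4
      (g := fun x : torus4 R => ((x.1, x.2.1), x.2.2))); measurable_coord.
  + move=> z; apply: (preserves_skew (s := fun p => t3 (z, p))
        (t := fun x => t4 (z, x.1, x.2))).
    * exact: (preserves_circle_affine (ga z) h2).
    * by apply: (measurableT_comp mt4
        (g := fun x : torus2 R => ((z, x.1), x.2))); measurable_coord.
    * by move=> b; exact: (preserves_circle_affine (de (z, b)) h3).
  + by [].
  + by move=> [[x1 x2] [x3 x4]]; rewrite GE.
have J4 : preserves (torus4_measure R) (((torus2_measure R \x mu) \x mu) \x nu)%E
    (fun x => (((x.1, x.2.1), x.2.2), q x)).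
  apply: (circle_extension_indep_transfer (muP := mu)
      (rho := @assocr _ _ _ (torus2 R) T T) (s := id) (GX := G)
      (g := fun x : torus3 R => ((x.1.1 + al, t2 x.1), t3 x))
      (G := t4) (gam := de) (e := i3) (f := f) (X0 := X0)
      (preserves_assocr (torus2_measure R) mu mu)
      (measurable_fun_pair measurable_fst M21) M22 _ _
      (preserves_id mu) pg3 mt4 _ h3 _ _ fwm mq mX0 X01 qG J3).
  + by move=> [[? ?] ?].
  + by [].
  + by move=> z; exact: (preserves_circle_affine (de z) h3).
  + by [].
  + by move=> [[[x1 x2] x3] x4]; rewrite /assocr/= GE.
move=> E mE.
have mqE : measurable (q @^-1` E) by rewrite -[_ @^-1` _]setTI; exact: mq.
have pr := preserves_assocr (torus2_measure R) mu mu.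
have := preserves_pairE J4 (S := @assocr _ _ _ (torus2 R) T T @^-1` (q @^-1` E)) _ mE.
rewrite (pr.2 _ mqE) (pq.2 _ mE) => <-; last first.
  by rewrite -[_ @^-1` _]setTI; exact: pr.1.
rewrite -(pq.2 _ mE); congr (torus4_measure R _).
by apply/seteqP; split=> -[[? ?] [? ?]]; [split|case].
Qed.

End levels.

(** * Exclusion of an isomorphism *)

Section not_isomorphic.
Context (R : realType).
Local Notation T := (circle R).
Local Notation mu := (@circle_measure R).

Lemma probability_full_setI d (X : measurableType d) (m : probability X R)
    (X0 A : set X) : measurable X0 -> m X0 = 1%E -> measurable A ->
  m (X0 `&` A) = m A.
Proof.
move=> mX0 X01 mA.
have C0 : m (~` X0) = 0%E by rewrite probability_setC// X01 subee.
have mXA : measurable (X0 `&` A) by exact: measurableI.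
have mCA : measurable (A `\` X0) by exact: measurableD.
have D0 : m (A `\` X0) = 0%E.
  apply/eqP; rewrite eq_le measure_ge0 andbT -C0; apply: le_measure; rewrite ?inE//.
  exact: measurableC.
rewrite -[in RHS](setUIDK A X0) setUC.
transitivity (m (X0 `&` A) + m (A `\` X0))%E; first by rewrite D0 adde0.
rewrite -measureU//; last by apply/seteqP; split=> x //= [[? _] []].
by rewrite setIC setUC.
Qed.

Lemma circle_arc_measure (v : R) : 0 < v <= 1 -> mu (circle_arc v) = v%:E.
Proof.
move=> /andP[v0 v1]; rewrite circle_arcE circle_measure_frac.
have -> : `]-oo, v[%classic `&` `[0, 1[%classic = `[0, v[%classic :> set R.
  apply/seteqP; split=> x /=; rewrite !in_itv/=; first by move=> [-> /andP[->]].
  by move=> /andP[-> xr]; split=> //=; apply: lt_le_trans xr _.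
by rewrite lebesgue_measure_itv/= lte_fin v0 oppr0 adde0.
Qed.

Lemma product_not_isomorphic_skew_product3 (f S : torus2 R -> torus2 R)
    (G : torus4 R -> torus4 R) :
  weakly_mixing (torus2_measure R) f -> skew_product3 G ->
  ~ metrically_isomorphic (torus4_measure R) (torus4_measure R)
      (product_map f S) G.
Proof.
move=> fwm skG [X0 [Y0 [h [k [[mX0 X01 FX0] [mY0 Y01 GY0] [mh hX0 khK] [mk kY0 hkK]
  [hpres hF]]]]]].
pose M4 : probability (torus4 R) R := torus4_measure R.
(* The projection to the torus of [f], carried over by the inverse isomorphism. Off [Y0], where [k]
   is not controlled, an arbitrary constant makes [q] measurable everywhere. *)
pose q y : torus2 R := if y \in Y0 then (k y).1 else point.
have qY y : Y0 y -> q y = (k y).1 by move=> Yy; rewrite /q mem_set.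
have mYk A : measurable A -> measurable (Y0 `&` k @^-1` (fst @^-1` A)).
  move=> mA; apply: mk => //; rewrite -[_ @^-1` _]setTI; exact: measurable_fst.
have mq : measurable_fun setT q.
  move=> _ A mA; rewrite setTI.
  have -> : q @^-1` A = (Y0 `&` k @^-1` (fst @^-1` A)) `|`
      (~` Y0 `&` [set _ | A point]).
    apply/seteqP; split=> y /=; rewrite /q.
      case: ifPn => yY Ay; [left|right]; first by split=> //; exact: set_mem.
      by split=> // /mem_set h'; rewrite h' in yY.
    case=> [[Yy Ay]|[nYy]]; first by rewrite mem_set.
    by rewrite memNset.
  apply: measurableU; first exact: mYk.
  apply: measurableI; first exact: measurableC.
  have [Ap|Ap] := pselect (A point).
    by rewrite (_ : [set _ | _] = setT)//; apply/seteqP; split.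
  by rewrite (_ : [set _ | _] = set0)//; apply/seteqP; split.
have pq : preserves (torus4_measure R) (torus2_measure R) q.
  split=> // A mA.
  have mqA : measurable (q @^-1` A) by rewrite -[_ @^-1` _]setTI; exact: mq.
  have mfA : measurable (fst @^-1` A : set (torus4 R)).
    by rewrite -[_ @^-1` _]setTI; exact: measurable_fst.
  rewrite -[LHS](@probability_full_setI _ _ M4 Y0 _ mY0 Y01 mqA).
  have -> : Y0 `&` q @^-1` A = Y0 `&` k @^-1` (fst @^-1` A).
    by apply/seteqP; split=> y /= [Yy]; rewrite qY.
  rewrite -[LHS](hpres _ (mYk _ mA)).
  have -> : X0 `&` h @^-1` (Y0 `&` k @^-1` (fst @^-1` A)) = X0 `&` fst @^-1` A.
    apply/seteqP; split=> x /= [Xx]; first by rewrite khK// => -[].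
    by move=> Ax; split=> //; split; [apply: hX0; exists x|rewrite khK].
  rewrite [LHS](@probability_full_setI _ _ M4 X0 _ mX0 X01 mfA).
  exact: (preserves_fst (torus2_measure R) (torus2_measure R)).2.
have qG y : Y0 y -> q (G y) = f (q y).
  move=> Yy; rewrite qY; last by apply: GY0; exists y.
  have Xk : X0 (k y) by apply: kY0; exists y.
  rewrite qY// -[in LHS](hkK y Yy) -hF// khK//.
  by apply: FX0; exists (k y).
(* A set of measure one half, a number different from its square. *)
pose E : set (torus2 R) := circle_arc 2^-1 `*` [set: T].
have mE : measurable E by apply: measurableX => //; exact: measurable_circle_arc.
have h12 : torus2_measure R E = (2^-1)%:E.
  rewrite [LHS]product_measure1E//; last exact: measurable_circle_arc.
  rewrite [X in (_ * X)%E](probability_setT mu) mule1.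
  by apply: circle_arc_measure; apply/andP; split; lra.
have : ((2^-1 : R)%:E = (2^-1)%:E * (2^-1)%:E)%E.
  have fac : (torus2_measure R E = torus2_measure R E * torus2_measure R E)%E.
    exact: (skew_product3_weakly_mixing_factor skG fwm pq mY0 Y01 qG).
  by rewrite h12 in fac.
by rewrite -EFinM => -[] /eqP; apply/negP; rewrite gt_eqF//; lra.
Qed.

End not_isomorphic.

(** * Birkhoff sums over ergodic rotations *)

Section rotation.
Context (R : realType) (a : R).
Local Notation T := (circle R).
Local Notation mu := (@circle_measure R).
Local Notation pr := (@circle_proj R).
Hypothesis a_ergodic : ergodic mu (circle_rotation (pr a)).

(** The [e]-neighbourhood of the two-sided orbit of 0. It is invariant, so ergodicity in measure
    gives it full measure; a set of full measure meets every arc, which yields density of the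
    orbit. *)
Let orbit_nbhs (e : R) : set T :=
  [set c | exists (j : int) x, pr x = c /\ `|x - j%:~R * a| < e].

Let measurable_orbit_nbhs e : measurable (orbit_nbhs e).
Proof.
rewrite /measurable/= /circle_measurable/=.
have -> : pr @^-1` orbit_nbhs e =
    \bigcup_(jn : int * int) `](jn.1%:~R * a + jn.2%:~R - e), (jn.1%:~R * a + jn.2%:~R + e)[%classic.
  apply/seteqP; split=> x /=.
    move=> [j [y [/circle_proj_eq[n ->]]]]; rewrite ltr_norml => /andP[h1 h2].
    by exists (j, - n) => //=; rewrite in_itv/= intrN; apply/andP; split; lra.
  move=> [[j n] _] /=; rewrite in_itv/= => /andP[h1 h2].
  exists j, (x + (- n)%:~R); split; first exact: circle_proj_addz.
  by rewrite intrN ltr_norml; apply/andP; split; lra.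
by apply: countable_bigcupT_measurable => // jn; exact: measurable_itv.
Qed.

Let orbit_nbhs_full e : 0 < e -> mu (orbit_nbhs e) = 1%E.
Proof.
move=> e0; have := a_ergodic.2 _ (measurable_orbit_nbhs e).
have inv : circle_rotation (pr a) @^-1` orbit_nbhs e = orbit_nbhs e.
  apply/seteqP; split=> c /=; rewrite /circle_rotation.
    move=> [j [x [xc xe]]]; exists (j - 1), (x - a); split.
      by rewrite circle_projD circle_projN xc addrK.
    by rewrite (_ : x - a - _ = x - j%:~R * a)// intrB; ring.
  move=> [j [x [<- xe]]]; exists (j + 1), (x + a); split; first by rewrite circle_projD.
  by rewrite (_ : x + a - _ = x - j%:~R * a)// intrD; ring.
case/(_ inv) => // U0.
(* Points of this arc are within [e] of the orbit point 0, which excludes measure 0; the cap at 1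
   makes [v] the length of the arc. *)
pose v := Num.min e 1; have v0 : 0 < v by rewrite lt_min e0 ltr01.
have : (v%:E <= 0 :> \bar R)%E.
  rewrite -U0 -(@circle_arc_measure _ v) ?v0 ?ge_min ?lexx ?orbT//.
  apply: le_measure; rewrite ?inE//; first exact: measurable_circle_arc.
  move=> c cv; exists 0, (circle_frac c); split; first exact: circle_fracK.
  rewrite mul0r subr0 ger0_norm ?circle_frac_ge0//.
  by apply: lt_le_trans cv _; rewrite ge_min lexx.
by rewrite lee_fin leNgt v0.
Qed.

Lemma rotation_orbit_dense (e y : R) : 0 < e ->
  exists j n : int, `|y - j%:~R * a - n%:~R| < e.
Proof.
move=> e0; have e2 : 0 < e / 2 by rewrite divr_gt0.
pose v := Num.min (e / 2) 1; have v0 : 0 < v by rewrite lt_min e2 ltr01.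
(* An arc of length [v] that starts at [y]: its points are within [e / 2] of [y], and one of them is
   within [e / 2] of the orbit. *)
pose V : set T := (fun c => c + - pr y) @^-1` circle_arc v.
have mV : measurable V.
  by rewrite -[V]setTI; apply: (preserves_circle_add _).1 => //; exact: measurable_circle_arc.
have V0 : mu V = v%:E.
  rewrite circle_measure_add; last exact: measurable_circle_arc.
  by apply: circle_arc_measure; rewrite v0 ge_min lexx orbT.
have full := probability_full_setI (measurable_orbit_nbhs (e / 2)) (orbit_nbhs_full e2) mV.
have [E|/set0P[c [[j [x [xc xe]]] cV]]] := eqVneq (orbit_nbhs (e / 2) `&` V) set0.
  have h0 : mu V = 0%E by rewrite -[LHS]full E; exact: measure0.
  by move: h0; rewrite V0 => -[] v00; rewrite v00 ltxx in v0.
set t := circle_frac (c + - pr y).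
have [n xE] : exists n : int, x = y + t + n%:~R.
  apply: circle_proj_eq; rewrite circle_projD /t circle_fracK.
  by rewrite xc [c - _]addrC addrA subrr add0r.
have t0 : 0 <= t := circle_frac_ge0 _.
have tv : t < e / 2 by apply: lt_le_trans cV _; rewrite ge_min lexx.
exists j, (- n); rewrite intrN; move: xe; rewrite xE !ltr_norml => /andP[h1 h2].
by apply/andP; split; lra.
Qed.

(** Modulo 1, finitely many grid points of mesh below [e / 2] suffice, and each uses one orbit time;
    [J] is the largest of these. *)
Lemma rotation_orbit_dense_unif (e : R) : 0 < e ->
  exists J : nat, forall y, exists j n : int,
    (`|j| <= J)%N /\ `|y - j%:~R * a - n%:~R| < e.
Proof.
move=> e0; have e2 : 0 < e / 2 by rewrite divr_gt0.
pose M := (Num.trunc (e / 2)^-1).+1.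
have M0 : 0 < M%:R :> R by rewrite ltr0n.
have Me : M%:R^-1 < e / 2.
  by rewrite invf_plt ?posrE// /M; exact: truncnS_gt.
have h (i : nat) : exists jn : int * int, `|i%:R / M%:R - jn.1%:~R * a - jn.2%:~R| < e / 2.
  by have [j [n h]] := rotation_orbit_dense (i%:R / M%:R) e2; exists (j, n).
have [jn hjn] := choice h.
exists (\max_(i < M) `|(jn i).1|%N) => y.
have [m [t [yE t0 t1]]] : exists (m : int) (t : R), [/\ y = t + m%:~R, 0 <= t & t < 1].
  exists (Num.floor y), (y - (Num.floor y)%:~R); split; first by rewrite subrK.
    by rewrite subr_ge0 floor_le.
  by rewrite ltrBlDl; have := floorD1_gt y; rewrite intrD.
pose i := Num.trunc (t * M%:R).
have tM0 : 0 <= t * M%:R by rewrite mulr_ge0// ltW.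
have iM : (i < M)%N.
  rewrite -(ltr_nat R); apply: (@le_lt_trans _ _ (t * M%:R)); first by rewrite truncn_le.
  by rewrite gtr_pMl.
have ti : `|t - i%:R / M%:R| < e / 2.
  have h1 : i%:R / M%:R <= t by rewrite ler_pdivrMr// truncn_le.
  rewrite ger0_norm ?subr_ge0//; apply: lt_trans Me.
  rewrite -(ltr_pM2r M0) mulrBl mulVf ?gt_eqF// divfK ?gt_eqF// ltrBlDr addrC natr1.
  exact: truncnS_gt.
exists (jn i).1, ((jn i).2 + m); split.
  exact: (leq_bigmax (F := fun i : 'I_M => `|(jn i).1|%N) (Ordinal iM)).
have := hjn i; rewrite yE intrD; move: ti; rewrite !ltr_norml => /andP[h1 h2] /andP[h3 h4].
by apply/andP; split; lra.
Qed.

Definition birkhoff (psi : R -> R) (N : nat) (x : R) : R :=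
  N%:R^-1 * \sum_(k < N) psi (x + k%:R * a).

Section oscillation.
Context (psi : R -> R) (L K : R).
Hypothesis psi1 : forall x, psi (x + 1) = psi x.
Hypothesis psiL : forall x y, `|psi x - psi y| <= L * `|x - y|.
Hypothesis psiK : forall x, `|psi x| <= K.

Let psin x (n : int) : psi (x + n%:~R) = psi x.
Proof.
have nat_case (m : nat) z : psi (z + m%:R) = psi z.
  by elim: m => [|m ih]; rewrite ?addr0// -natr1 addrA psi1.
case: n => m; first exact: nat_case.
by rewrite NegzE intrN -[LHS](nat_case m.+1); congr psi; exact: subrK.
Qed.

Let L0 : 0 <= L.
Proof.
have := psiL 1 0; rewrite subr0 normr1 mulr1; exact: le_trans.
Qed.

Let birk_period N x (n : int) : birkhoff psi N (x + n%:~R) = birkhoff psi N x.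
Proof.
rewrite /birkhoff; congr (_ * _); apply: eq_bigr => k _.
by rewrite addrAC psin.
Qed.

Let birk_lip N x y : `|birkhoff psi N x - birkhoff psi N y| <= L * `|x - y|.
Proof.
have [->|N0] := posnP N.
  by rewrite /birkhoff !big_ord0 !mulr0 subrr normr0 mulr_ge0.
rewrite /birkhoff -mulrBr -sumrB normrM ger0_norm ?invr_ge0//.
rewrite ler_pdivrMl ?ltr0n//; apply: le_trans (ler_norm_sum _ _ _) _.
apply: (@le_trans _ _ (\sum_(i < N) L * `|x - y|)); last first.
  by rewrite sumr_const card_ord mulr_natl.
apply: ler_sum => k _; apply: le_trans (psiL _ _) _.
by rewrite opprD addrACA subrr addr0.
Qed.

(** The two sums differ only by one term at each end. *)
Let birk_shift1 N x : `|birkhoff psi N (x + a) - birkhoff psi N x| <= 2 * K / N%:R.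
Proof.
have [->|N0] := posnP N.
  by rewrite /birkhoff !big_ord0 !mulr0 subrr normr0 invr0 mulr0.
rewrite /birkhoff -mulrBr normrM ger0_norm ?invr_ge0// mulrC ler_pM2r ?invr_gt0 ?ltr0n//.
have -> : \sum_(k < N) psi (x + a + k%:R * a) - \sum_(k < N) psi (x + k%:R * a) =
    psi (x + N%:R * a) - psi x.
  elim: N {N0} => [|N ih]; first by rewrite !big_ord0 mul0r addr0 !subrr.
  rewrite !big_ord_recr/= opprD addrACA ih -natr1 mulrDl mul1r.
  have -> : x + a + N%:R * a = x + (N%:R * a + a) by ring.
  by rewrite addrC addrA subrK.
apply: le_trans (ler_normB _ _) _.
by have := psiK (x + N%:R * a); have := psiK x; lra.
Qed.

Let birk_shift N x (j : int) :
  `|birkhoff psi N (x + j%:~R * a) - birkhoff psi N x| <= `|j|%N%:R * (2 * K / N%:R).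
Proof.
have nat_case (m : nat) z :
    `|birkhoff psi N (z + m%:R * a) - birkhoff psi N z| <= m%:R * (2 * K / N%:R).
  elim: m => [|m ih]; first by rewrite !mul0r addr0 subrr normr0.
  rewrite -natr1 mulrDl mul1r addrA.
  rewrite -(subrKA (birkhoff psi N (z + m%:R * a))) [leRHS]mulrDl mul1r [leRHS]addrC.
  apply: le_trans (ler_normD _ _) _; rewrite lerD//; exact: birk_shift1.
case: j => m; first exact: nat_case.
rewrite NegzE intrN abszN absz_nat.
have := nat_case m.+1 (x + - m.+1%:~R * a).
by rewrite mulNr subrK distrC.
Qed.

(** All averages share the Lipschitz constant of [psi], and one step of the rotation changes them by
    at most [2 K / N]. As every point is close to an orbit point reached in at most [J] steps, every
    value is close to the value at 0. *)
Lemma birkhoff_oscillation (e : R) : 0 < e ->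
  exists N0, forall N, (N0 <= N)%N -> forall x y,
    `|birkhoff psi N x - birkhoff psi N y| <= e.
Proof.
(* The distance to the orbit then costs at most [e / 4]; [L + 1] is used because [L] may be 0. *)
move=> e0; pose e1 := e / (4 * (L + 1)).
have L1 : 0 < L + 1 by apply: ltr_wpDl.
have e10 : 0 < e1 by rewrite divr_gt0// mulr_gt0.
have [J HJ] := rotation_orbit_dense_unif e10.
have K0 : 0 <= K by apply: le_trans (psiK 0).
(* From this index on, [J] steps of the rotation cost at most [e / 4]. *)
pose N0 := (Num.trunc (J%:R * (2 * K) * 4 / e)).+1.
exists N0 => N NN x y.
have N0' : 0 < N%:R :> R by rewrite ltr0n (leq_trans _ NN).
have base z : `|birkhoff psi N z - birkhoff psi N 0| <= e / 2.
  have [j [n [jJ zj]]] := HJ z.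
  have := birk_lip N z (j%:~R * a + n%:~R).
  have := birk_shift N 0 j; rewrite add0r birk_period.
  have zj' : `|z - (j%:~R * a + n%:~R)| <= e1 by rewrite opprD addrA ltW.
  have bl : L * `|z - (j%:~R * a + n%:~R)| <= e / 4.
    apply: (@le_trans _ _ ((L + 1) * e1)); first by rewrite ler_pM// lerDl.
    by rewrite /e1 le_eqVlt; apply/orP; left; apply/eqP; field; rewrite gt_eqF.
  have bs : `|j|%N%:R * (2 * K / N%:R) <= e / 4.
    apply: (@le_trans _ _ (J%:R * (2 * K / N%:R))).
      by rewrite ler_wpM2r ?ler_nat// divr_ge0// ?mulr_ge0// ltW.
    rewrite mulrA ler_pdivrMr// -ler_pdivrMl ?divr_gt0// invf_div.
    have : J%:R * (2 * K) * 4 / e <= N%:R.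
      apply: ltW; apply: lt_le_trans (truncnS_gt _) _; by rewrite ler_nat.
    by apply: le_trans; rewrite le_eqVlt; apply/orP; left; apply/eqP; ring.
  move=> h1 h2; have {}h1 := le_trans h1 bs; have {}h2 := le_trans h2 bl.
  rewrite -(subrKA (birkhoff psi N (j%:~R * a))).
  by apply: le_trans (ler_normD _ _) _; lra.
rewrite -(subrKA (birkhoff psi N 0)); apply: le_trans (ler_normD _ _) _.
by have := base x; have := base y; rewrite [X in _ -> _ -> _ + X <= _]distrC; lra.
Qed.

End oscillation.
End rotation.

(** * Periodic functions and lifts *)

Section real_functions.
Context (R : realType).
Local Notation pr := (@circle_proj R).

Lemma periodic_addz (V : Type) (h : R -> V) : (forall t, h (t + 1) = h t) ->
  forall t (n : int), h (t + n%:~R) = h t.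
Proof.
move=> h1 t n; have nat_case (k : nat) z : h (z + k%:R) = h z.
  by elim: k => [|k ih]; rewrite ?addr0// -natr1 addrA h1.
case: n => k; first exact: nat_case.
by rewrite NegzE intrN -[LHS](nat_case k.+1); congr h; exact: subrK.
Qed.

Lemma periodic_unit_itv (V : Type) (h : R -> V) : (forall t, h (t + 1) = h t) ->
  forall t, exists2 u, 0 <= u < 1 & h t = h u.
Proof.
move=> h1 t; exists (t - (Num.floor t)%:~R); last by rewrite -intrN periodic_addz.
by rewrite subr_ge0 floor_le/= ltrBlDl; have := floorD1_gt t; rewrite intrD.
Qed.

Lemma continuous_periodic_bounded (h : R -> R) : continuous h ->
  (forall t, h (t + 1) = h t) -> exists K, forall t, `|h t| <= K.
Proof.
move=> ch h1.
have cn : continuous (fun t => `|h t|).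
  by move=> t; apply: continuous_comp; [exact: ch|exact: norm_continuous].
have [c _ hc] := EVT_max ler01 (continuous_subspaceT cn).
exists `|h c| => t; have [u /andP[u0 u1] ->] := periodic_unit_itv h1 t.
by apply: hc; rewrite in_itv/= u0 ltW.
Qed.

Lemma MVT_lipschitz (h : R -> R) (L : R) :
  (forall t : R, derivable h t 1) -> (forall t : R, `|'D_1 h t| <= L) ->
  forall x y, `|h x - h y| <= L * `|x - y|.
Proof.
move=> dh hL; have dih (t : R) : is_derive t (1 : R) h ('D_1 h t) by exact: derivableP.
have ch : continuous h by move=> t; apply/differentiable_continuous/derivable1_diffP.
suff H x y : x < y -> `|h y - h x| <= L * `|y - x|.
  move=> x y; have [xy|xy|->] := ltgtP x y.
  - by rewrite distrC (distrC x); exact: H.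
  - exact: H.
  - by rewrite !subrr normr0 mulr0.
move=> xy; have [c _ ->] := MVT xy (fun z _ => dih z) (continuous_subspaceT ch).
by rewrite normrM ler_wpM2r.
Qed.

(** A change of value would force, by the intermediate value theorem, a half-integer value. *)
Lemma int_valued_continuous_cst (D : R -> R) : continuous D ->
  (forall t, D t \is a Num.int) -> forall s t, D s = D t.
Proof.
move=> cD iD.
have step s t : s <= t -> D s = D t.
  move=> st.
  have key (v : R) : v \is a Num.int -> v + 2^-1 \isn't a Num.int.
    move=> iv; apply/negP => iv2.
    have : (2^-1 : R) \is a Num.int by rewrite -(addKr v 2^-1) rpredD// rpredN.
    move=> /intrP[n nE].
    have : (0%:~R : R) < n%:~R by rewrite -nE; lra.
    have : (n%:~R : R) < 1%:~R by rewrite -nE; lra.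
    by rewrite !ltr_int; lia.
  have gap (u v : R) : u \is a Num.int -> v \is a Num.int -> u < v -> u + 1 <= v.
    move=> /intrP[n ->] /intrP[k ->]; rewrite ltr_int -(intrD _ n 1) ler_int; lia.
  apply/eqP; apply: contrapT => /negP; rewrite neq_lt => /orP[h|h].
    have g1 := gap _ _ (iD s) (iD t) h.
    have [|c _ cE] := IVT st (continuous_subspaceT cD) (v := D s + 2^-1).
      by rewrite ge_min le_max; apply/andP; split; apply/orP; [left|right]; lra.
    by have := key _ (iD s); rewrite -cE iD.
  have g1 := gap _ _ (iD t) (iD s) h.
  have [|c _ cE] := IVT st (continuous_subspaceT cD) (v := D t + 2^-1).
    by rewrite ge_min le_max; apply/andP; split; apply/orP; [right|left]; lra.
  by have := key _ (iD t); rewrite -cE iD.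
by move=> s t; have [/step//|/ltW/step] := leP s t.
Qed.

(** The degree is witnessed by some continuous lift, possibly not the smooth one; two continuous
    lifts differ by an integer-valued continuous function, hence by a constant. *)
Lemma smooth_lift_degree (phi : circle R -> circle R) (m : int) (Phi : R -> R) :
  topological_degree phi m -> lifts pr pr Phi phi -> continuous Phi ->
  forall t, Phi (t + 1) = Phi t + m%:~R.
Proof.
move=> [F [cF lF Fm]] lP cP t.
have cD : continuous (fun t => Phi t - F t).
  by move=> s; apply: cvgB; [exact: cP|exact: cF].
have := int_valued_continuous_cst cD _ (t + 1) t; rewrite Fm => h.
have : Phi (t + 1) - (F t + m%:~R) = Phi t - F t.
  by apply: h => s; apply/circle_projP; rewrite -lP -lF.
by move=> {}h; lra.
Qed.

End real_functions.

(** * The degree as limit of Birkhoff averages *)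

Section degree.
Context (R : realType) (a : R) (Phi : R -> R) (m : int).
Local Notation pr := (@circle_proj R).
Hypothesis a_ergodic : ergodic (@circle_measure R) (circle_rotation (pr a)).
Hypothesis Phi_smooth : forall k, Ck k Phi.
Hypothesis Phi_deg : forall t, Phi (t + 1) = Phi t + m%:~R.
Local Notation dPhi := (fun t : R => 'D_1 Phi t).

Lemma smooth_derivable (t : R) : derivable Phi t 1.
Proof. by apply/derivable1_diffP; exact: (Phi_smooth 1).1. Qed.

Let dPhi_derivable (t : R) : derivable dPhi t 1.
Proof. by apply/derivable1_diffP; exact: ((Phi_smooth 2).2 1).1. Qed.

Let ddPhi_continuous : continuous (fun t : R => 'D_1 dPhi t).
Proof. exact: ((Phi_smooth 2).2 1).2. Qed.

Lemma smooth_derive_continuous : continuous dPhi.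
Proof. exact: (Phi_smooth 1).2. Qed.

Let derive_periodic (h : R -> R) (c : R) : (forall t : R, derivable h t 1) ->
  (forall t, h (t + 1) = h t + c) -> forall t : R, 'D_1 h (t + 1) = 'D_1 h t.
Proof.
move=> dh hc t.
have E : h = (fun s => h s + c) \o (fun s => s - 1).
  by apply/funext => s /=; rewrite -hc subrK.
have d1 : is_derive (t + 1) (1 : R) (fun s : R => s - 1) 1.
  by apply: is_derive_eq; rewrite subr0.
have d2 : is_derive (t + 1 - 1) (1 : R) (fun s => h s + c) ('D_1 h t).
  rewrite addrK; have := derivableP (dh t) => ?.
  by apply: is_derive_eq; rewrite addr0.
have d3 := @is_derive1_comp _ (fun s => h s + c) (fun s => s - 1) (t + 1) _ _ d2 d1.
by rewrite {1}E derive_val mulr1.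
Qed.

Lemma smooth_derive_periodic t : dPhi (t + 1) = dPhi t.
Proof. exact: (derive_periodic smooth_derivable Phi_deg). Qed.

(** The second derivative of [Phi], continuous and periodic, provides the Lipschitz constant of the
    first. *)
Lemma birkhoff_derive_osc (e : R) : 0 < e ->
  exists N0, forall N, (N0 <= N)%N -> forall x y,
    `|birkhoff a dPhi N x - birkhoff a dPhi N y| <= e.
Proof.
have [K HK] := continuous_periodic_bounded smooth_derive_continuous smooth_derive_periodic.
have ddP (t : R) : 'D_1 dPhi (t + 1) = 'D_1 dPhi t.
  apply: (derive_periodic (c := 0)) => // s.
  by rewrite addr0 smooth_derive_periodic.
have [L HL] := continuous_periodic_bounded ddPhi_continuous ddP.
apply: (birkhoff_oscillation a_ergodic (L := L) (K := K)) => //.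
- exact: smooth_derive_periodic.
- exact: MVT_lipschitz.
Qed.

(** The real lift of the displacement of the second coordinate under the [n]-th iterate of the skew
    shift. *)
Definition lift_iter (n : nat) (x : R) : R := \sum_(k < n) Phi (x + k%:R * a).

Lemma is_derive_lift_iter n (x : R) :
  is_derive x (1 : R) (lift_iter n) (n%:R * birkhoff a dPhi n x).
Proof.
have -> : n%:R * birkhoff a dPhi n x = \sum_(k < n) dPhi (x + k%:R * a).
  rewrite /birkhoff; have [->|n0] := posnP n; first by rewrite !big_ord0 !mulr0.
  by rewrite mulVKf// pnatr_eq0 -lt0n.
have -> : lift_iter n = \sum_(k < n) (fun x => Phi (x + k%:R * a)).
  by apply/funext => s; rewrite /lift_iter fct_sumE.
apply: is_derive_sum => k.
have d1 : is_derive x (1 : R) (fun s : R => s + k%:R * a) 1.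
  by apply: is_derive_eq; rewrite addr0.
have dP : is_derive (x + k%:R * a) (1 : R) Phi (dPhi (x + k%:R * a)).
  by apply/derivableP; exact: smooth_derivable.
have := @is_derive1_comp _ Phi (fun s => s + k%:R * a) x _ _ dP d1.
by rewrite mulr1.
Qed.

Lemma lift_iter_deg n x : lift_iter n (x + 1) = lift_iter n x + n%:R * m%:~R.
Proof.
rewrite /lift_iter; under eq_bigr do rewrite addrAC Phi_deg.
by rewrite big_split/= sumr_const card_ord mulr_natl.
Qed.

(** Over one period [lift_iter N] increases by [N m], so its derivative equals [N m] somewhere.
    Hence the average takes the value [m] exactly, and small oscillation does the rest. *)
Lemma birkhoff_derive_cvg (e : R) : 0 < e ->
  exists N0, forall N, (N0 <= N)%N -> forall x,
    `|birkhoff a dPhi N x - m%:~R| <= e.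
Proof.
move=> e0; have [N0 HN0] := birkhoff_derive_osc e0.
(* The successor ensures [N > 0], so that [N] can be cancelled. *)
exists N0.+1 => N NN x.
have N_gt0 : (0 < N)%N by exact: leq_trans NN.
have cl : continuous (lift_iter N).
  move=> t; apply/differentiable_continuous/derivable1_diffP.
  by have [] := is_derive_lift_iter N t.
have [c _ cE] := MVT ltr01 (fun z _ => is_derive_lift_iter N z) (continuous_subspaceT cl).
have -> : m%:~R = birkhoff a dPhi N c.
  move: cE; rewrite subr0 mulr1 -[X in lift_iter N X](add0r 1) lift_iter_deg addrAC subrr add0r.
  by apply: mulfI; rewrite pnatr_eq0 -lt0n.
exact: HN0 (ltnW NN) _ _.
Qed.

End degree.

(** * Growth of the derivative *)

Section product_lift.
Context (R : realType).
Local Notation V2 := 'rV[R]_2.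
Local Notation V4 := 'rV[R]_(2 + 2).

Lemma differentiable_mulmxr n p (A : 'M[R]_(n, p)) (v : 'rV[R]_n) :
  differentiable (fun u : 'rV[R]_n => u *m A) v.
Proof.
have -> : (fun u : 'rV[R]_n => u *m A) = \sum_(i < n) (fun u : 'rV[R]_n => u 0 i *: row i A).
  by apply/funext => u; rewrite fct_sumE -mulmx_sum_row.
apply: differentiable_sum => i; apply: differentiableZl.
exact: differentiable_coord.
Qed.

Lemma mulmxr_continuous n p (A : 'M[R]_(n, p)) :
  continuous (fun u : 'rV[R]_n => u *m A).
Proof. by move=> v; apply/differentiable_continuous/differentiable_mulmxr. Qed.

Lemma diff_mulmxr n p (A : 'M[R]_(n, p)) (v : 'rV[R]_n) :
  'd (fun u : 'rV[R]_n => u *m A) v = (fun u => u *m A) :> (_ -> _).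
Proof.
exact: (@diff_lin _ _ _ (mulmxr A : {linear 'rV[R]_n -> 'rV[R]_p}) v (@mulmxr_continuous n p A)).
Qed.

Definition inl_mx : 'M[R]_(2 + 2, 2) := col_mx 1%:M 0.
Definition inr_mx : 'M[R]_(2 + 2, 2) := col_mx 0 1%:M.
Definition outl_mx : 'M[R]_(2, 2 + 2) := row_mx 1%:M 0.
Definition outr_mx : 'M[R]_(2, 2 + 2) := row_mx 0 1%:M.

Lemma mul_inl_mx (v : V4) : v *m inl_mx = lsubmx v.
Proof.
by rewrite -[in LHS](hsubmxK v) mul_row_col mulmx1 mulmx0 addr0.
Qed.

Lemma mul_inr_mx (v : V4) : v *m inr_mx = rsubmx v.
Proof.
by rewrite -[in LHS](hsubmxK v) mul_row_col mulmx1 mulmx0 add0r.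
Qed.

(** Projections and inclusions of the two blocks are written as matrix products, so that the chain
    rule meets only [F], [S] and linear maps; [prod_liftE] gives the block form. *)
Definition prod_lift (F S : V2 -> V2) (v : V4) : V4 :=
  F (v *m inl_mx) *m outl_mx + S (v *m inr_mx) *m outr_mx.

Lemma prod_liftE F S v : prod_lift F S v = row_mx (F (lsubmx v)) (S (rsubmx v)).
Proof.
rewrite /prod_lift mul_inl_mx mul_inr_mx !mul_mx_row !mulmx1 !mulmx0.
by rewrite add_row_mx addr0 add0r.
Qed.

Lemma torus4_projE (v : V4) :
  torus4_proj v = (torus2_proj (lsubmx v), torus2_proj (rsubmx v)).
Proof.
rewrite /torus4_proj /torus2_proj !mxE.
by congr ((_, _), (_, _)); congr (circle_proj (v _ _)); apply/val_inj.
Qed.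

Lemma lifts_prod_lift (f g : torus2 R -> torus2 R) (F S : V2 -> V2) :
  lifts (@torus2_proj R) (@torus2_proj R) F f ->
  lifts (@torus2_proj R) (@torus2_proj R) S g ->
  lifts (@torus4_proj R) (@torus4_proj R) (prod_lift F S) (product_map f g).
Proof.
move=> lF lS v; rewrite [in LHS]torus4_projE [in RHS]torus4_projE.
by rewrite prod_liftE row_mxKl row_mxKr /product_map/= lF lS.
Qed.

Lemma differentiable_prod_lift F S v :
  (forall u, differentiable F u) -> (forall u, differentiable S u) ->
  differentiable (prod_lift F S) v.
Proof.
move=> dF dS; apply: differentiableD.
  apply: (@differentiable_comp _ _ _ _ (fun u => F (u *m inl_mx)) (fun u => u *m outl_mx)).
    apply: (@differentiable_comp _ _ _ _ (fun u => u *m inl_mx) F) => //.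
    exact: differentiable_mulmxr.
  exact: differentiable_mulmxr.
apply: (@differentiable_comp _ _ _ _ (fun u => S (u *m inr_mx)) (fun u => u *m outr_mx)).
  apply: (@differentiable_comp _ _ _ _ (fun u => u *m inr_mx) S) => //.
  exact: differentiable_mulmxr.
exact: differentiable_mulmxr.
Qed.

Let diff_sandwich (F : V2 -> V2) (A : 'M[R]_(2 + 2, 2)) (B : 'M[R]_(2, 2 + 2)) v w :
  (forall u, differentiable F u) ->
  'd (fun u : V4 => F (u *m A) *m B) v w = 'd F (v *m A) (w *m A) *m B.
Proof.
move=> dF; have d1 := differentiable_mulmxr A v.
have d2 : differentiable (fun u : V4 => F (u *m A)) v.
  exact: (@differentiable_comp _ _ _ _ (fun u => u *m A) F).
rewrite (@diff_comp _ _ _ _ (fun u => F (u *m A)) (fun u => u *m B)) //=; last first.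
  exact: differentiable_mulmxr.
rewrite diff_mulmxr (@diff_comp _ _ _ _ (fun u => u *m A) F)//=.
by rewrite diff_mulmxr.
Qed.

Lemma diff_prod_lift F S v w :
  (forall u, differentiable F u) -> (forall u, differentiable S u) ->
  'd (prod_lift F S) v w = 'd F (v *m inl_mx) (w *m inl_mx) *m outl_mx +
                           'd S (v *m inr_mx) (w *m inr_mx) *m outr_mx.
Proof.
move=> dF dS.
have dA (H : V2 -> V2) (A : 'M[R]_(2 + 2, 2)) (B : 'M[R]_(2, 2 + 2)) :
    (forall u, differentiable H u) -> differentiable (fun u : V4 => H (u *m A) *m B) v.
  move=> dH.
  apply: (@differentiable_comp _ _ _ _ (fun u => H (u *m A)) (fun u => u *m B)).
    apply: (@differentiable_comp _ _ _ _ (fun u => u *m A) H) => //.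
    exact: differentiable_mulmxr.
  exact: differentiable_mulmxr.
rewrite /prod_lift (_ : (fun v => _) = (fun u => F (u *m inl_mx) *m outl_mx) +
  (fun u => S (u *m inr_mx) *m outr_mx))//.
rewrite diffD; [|exact: dA|exact: dA].
by congr (_ + _); exact: diff_sandwich.
Qed.

Lemma jacobian_prod_lift F S v :
  (forall u, differentiable F u) -> (forall u, differentiable S u) ->
  'J (prod_lift F S) v = inl_mx *m 'J F (v *m inl_mx) *m outl_mx +
                         inr_mx *m 'J S (v *m inr_mx) *m outr_mx.
Proof.
move=> dF dS; apply/row_matrixP => i; rewrite !rowE.
rewrite mul_rV_lin1 diff_prod_lift// mulmxDr !mulmxA.
by rewrite !mul_rV_lin1.
Qed.

Lemma Ck1_prod_lift F S : Ck 1 F -> Ck 1 S -> Ck 1 (prod_lift F S).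
Proof.
move=> [dF cF] [dS cS]; split=> [v|w]; first exact: differentiable_prod_lift.
have -> : (fun v => 'D_w (prod_lift F S) v) = prod_lift
    (fun u => 'D_(w *m inl_mx) F u) (fun u => 'D_(w *m inr_mx) S u).
  apply/funext => v; rewrite deriveE; last exact: differentiable_prod_lift.
  by rewrite diff_prod_lift// /prod_lift !deriveE.
have cc (H : V2 -> V2) (A : 'M[R]_(2 + 2, 2)) (B : 'M[R]_(2, 2 + 2)) :
    continuous H -> continuous (fun v : V4 => H (v *m A) *m B).
  move=> cH v.
  apply: (@continuous_comp _ _ _ (fun u : V4 => H (u *m A)) (fun u : V2 => u *m B)).
    apply: (@continuous_comp _ _ _ (fun u : V4 => u *m A) H).
      exact: mulmxr_continuous.
    exact: cH.
  exact: mulmxr_continuous.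
have h1 := cc (fun u => 'D_(w *m inl_mx) F u) inl_mx outl_mx (cF (w *m inl_mx)).
have h2 := cc (fun u => 'D_(w *m inr_mx) S u) inr_mx outr_mx (cS (w *m inr_mx)).
move=> v; exact: (cvgD (h1 v) (h2 v)).
Qed.

(** One shape that covers the lifts of the skew shift, of its iterates and of its inverse. *)
Definition shear_lift (c : V2) (Psi : R -> R) (u : V2) : V2 :=
  u + c + Psi (u 0 0) *: delta_mx 0 1.

Lemma differentiable_shear_lift c Psi u : (forall t : R, derivable Psi t 1) ->
  differentiable (shear_lift c Psi) u.
Proof.
move=> dPsi; apply: differentiableD.
  by apply: differentiableD => //; exact: differentiable_cst.
apply: differentiableZl.
apply: (@differentiable_comp _ _ _ _ (fun u : V2 => u 0 0 : R) Psi).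
  exact: differentiable_coord.
exact/derivable1_diffP.
Qed.

Lemma diff_shear_lift c Psi u w : (forall t : R, derivable Psi t 1) ->
  'd (shear_lift c Psi) u w = w + ('D_1 Psi (u 0 0) * w 0 0) *: delta_mx 0 1.
Proof.
move=> dPsi.
have d0 : differentiable (fun u : V2 => u 0 0 : R) u by exact: differentiable_coord.
have dP : differentiable Psi (u 0 0) by exact/derivable1_diffP.
have d1 : differentiable (fun u : V2 => Psi (u 0 0)) u.
  exact: (@differentiable_comp _ _ _ _ (fun u : V2 => u 0 0 : R) Psi).
rewrite /shear_lift (_ : (fun u => _) = (id + cst c) +
  (fun u : V2 => Psi (u 0 0) *: delta_mx 0 1))//.
have d2 : differentiable (fun u : V2 => Psi (u 0 0) *: (delta_mx 0 1 : V2)) u.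
  exact: differentiableZl.
have d3 : is_diff u (id + cst c) (id + 0) by exact: is_diffD.
have e1 : 'd (fun u : V2 => Psi (u 0 0) *: (delta_mx 0 1 : V2)) u w =
    'd (fun u : V2 => Psi (u 0 0)) u w *: delta_mx 0 1.
  by rewrite diffZl.
have e2 : 'd (id + cst c) u w = w.
  by have -> : 'd (id + cst c) u = (id + 0) :> (V2 -> V2); [exact: diff_val|rewrite /= addr0].
have e3 : 'd (fun u : V2 => Psi (u 0 0)) u w = 'd Psi (u 0 0) ('d (fun u : V2 => u 0 0 : R) u w).
  by rewrite (@diff_comp _ _ _ _ (fun u : V2 => u 0 0 : R) Psi).
have e4 h : 'd Psi (u 0 0) h = 'D_1 Psi (u 0 0) * h.
  by rewrite diff1E// derive1E mulrC.
have d4 : differentiable (id + cst c) u by case: d3.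
transitivity ('d (id + cst c) u w +
    'd (fun u : V2 => Psi (u 0 0) *: (delta_mx 0 1 : V2)) u w).
  exact: (congr1 (fun H => H w) (diffD d4 d2)).
have e5 : 'd (fun u : V2 => u 0 0 : R) u w = w 0 0.
  have @lin : {linear V2 -> R}.
    by exists (fun N : V2 => N 0 0); do 2![eexists]; do ?[constructor];
       rewrite ?mxE// => ? *; rewrite ?mxE//; move=> ?; rewrite !mxE.
  have h := @diff_lin _ _ _ lin u (@coord_continuous _ _ _ 0 0).
  exact: (congr1 (fun H => H w) h).
have e6 := etrans e3 (etrans (e4 _) (congr1 ( *%R _) e5)).
exact: (congr2 +%R e2 (etrans e1 (congr1 ( *:%R^~ _) e6))).
Qed.

(** Matrices act on row vectors, which puts the derivative of [Psi] above the diagonal. *)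
Lemma jacobian_shear_lift c Psi u : (forall t : R, derivable Psi t 1) ->
  'J (shear_lift c Psi) u = 1%:M + 'D_1 Psi (u 0 0) *: delta_mx 0 1.
Proof.
move=> dPsi; apply/row_matrixP => i; rewrite !rowE mul_rV_lin1.
rewrite diff_shear_lift// mulmxDr mulmx1 -scalemxAr; congr (_ + _).
rewrite mul_delta_mx_cond mxE; case: (i =P 0) => [->|/eqP i0].
  by rewrite !eqxx mulr1.
by rewrite eq_sym (negbTE i0) mulr0 scale0r scaler0.
Qed.

Lemma Ck1_shear_lift c Psi : (forall t : R, derivable Psi t 1) ->
  continuous (fun t : R => 'D_1 Psi t) -> Ck 1 (shear_lift c Psi).
Proof.
move=> dPsi cPsi; split=> [u|w]; first exact: differentiable_shear_lift.
have -> : (fun u => 'D_w (shear_lift c Psi) u) =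
    (fun u => w + ('D_1 Psi (u 0 0) * w 0 0) *: delta_mx 0 1).
  apply/funext => u; have := deriveE w (differentiable_shear_lift c u dPsi) => ->.
  exact: diff_shear_lift.
have c1 : continuous (fun u : V2 => 'D_1 Psi (u 0 0)).
  move=> u; apply: (@continuous_comp _ _ _ (fun u : V2 => u 0 0 : R) (fun t : R => 'D_1 Psi t)).
    exact: coord_continuous.
  exact: cPsi.
have c2 : continuous (fun u : V2 => 'D_1 Psi (u 0 0) * w 0 0).
  by move=> u; exact: (cvgM (c1 u) (cvg_cst (w 0 0))).
have c3 : continuous (fun u : V2 => ('D_1 Psi (u 0 0) * w 0 0) *: (delta_mx 0 1 : V2)).
  by move=> u; exact: (cvgZ (c2 u) (cvg_cst (delta_mx 0 1 : V2))).
by move=> u; apply: (@cvgD _ _ _ (nbhs u) _ (fun=> w) _ w _ (cvg_cst w) (c3 u)).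
Qed.

End product_lift.

Section growth.
Context (R : realType).
Local Notation V2 := 'rV[R]_2.
Local Notation V4 := 'rV[R]_(2 + 2).
Local Notation pr := (@circle_proj R).

Lemma uniform_cvg_mxP (X : choiceType) d (F : nat -> X -> 'M[R]_d) (g : X -> 'M[R]_d) :
  {uniform, F @ \oo --> g} <->
  (forall e, 0 < e -> exists N, forall n, (N <= n)%N -> forall x i j,
    `|g x i j - F n x i j| < e).
Proof.
split=> [cF e e0|h P].
  pose E : set ('M[R]_d * 'M[R]_d) := [set xy | ball xy.1 e xy.2].
  have entE : entourage E by exact: entourage_ball (PosNum e0).
  have nP : nbhs (g : {uniform X -> 'M[R]_d}) [set h : {uniform X -> 'M[R]_d} |
      forall y, [set: X] y -> E (g y, h y)].
    apply/uniform_nbhs; exists E; split; first exact: entE.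
    by move=> k.
  have [N _ HN] := cF _ nP.
  exists N => n Nn x i j; have := HN n Nn x Logic.I; rewrite /E/=.
  by case=> _; exact.
move=> /uniform_nbhs[E [entE EP]].
move: entE; rewrite -entourage_ballE => -[e /= e0 eE].
have [N HN] := h e e0.
exists N => // n Nn; apply: EP => y _; apply: eE => /=.
by split=> // i j; exact: HN.
Qed.

Lemma sandwich_block_mx (X Y : 'M[R]_2) :
  inl_mx R *m X *m outl_mx R + inr_mx R *m Y *m outr_mx R = block_mx X 0 0 Y.
Proof.
rewrite /inl_mx /inr_mx /outl_mx /outr_mx !mul_col_mx !mul1mx !mul0mx.
rewrite !mul_mx_row !mulmx1 !mulmx0 add_col_mx addr0 add0r.
by [].
Qed.

Lemma block_mx_entries (X Y : 'M[R]_2) (e : R) : 0 < e ->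
  (forall i j, `|X i j| < e) -> (forall i j, `|Y i j| < e) ->
  forall i j, `|(block_mx X 0 0 Y : 'M[R]_(2 + 2)) i j| < e.
Proof.
move=> e0 hX hY i j; rewrite !mxE.
by case: (fintype.split i) => k; rewrite !mxE; case: (fintype.split j) => l; rewrite ?mxE ?normr0.
Qed.

Lemma torus2_proj_shear c Psi (u : V2) :
  torus2_proj (shear_lift c Psi u) =
  (pr (u 0 0 + c 0 0), pr (u 0 1 + c 0 1 + Psi (u 0 0))).
Proof.
by rewrite /torus2_proj /shear_lift !mxE /= mulr0 addr0 mulr1.
Qed.

Lemma lifts_shear (al : R) (phi : circle R -> circle R) (Phi : R -> R) :
  lifts pr pr Phi phi ->
  lifts (@torus2_proj R) (@torus2_proj R) (shear_lift (al *: delta_mx 0 0) Phi)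
    (torus2_skew (pr al) phi).
Proof.
move=> lP u; rewrite torus2_proj_shear /torus2_skew /torus2_proj /=.
by rewrite !mxE/= mulr1 mulr0 addr0 !circle_projD lP.
Qed.

Lemma lifts_iter_shear (al : R) (phi : circle R -> circle R) (Phi : R -> R) n :
  lifts pr pr Phi phi ->
  lifts (@torus2_proj R) (@torus2_proj R)
    (shear_lift ((n%:R * al) *: delta_mx 0 0) (lift_iter al Phi n))
    (iter n (torus2_skew (pr al) phi)).
Proof.
move=> lP u; elim: n => [|n ih].
  rewrite /= torus2_proj_shear /lift_iter big_ord0 !mxE/= mul0r !mul0r !addr0.
  by [].
rewrite iterS ih !torus2_proj_shear /torus2_skew /= /lift_iter big_ord_recr/=.
rewrite !mxE/= !mulr1 !mulr0 !addr0 -!circle_projD lP -circle_projD.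
by rewrite addrA -natr1 mulrDl mul1r addrA.
Qed.

Lemma iter_product_map (X Y : Type) (f : X -> X) (g : Y -> Y) n :
  iter n (product_map f g) = product_map (iter n f) (iter n g).
Proof.
by elim: n => [|n ih]; apply/funext => -[x y]//; rewrite iterS ih.
Qed.

Lemma torus2_skew_inverse (al : R) (phi : circle R -> circle R) :
  let T' := torus2_skew (pr (- al)) (fun x => - phi (x - pr al)) in
  cancel (torus2_skew (pr al) phi) T' /\ cancel T' (torus2_skew (pr al) phi).
Proof.
move=> T'; split=> -[x y]; rewrite /T' /torus2_skew/= circle_projN.
  by rewrite !addrK.
by rewrite !subrK.
Qed.

Lemma product_linear_growth (f : torus2 R -> torus2 R) (al : R)
    (phi : circle R -> circle R) (m : int) :
  diffeo_Coo (@torus2_proj R) f -> sublinear_growth (@torus2_proj R) f ->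
  ergodic (@circle_measure R) (circle_rotation (pr al)) ->
  class_Coo pr pr phi -> topological_degree phi m -> m != 0 ->
  linear_uniform_growth (@torus4_proj R)
    (product_map f (torus2_skew (pr al) phi)).
Proof.
move=> fCoo [_ [Df [HDf cDf]]] erg [Phi [lPhi Phi_smooth]] phi_deg m0.
have cPhi : continuous Phi := Phi_smooth 0.
have Phi_deg := smooth_lift_degree phi_deg lPhi cPhi.
have dPhi := smooth_derivable Phi_smooth.
have cdPhi := smooth_derive_continuous Phi_smooth.
split.
  have [[F [lF CF]] [g [fg gf [F' [lF' CF']]]]] := fCoo.
  split.
    exists (prod_lift F (shear_lift (al *: delta_mx 0 0) Phi)); split.
      by apply: lifts_prod_lift => //; exact: lifts_shear.
    by apply: Ck1_prod_lift; [exact: CF 1|exact: Ck1_shear_lift].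
  have [c1 c2] := torus2_skew_inverse al phi.
  exists (product_map g (torus2_skew (pr (- al)) (fun x => - phi (x - pr al)))); split.
  - by move=> [x y]; rewrite /product_map/= fg c1.
  - by move=> [x y]; rewrite /product_map/= gf c2.
  - exists (prod_lift F' (shear_lift ((- al) *: delta_mx 0 0) (fun t => - Phi (t - al)))).
    have dPsi (t : R) : is_derive t (1 : R) (fun t => - Phi (t - al)) (- 'D_1 Phi (t - al)).
      have d1 : is_derive t (1 : R) (fun s : R => s - al) 1.
        by apply: is_derive_eq; rewrite subr0.
      have dP : is_derive (t - al) (1 : R) Phi ('D_1 Phi (t - al)).
        by apply/derivableP; exact: dPhi.
      have d2 := @is_derive1_comp _ Phi (fun s => s - al) t _ _ dP d1.
      rewrite mulr1 in d2; have := is_deriveN d2; exact.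
    split.
      apply: lifts_prod_lift => //; apply: lifts_shear => t.
      by rewrite circle_projN -lPhi circle_projD circle_projN.
    apply: Ck1_prod_lift; [exact: CF' 1|apply: Ck1_shear_lift].
      by move=> t; have [] := dPsi t.
    have -> : (fun t : R => 'D_1 (fun t => - Phi (t - al)) t) = (fun t => - 'D_1 Phi (t - al)).
      by apply/funext => t; rewrite derive_val.
    move=> t; apply: cvgN.
    apply: (@continuous_comp _ _ _ (fun t => t - al) (fun t : R => 'D_1 Phi t)); last exact: cdPhi.
    by apply: cvgB; [exact: cvg_id|exact: cvg_cst].
(* The limit is constant; its only nonzero entry is the degree [m], in the block of the skew
   shift. *)
exists (fun=> block_mx 0 0 0 (m%:~R *: delta_mx 0 1) : 'M[R]_(2 + 2)).
split; last first.
  exists point; apply/eqP => h.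
  have := congr1 (fun M : 'M[R]_(2 + 2) => M (rshift 2 0) (rshift 2 1)) h.
  rewrite [LHS]block_mxEdr !mxE/= mulr1 => /eqP; rewrite intr_eq0.
  by apply/negP.
pose B n (t : R) := birkhoff al (fun t => 'D_1 Phi t) n t.
have B1 n t : B n (t + 1) = B n t.
  rewrite /B /birkhoff; congr (_ * _); apply: eq_bigr => k _.
  by rewrite addrAC (smooth_derive_periodic Phi_smooth Phi_deg).
have Bfrac n t : B n (circle_frac (pr t)) = B n t.
  have [k ->] := circle_proj_eq (circle_fracK (pr t)).
  by rewrite periodic_addz.
pose J n (t : R) : 'M[R]_2 := 1%:M + (n%:R * B n t) *: delta_mx 0 1.
(* The derivative must be a function on the torus. Evaluating [B n] at the representative is
   legitimate because it is 1-periodic. *)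
exists (fun n x => block_mx (Df n x.1) 0 0 (J n (circle_frac x.2.1)) : 'M[R]_(2 + 2)).
split=> [n|].
  have [Fn [lFn dFn JFn]] := HDf n.
  have dS (t : R) : derivable (lift_iter al Phi n) t 1.
    by have [] := is_derive_lift_iter al Phi_smooth n t.
  have dSn u := differentiable_shear_lift ((n%:R * al) *: delta_mx 0 0) u dS.
  exists (prod_lift Fn (shear_lift ((n%:R * al) *: delta_mx 0 0) (lift_iter al Phi n))); split.
  - by rewrite iter_product_map; apply: lifts_prod_lift => //; exact: lifts_iter_shear.
  - by move=> v; exact: differentiable_prod_lift.
  - move=> v; rewrite jacobian_prod_lift// sandwich_block_mx jacobian_shear_lift//.
    rewrite torus4_projE mul_inl_mx mul_inr_mx /= JFn.
    suff E : J n (circle_frac (pr (rsubmx (v : V4) 0 0))) =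
        1%:M + 'D_1 (lift_iter al Phi n) (rsubmx (v : V4) 0 0) *: delta_mx 0 1.
      exact: (congr1 (fun Y : 'M[R]_2 => block_mx ('J Fn (lsubmx (v : V4))) 0 0 Y) E).
    have dd := is_derive_lift_iter al Phi_smooth n (rsubmx (v : V4) 0 0).
    by rewrite derive_val /J Bfrac.
apply/uniform_cvg_mxP => e e0.
have [N1 HN1] := (uniform_cvg_mxP _ _).1 cDf e e0.
have e2 : 0 < e / 2 by rewrite divr_gt0.
have e4 : 0 < e / 4 by rewrite divr_gt0.
have [N2 HN2] := birkhoff_derive_cvg erg Phi_smooth Phi_deg e4.
(* Makes [n^-1 < e / 2], the contribution of the identity matrix in [J n]; the Birkhoff average
   contributes at most [e / 4]. *)
pose N3 := (Num.trunc (e / 2)^-1).+1.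
exists (maxn N1 (maxn N2 N3)) => n; rewrite !geq_max => /and3P[n1 n2 n3] x i j.
have n0 : 0 < n%:R :> R by rewrite ltr0n (leq_trans _ n3).
have ninv : n%:R^-1 < e / 2.
  rewrite invf_plt ?posrE//; apply: lt_le_trans (truncnS_gt _) _.
  by rewrite ler_nat.
set b := B n (circle_frac x.2.1).
have bm : `|m%:~R - b| <= e / 4 by rewrite distrC; exact: HN2.
(* [X] and [Y] are the diagonal blocks of the limit minus the rescaled derivative. *)
pose X : 'M[R]_2 := - (n%:R^-1 *: Df n x.1).
pose Y : 'M[R]_2 := (m%:~R - b) *: delta_mx 0 1 - n%:R^-1%:M.
have -> : (block_mx 0 0 0 (m%:~R *: delta_mx 0 1) : 'M[R]_(2 + 2)) i j -
    (n%:R^-1 *: (block_mx (Df n x.1) 0 0 (J n (circle_frac x.2.1)) : 'M[R]_(2 + 2))) i j =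
    (block_mx X 0 0 Y : 'M[R]_(2 + 2)) i j.
  rewrite scale_block_mx !scaler0.
  have -> : block_mx X 0 0 Y = block_mx 0 0 0 (m%:~R *: delta_mx 0 1) -
      block_mx (n%:R^-1 *: Df n x.1) 0 0 (n%:R^-1 *: J n (circle_frac x.2.1)).
    rewrite opp_block_mx add_block_mx !oppr0 !addr0 add0r; congr block_mx.
    rewrite /Y /J -/b scalerDr scalerA mulKf ?gt_eqF// scalemx1 opprD addrCA addrC.
    by rewrite -scalerBl.
  by rewrite !mxE.
apply: block_mx_entries => // k l.
  by have := HN1 n n1 x.1 k l; rewrite /X !mxE sub0r.
rewrite /Y !mxE; apply: le_lt_trans (ler_normB _ _) _.
have d01 (c : bool) : `|c%:R : R| <= 1 by case: c; rewrite ?normr1 ?normr0.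
have h1 : `|(m%:~R - b) * ((k == 0) && (l == 1))%:R| <= e / 4.
  by rewrite normrM -[leRHS]mulr1 ler_pM.
have h2 : `|(n%:R^-1 : R) *+ (k == l)| <= n%:R^-1.
  by case: (k == l); [rewrite /= mulr1n ger0_norm|rewrite /= mulr0n normr0];
    rewrite ?invr_ge0 ?ler0n.
by move: h1 h2; set A := `| _ | => h1; set A' := `| _ | => h2; lra.
Qed.

End growth.

(** * Ergodicity of the product *)

Section cesaro_ergodic.
Context (R : realType).

(** Convergence passes to countable disjoint unions because [Q N] is dominated by [mu] for all [N]
    at once: the tail of the union is small uniformly in [N]. *)
Lemma dominated_limit_dynkin d (X : measurableType d) (mu : probability X R)
    (Q : nat -> set X -> R) (c : R) :
  (forall N A B, measurable A -> measurable B -> A `&` B = set0 ->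
    Q N (A `|` B) = Q N A + Q N B) ->
  (forall N A, measurable A -> 0 <= Q N A <= fine (mu A)) ->
  Q ^~ setT @ \oo --> c ->
  dynkin [set S | measurable S /\ Q ^~ S @ \oo --> c * fine (mu S)].
Proof.
move=> QU Q0 QT.
have Qset0 N : Q N set0 = 0.
  have /andP[h1 h2] := Q0 N set0 measurable0; apply/eqP; rewrite eq_le h1 andbT.
  by move: h2; rewrite measure0.
have fmuU (A B : set X) : measurable A -> measurable B -> A `&` B = set0 ->
    fine (mu (A `|` B)) = fine (mu A) + fine (mu B).
  move=> mA mB AB; rewrite -fineD ?fin_num_measure//; congr fine.
  exact: measureU.
split => /=.
- by split=> //; rewrite probability_setT mulr1.
- move=> S [mS QS]; split; first exact: measurableC.
  have mCS : measurable (~` S) by exact: measurableC.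
  have -> : c * fine (mu (~` S)) = c - c * fine (mu S).
    have := fmuU S (~` S) mS mCS (setICr S); rewrite setUv probability_setT /=.
    by move=> h; rewrite -[X in X - _]mulr1 h mulrDr addrC addKr.
  have -> : Q ^~ (~` S) = (fun N => Q N setT - Q N S).
    by apply/funext => N; rewrite -(setUv S) QU ?setICr// addrC addKr.
  exact: cvgB.
- move=> F tF PF; have mF i : measurable (F i) by have [] := PF i.
  have mA : measurable (\bigcup_k F k) by exact: bigcupT_measurable.
  split=> //; set A := \bigcup_k F k.
  pose U n := \big[setU/set0]_(i < n) F i.
  have mU n : measurable (U n) by exact: bigsetU_measurable.
  have UF n : U n `&` F n = set0.
    rewrite /U; apply/seteqP; split=> x //; rewrite -bigcup_mkord => -[[i /= ilt Fi] Fn].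
    have E := tF i n Logic.I Logic.I (ex_intro _ x (conj Fi Fn)).
    by rewrite E ltnn in ilt.
  have US n : U n.+1 = U n `|` F n by rewrite /U big_ord_recr.
  have UA n : U n `<=` A.
    by move=> x; rewrite /U -bigcup_mkord => -[i _ Fi]; exists i.
  have UD n : U n `|` (A `\` U n) = A by exact: setDUK (UA n).
  have UDI n : U n `&` (A `\` U n) = set0 by apply/seteqP; split=> x //= [Ux [_ nUx]].
  have QUs n : Q ^~ (U n) @ \oo --> c * fine (mu (U n)).
    elim: n => [|n ih].
      rewrite /U big_ord0 measure0 mulr0.
      have -> : Q ^~ set0 = cst 0 by apply/funext => N; exact: Qset0.
      exact: cvg_cst.
    rewrite US fmuU// mulrDr.
    have -> : Q ^~ (U n `|` F n) = (fun N => Q N (U n) + Q N (F n)).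
      by apply/funext => N; rewrite QU.
    by apply: cvgD => //; have [] := PF n.
  have muU : (fun n => fine (mu (U n))) @ \oo --> fine (mu A).
    apply: fine_cvg; rewrite fineK ?fin_num_measure//.
    have := @measure_semi_sigma_additive _ _ _ mu F mF tF mA.
    apply: cvg_trans; apply: near_eq_cvg; apply: nearW => n.
    rewrite big_mkord; elim: n => [|n ih]; first by rewrite /U !big_ord0 measure0.
    by rewrite big_ord_recr/= ih US; apply: esym; apply: measureU.
  have c1 : 0 <= c.
    rewrite -(cvg_lim _ QT)//; apply: limr_ge; first by apply: cvgP QT.
    apply: nearW => N.
    by have /andP[] := Q0 N setT measurableT.
  have AD n : Q ^~ A = (fun N => Q N (U n) + Q N (A `\` U n)).
    by apply/funext => N; rewrite -QU ?UD//; exact: measurableD.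
  apply/cvgrPdist_le => e e0.
  (* Chosen so that the tail, of measure [D], satisfies [(c + 1) * D <= e / 3]; this covers both
     [c * D] and [Q N] of the tail. *)
  have e3 : 0 < e / (3 * (c + 1)) by rewrite divr_gt0// mulr_gt0// ltr_wpDl.
  move/cvgrPdist_le : (muU) => /(_ _ e3)[n0 _ /(_ n0 (leqnn n0))] hn0.
  have en3 : 0 < e / 3 by rewrite divr_gt0.
  move/cvgrPdist_le : (QUs n0) => /(_ _ en3)[N0 _ HN0]; exists N0 => // N NN.
  have {}HN0 := HN0 N NN; rewrite /= in HN0 hn0 *.
  rewrite (congr1 (fun h => h N) (AD n0)).
  have mD : measurable (A `\` U n0) by exact: measurableD.
  have muD : fine (mu A) = fine (mu (U n0)) + fine (mu (A `\` U n0)).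
    by rewrite -fmuU ?UD.
  have /andP[q0 q1] := Q0 N _ mD.
  set D := fine (mu (A `\` U n0)) in muD q1.
  rewrite muD addrC addKr in hn0 *.
  have D0 : 0 <= D by rewrite fine_ge0.
  rewrite ger0_norm// in hn0.
  have cD : (c + 1) * D <= e / 3.
    rewrite -ler_pdivlMl; last by rewrite ltr_wpDl.
    apply: le_trans hn0 _; rewrite le_eqVlt; apply/orP; left; apply/eqP.
    by field; rewrite gt_eqF// ltr_wpDl.
  rewrite mulrDr opprD addrACA; apply: le_trans (ler_normD _ _) _.
  have h : `|c * D - Q N (A `\` U n0)| <= c * D + D.
    rewrite ler_norml; have := mulr_ge0 c1 D0; lra.
  by move: HN0 h cD; rewrite mulrDl mul1r; lra.
Qed.

(** A complement in the second factor is a difference inside [A] times the whole space, which must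
    therefore belong to the class. *)
Lemma dynkin_setXr (X Y : Type) (P : set (set (X * Y))) (A : set X) :
  dynkin P -> P (A `*` setT) -> dynkin [set S | P (A `*` S)].
Proof.
move=> dP PA; have [_ _ PD _] := (dynkin_lambda_system P).1 dP; split => //.
- move=> S PS; change (P (A `*` ~` S)).
  have -> : A `*` ~` S = (A `*` setT) `\` (A `*` S).
    apply/seteqP; split=> -[x y] /= [h1 h2]; first by split=> // -[].
    by case: h1 => Ax _; split=> // Sy; exact: h2.
  by apply: PD => //; apply: setSX.
- move=> F tF PF; have [_ _ PU] := dP; change (P (A `*` \bigcup_k F k)).
  have -> : A `*` \bigcup_k F k = \bigcup_k (A `*` F k).
    apply/seteqP; split=> -[x y] /= => [[Ax [i _ Fi]]|[i _ [Ax Fi]]].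
      by exists i.
    by split=> //; exists i.
  apply: PU => // i j Di Dj [[x y] [[_ /= Fi] [_ /= Fj]]].
  by apply: (tF i j Di Dj); exists y.
Qed.

Lemma dynkin_setXl (X Y : Type) (P : set (set (X * Y))) (B : set Y) :
  dynkin P -> P (setT `*` B) -> dynkin [set S | P (S `*` B)].
Proof.
move=> dP PB; have [_ _ PD _] := (dynkin_lambda_system P).1 dP; split => //.
- move=> S PS; change (P (~` S `*` B)).
  have -> : ~` S `*` B = (setT `*` B) `\` (S `*` B).
    apply/seteqP; split=> -[x y] /= [h1 h2]; first by split=> // -[].
    by case: h1 => _ By; split=> // Sx; exact: h2.
  by apply: PD => //; apply: setSX.
- move=> F tF PF; have [_ _ PU] := dP; change (P ((\bigcup_k F k) `*` B)).
  have -> : (\bigcup_k F k) `*` B = \bigcup_k (F k `*` B).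
    apply/seteqP; split=> -[x y] /= => [[[i _ Fi] By]|[i _ [Fi By]]].
      by exists i.
    by split=> //; exists i.
  apply: PU => // i j Di Dj [[x y] [[/= Fi _] [/= Fj _]]].
  by apply: (tF i j Di Dj); exists x.
Qed.

Local Notation T := (circle R).

Lemma circle_arc1 : circle_arc (1 : R) = setT.
Proof. by apply/seteqP; split=> x // _; exact: circle_frac_lt1. Qed.

(** Since the whole circle is an arc, the hypothesis also supplies the cylinders that each change of
    factor requires. *)
Lemma arc_rectangle_dynkin d (X : measurableType d) (P : set (set (X * (T * T)))) :
  dynkin P ->
  (forall E u v, measurable E -> P (E `*` (circle_arc u `*` circle_arc v))) ->
  forall S, measurable S -> P S.
Proof.
move=> dP PR; apply: prod_dynkin => // E S mE mS.
have TT : [set: T * T] = circle_arc 1 `*` circle_arc 1.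
  by rewrite circle_arc1; apply/seteqP; split.
have dE : dynkin [set S0 | P (E `*` S0)].
  by apply: dynkin_setXr => //; rewrite TT; exact: PR.
apply: (prod_dynkin dE _ mS) => I J mI mJ /=.
have arcR K v : measurable K -> P (E `*` (K `*` circle_arc v)).
  move=> mK.
  have dl : dynkin [set K0 | [set S0 | P (E `*` S0)] (K0 `*` circle_arc v)].
    by apply: (dynkin_setXl dE) => /=; rewrite -circle_arc1; exact: PR.
  by apply: (circle_dynkin dl _ mK) => u /=; exact: PR.
have dr : dynkin [set J0 | [set S0 | P (E `*` S0)] (I `*` J0)].
  by apply: (dynkin_setXr dE) => /=; rewrite -circle_arc1; exact: arcR.
by apply: (circle_dynkin dr _ mJ) => v /=; exact: arcR.
Qed.

Lemma cesaro_cst (c : R) : (fun N => N%:R^-1 * \sum_(k < N) c) @ \oo --> c.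
Proof.
apply: cvg_near_cst; exists 1 => // N N1.
by rewrite sumr_const card_ord -[c *+ N]mulr_natl mulKf// pnatr_eq0 -lt0n.
Qed.

Section criterion.
Context d (X : measurableType d) (mu : probability (X * (T * T))%type R).
Context (F : X * (T * T) -> X * (T * T)).
Hypothesis pF : preserves mu mu F.

Let corr (A B : set (X * (T * T))) (N : nat) : R :=
  N%:R^-1 * \sum_(k < N) fine (mu (iter k F @^-1` A `&` B)).

Let piter k : preserves mu mu (iter k F).
Proof.
elim: k => [|k ih]; first exact: preserves_id.
exact: (preserves_comp ih pF).
Qed.

Let miter k A : measurable A -> measurable (iter k F @^-1` A).
Proof. by move=> mA; rewrite -[_ @^-1` _]setTI; exact: (piter k).1. Qed.

Let fmuU (A B : set (X * (T * T))) : measurable A -> measurable B -> A `&` B = set0 ->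
  fine (mu (A `|` B)) = fine (mu A) + fine (mu B).
Proof.
move=> mA mB AB; rewrite -fineD ?fin_num_measure//; congr fine.
exact: measureU.
Qed.

Let fmu_le (A B : set (X * (T * T))) : measurable A -> measurable B -> A `<=` B ->
  fine (mu A) <= fine (mu B).
Proof.
move=> mA mB AB; apply: fine_le; rewrite ?fin_num_measure//.
by apply: le_measure; rewrite ?inE.
Qed.

Let mean_bound (t : nat -> R) (b : R) N : 0 <= b -> (forall k, 0 <= t k <= b) ->
  0 <= N%:R^-1 * \sum_(k < N) t k <= b.
Proof.
move=> b0 tb; apply/andP; split.
  by rewrite mulr_ge0 ?invr_ge0// sumr_ge0// => k _; have /andP[] := tb k.
have [->|N0] := posnP N; first by rewrite invr0 mul0r.
rewrite ler_pdivrMl ?ltr0n// mulr_natl -[X in b *+ X]card_ord -sumr_const.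
by apply: ler_sum => k _; have /andP[] := tb k.
Qed.

Let corr_dynkinl B : measurable B -> dynkin [set A | measurable A /\
  corr A B @ \oo --> fine (mu B) * fine (mu A)].
Proof.
move=> mB.
apply: (dominated_limit_dynkin (Q := fun N A => corr A B N)) => [N A A' mA mA' AA'|N A mA|].
- rewrite /corr -mulrDr -big_split/=; congr (_ * _); apply: eq_bigr => k _.
  rewrite preimage_setU setIUl fmuU//; try by apply: measurableI => //; exact: miter.
  by rewrite setIACA setIid -preimage_setI AA' preimage_set0 set0I.
- apply: (mean_bound (t := fun k => fine (mu (iter k F @^-1` A `&` B)))) => [|k].
    exact: fine_ge0.
  rewrite fine_ge0//= -((piter k).2 _ mA); apply: fmu_le => //; last exact: miter.
  by apply: measurableI => //; exact: miter.
- have -> : (corr setT B) = (fun N => N%:R^-1 * \sum_(k < N) fine (mu B)).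
    apply/funext => N; congr (_ * _); apply: eq_bigr => k _.
    by rewrite preimage_setT setTI.
  exact: cesaro_cst.
Qed.

Let corr_dynkinr A : measurable A -> dynkin [set B | measurable B /\
  corr A B @ \oo --> fine (mu A) * fine (mu B)].
Proof.
move=> mA.
apply: (dominated_limit_dynkin (Q := fun N B => corr A B N)) => [N B B' mB mB' BB'|N B mB|].
- rewrite /corr -mulrDr -big_split/=; congr (_ * _); apply: eq_bigr => k _.
  rewrite setIUr fmuU//; try by apply: measurableI => //; exact: miter.
  by rewrite setIACA setIid BB' setI0.
- apply: (mean_bound (t := fun k => fine (mu (iter k F @^-1` A `&` B)))) => [|k].
    exact: fine_ge0.
  rewrite fine_ge0//=; apply: fmu_le => //.
  by apply: measurableI => //; exact: miter.
- have -> : (corr A setT) = (fun N => N%:R^-1 * \sum_(k < N) fine (mu A)).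
    apply/funext => N; congr (_ * _); apply: eq_bigr => k _.
    by rewrite setIT (piter k).2.
  exact: cesaro_cst.
Qed.

(** The correlation averages are additive in each set and dominated by its measure, so convergence
    extends from rectangles to all sets, one argument at a time. *)
Lemma ergodic_arc_rectangles :
  (forall E u v E' u' v', measurable E -> measurable E' ->
    let A := E `*` (circle_arc u `*` circle_arc v) in
    let B := E' `*` (circle_arc u' `*` circle_arc v') in
    (fun N => N%:R^-1 * \sum_(k < N) fine (mu (iter k F @^-1` A `&` B))) @ \oo -->
      fine (mu A) * fine (mu B)) ->
  ergodic mu F.
Proof.
move=> hR.
have mR E u v : measurable E ->
    measurable (E `*` (circle_arc u `*` circle_arc v) : set (X * (T * T))).
  by move=> mE; apply: measurableX => //; apply: measurableX; exact: measurable_circle_arc.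
have all A B : measurable A -> measurable B ->
    corr A B @ \oo --> fine (mu A) * fine (mu B).
  move=> mA mB.
  have hB E' u' v' : measurable E' -> [set B | measurable B /\
      corr A B @ \oo --> fine (mu A) * fine (mu B)]
      (E' `*` (circle_arc u' `*` circle_arc v')).
    move=> mE'; split; first exact: mR.
    have hA E u v : measurable E -> [set A | measurable A /\
        corr A (E' `*` (circle_arc u' `*` circle_arc v')) @ \oo -->
        fine (mu (E' `*` (circle_arc u' `*` circle_arc v'))) * fine (mu A)]
        (E `*` (circle_arc u `*` circle_arc v)).
      move=> mE; split; first exact: mR.
      by rewrite mulrC; exact: hR.
    rewrite mulrC.
    by have [_] := arc_rectangle_dynkin (corr_dynkinl (mR _ u' v' mE')) hA mA.
  by have [_] := arc_rectangle_dynkin (corr_dynkinr mA) hB mB.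
(* For an invariant set all correlations with itself equal its measure, so the limit gives a measure
   equal to its square. *)
split=> // S mS FS; have := all S S mS mS.
have -> : corr S S = (fun N => N%:R^-1 * \sum_(k < N) fine (mu S)).
  apply/funext => N; congr (_ * _); apply: eq_bigr => k _; congr (fine (mu _)).
  suff -> : iter k F @^-1` S = S by rewrite setIid.
  by elim: (k : nat) => // j ih; rewrite -[RHS]ih -[in RHS]FS.
move=> c1.
have c0 : (fun N => N%:R^-1 * \sum_(k < N) fine (mu S)) @ \oo --> fine (mu S).
  exact: cesaro_cst.
have : fine (mu S) = fine (mu S) * fine (mu S).
  by rewrite -[LHS](cvg_lim _ c0)// (cvg_lim _ c1).
move=> /eqP; rewrite -subr_eq0 -[X in X - _]mulr1 -mulrBr mulf_eq0 subr_eq0.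
move=> /orP[/eqP h|/eqP h]; [left|right].
  by rewrite -[LHS]fineK ?fin_num_measure// h.
by rewrite -[LHS]fineK ?fin_num_measure// -h.
Qed.

End criterion.

End cesaro_ergodic.

(** * Overlaps of arcs and mixing along the fibre *)

Section overlap.
Context (R : realType).
Local Notation T := (circle R).
Local Notation mu := (@circle_measure R).
Local Notation pr := (@circle_proj R).

Let barc d (X : measurableType d) (v : R) (h : X -> T) : measurable_fun setT h ->
  bounded_meas (fun x => (\1_(circle_arc v) (h x) : R)).
Proof.
move=> mh; apply: (bounded_meas_comp mh); apply: bounded_meas_indic.
exact: measurable_circle_arc.
Qed.

Let mshift (c : T) : measurable_fun [set: T] (fun x => x + c).
Proof. exact: (preserves_circle_add c).1. Qed.

Let indic01 (A : set T) x : 0 <= (\1_A x : R) <= 1.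
Proof. by rewrite indicE; case: (_ \in _); rewrite ?lexx ?ler01. Qed.

(** The correlation of two arcs under the translation by [t]. The variable is real so that
    [lift_iter] can be inserted. *)
Definition overlap (u' u t : R) : R :=
  \int[mu]_x (\1_(circle_arc u') x * \1_(circle_arc u) (x + pr t)).

Lemma bounded_meas_overlap u' u t : bounded_meas
  (fun x : T => (\1_(circle_arc u') x * \1_(circle_arc u) (x + pr t) : R)).
Proof. by apply: bounded_measM; [apply: (barc _ (h := id))|exact: barc]. Qed.

Lemma overlap01 u' u t : 0 <= overlap u' u t <= 1.
Proof.
apply/andP; split; first by apply: mean_ge0 => x; rewrite mulr_ge0.
rewrite -[leRHS](mean_cst mu); apply: mean_le; first exact: bounded_meas_overlap.
  exact: bounded_meas_cst.
move=> x; have /andP[h1 h2] := indic01 (circle_arc u') x.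
have /andP[h3 h4] := indic01 (circle_arc u) (x + pr t).
by rewrite mulr_ile1.
Qed.

Lemma overlap_periodic u' u t : overlap u' u (t + 1) = overlap u' u t.
Proof. by rewrite /overlap circle_proj_add1. Qed.

Lemma mean_arc_shift v (s t : R) :
  \int[mu]_x `|\1_(circle_arc v) (x + pr t) - \1_(circle_arc v) (x + pr s)| <= 2 * `|t - s|.
Proof.
apply: le_trans (circle_arc_lipschitz v (t - s)).
rewrite le_eqVlt; apply/orP; left; apply/eqP.
rewrite -[RHS](mean_preserves (preserves_circle_add (pr s))); last first.
  by apply: bounded_meas_norm; apply: bounded_measB; [exact: barc|apply: (barc _ (h := id))].
apply: eq_Rintegral => x _; rewrite -addrA -circle_projD.
by have -> : s + (t - s) = t by ring.
Qed.

Lemma overlap_lipschitz u' u s t :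
  `|overlap u' u t - overlap u' u s| <= 2 * `|t - s|.
Proof.
rewrite -meanB; [|exact: bounded_meas_overlap..].
apply: le_trans (mean_norm _ _) _.
  by apply: bounded_measB; exact: bounded_meas_overlap.
apply: le_trans (mean_arc_shift u s t); apply: mean_le.
- by apply: bounded_meas_norm; apply: bounded_measB; exact: bounded_meas_overlap.
- by apply: bounded_meas_norm; apply: bounded_measB; exact: barc.
- by move=> x; rewrite -mulrBr normrM ler_piMl// ger0_norm.
Qed.

Lemma overlap_continuous u' u : continuous (overlap u' u).
Proof.
move=> t; apply/cvgrPdist_le => r r0; apply/nbhs_ballP.
exists (r / 2) => /=; first by rewrite divr_gt0.
move=> s ts; have {}ts : `|t - s| < r / 2 := ts; apply: le_trans (overlap_lipschitz _ _ _ _) _.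
by lra.
Qed.

(** Averaged over all translations, two arcs become independent. *)
Lemma mean_overlap u' u s :
  \int[mu]_c overlap u' u (s + circle_frac c) =
  fine (mu (circle_arc u')) * fine (mu (circle_arc u)).
Proof.
have mxc : measurable_fun [set: T * T] (fun z => z.2 + (pr s + z.1)).
  apply: measurable_circleD => //; apply: measurable_circleD => //; exact: measurable_cst.
have bH : bounded_meas (fun z : T * T =>
    (\1_(circle_arc u') z.2 * \1_(circle_arc u) (z.2 + (pr s + z.1)) : R)).
  by apply: bounded_measM; exact: barc.
transitivity (\int[mu]_c \int[mu]_x
    (\1_(circle_arc u') x * \1_(circle_arc u) (x + (pr s + c)))).
  apply: eq_Rintegral => c _; apply: eq_Rintegral => x _.
  by rewrite circle_projD circle_fracK.
transitivity (\int[(mu \x mu)%E]_z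
    (\1_(circle_arc u') z.2 * \1_(circle_arc u) (z.2 + (pr s + z.1)))).
  by rewrite [RHS]mean_fubini.
rewrite mean_fubini2//=.
have bu : bounded_meas (\1_(circle_arc u) : T -> R) by apply: (barc _ (h := id)).
have bu' : bounded_meas (\1_(circle_arc u') : T -> R) by apply: (barc _ (h := id)).
rewrite -!mean_indic; [|exact: measurable_circle_arc..].
rewrite mulrC -meanZ//; apply: eq_Rintegral => x _.
rewrite meanZ; last first.
  apply: barc; apply: measurable_circleD; first exact: measurable_cst.
  by apply: measurable_circleD => //; exact: measurable_cst.
rewrite mulrC; congr (_ * _).
rewrite -[RHS](mean_preserves (preserves_circle_add (x + pr s)) bu).
by apply: eq_Rintegral => c _; rewrite addrA addrC.
Qed.

Section fiber_mixing.
Context (a : R) (Phi : R -> R) (m : int).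
Hypothesis a_ergodic : ergodic mu (circle_rotation (pr a)).
Hypothesis Phi_smooth : forall k, Ck k Phi.
Hypothesis Phi_deg : forall t, Phi (t + 1) = Phi t + m%:~R.
Hypothesis m_neq0 : m != 0.
Local Notation Phi_ k := (lift_iter a Phi k).

Lemma lift_iter_continuous k : continuous (Phi_ k).
Proof.
move=> t; apply/differentiable_continuous/derivable1_diffP.
by have [] := is_derive_lift_iter a Phi_smooth k t.
Qed.

Lemma measurable_lift_iter_frac k : measurable_fun [set: T] (fun x => Phi_ k (circle_frac x)).
Proof.
apply: (measurableT_comp (f := Phi_ k)); last exact: measurable_circle_frac.
exact: continuous_measurable_fun (@lift_iter_continuous k).
Qed.

(** Mean value theorem for [Phi_ k] minus the line of slope [k m]. At distances of order [1 / k] the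
    displacement is thus affine up to an error of order [e]. *)
Lemma lift_iter_shear_approx (e : R) : 0 < e -> exists k0, forall k, (k0 <= k)%N ->
  forall t th, `|Phi_ k (t + th) - Phi_ k t - th * (k%:R * m%:~R)| <= k%:R * e * `|th|.
Proof.
move=> e0; have [N HN] := birkhoff_derive_cvg a_ergodic Phi_smooth Phi_deg e0.
exists N => k Nk t th.
pose h (s : R) := Phi_ k s - (k%:R * m%:~R) * s.
have dh (s : R) : is_derive s (1 : R) h
    (k%:R * birkhoff a (fun t => 'D_1 Phi t) k s - k%:R * m%:~R).
  have d1 := is_derive_lift_iter a Phi_smooth k s.
  have d2 : is_derive s (1 : R) (fun s : R => (k%:R * m%:~R) * s) (k%:R * m%:~R).
    by apply: is_derive_eq; rewrite /GRing.scale/= mulr1.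
  exact: is_deriveB.
have := @MVT_lipschitz _ h (k%:R * e) _ _ (t + th) t.
have -> : h (t + th) - h t = Phi_ k (t + th) - Phi_ k t - th * (k%:R * m%:~R).
  by rewrite /h; ring.
have -> : t + th - t = th by ring.
apply; first by move=> s; have [] := dh s.
move=> s; have -> : 'D_1 h s = k%:R * birkhoff a (fun t => 'D_1 Phi t) k s - k%:R * m%:~R.
  by have := dh s => ?; rewrite derive_val.
by rewrite -mulrBr normrM ger0_norm// ler_wpM2l// HN.
Qed.

Let wgt (u' u b : R) (x : T) : R := \1_(circle_arc u') x * \1_(circle_arc u) (x + pr b).

Let wgt01 u' u b x : 0 <= wgt u' u b x <= 1.
Proof.
have /andP[h1 h2] := indic01 (circle_arc u') x.
have /andP[h3 h4] := indic01 (circle_arc u) (x + pr b).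
by rewrite mulr_ge0//= mulr_ile1.
Qed.

Let bwgt u' u b : bounded_meas (wgt u' u b).
Proof. exact: bounded_meas_overlap. Qed.

Let wgt_shift u' u b th :
  \int[mu]_x `|wgt u' u b (x + pr th) - wgt u' u b x| <= 4 * `|th|.
Proof.
pose d1 (x : T) : R := `|\1_(circle_arc u') (x + pr th) - \1_(circle_arc u') (x + pr 0)|.
pose d2 (x : T) : R := `|\1_(circle_arc u) (x + pr (th + b)) - \1_(circle_arc u) (x + pr b)|.
have b1 : bounded_meas d1 by apply: bounded_meas_norm; apply: bounded_measB; exact: barc.
have b2 : bounded_meas d2 by apply: bounded_meas_norm; apply: bounded_measB; exact: barc.
have bw : bounded_meas (fun x : T => wgt u' u b (x + pr th)).
  exact: (bounded_meas_comp (mshift _) (bwgt u' u b)).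
apply: (@le_trans _ _ (\int[mu]_x (d1 x + d2 x))); last first.
  rewrite meanD//; have := mean_arc_shift u' 0 th; have := mean_arc_shift u b (th + b).
  rewrite addrK subr0 -/d1 -/d2.
  by rewrite -/(\int[mu]_x d1 x) -/(\int[mu]_x d2 x); lra.
apply: mean_le.
- by apply: bounded_meas_norm; exact: bounded_measB.
- exact: bounded_measD.
move=> x; rewrite /wgt /d1 /d2 circle_proj0 addr0 -addrA -circle_projD.
set A := \1_(circle_arc u') (x + _); set A0 := \1_(circle_arc u') x.
set B := \1_(circle_arc u) _; set B0 := \1_(circle_arc u) _.
have -> : A * B - A0 * B0 = (A - A0) * B + A0 * (B - B0) by ring.
apply: le_trans (ler_normD _ _) _; rewrite !normrM.
have /andP[h1 h2] := indic01 (circle_arc u) (x + pr (th + b)).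
have /andP[h3 h4] := indic01 (circle_arc u') x.
by rewrite (ger0_norm h1) (ger0_norm h3) lerD// ?ler_piMr// ler_piMl.
Qed.

(** A translation by [c / (k m)] barely moves the weight in the base but advances the displacement
    [Phi_ k] by nearly [c]. The integral is therefore almost the same for each extra phase [c], and
    averaging over [c] decouples the fibre arcs. That [k0] does not depend on [b] matters, since [b]
    will be [k a]. *)
Lemma fiber_mixing (v' v e : R) : 0 < e -> exists k0, forall k, (k0 <= k)%N ->
  forall u' u b,
  `|\int[mu]_x (\1_(circle_arc u') x * \1_(circle_arc u) (x + pr b) *
       overlap v' v (Phi_ k (circle_frac x))) -
    fine (mu (circle_arc v')) * fine (mu (circle_arc v)) * overlap u' u b| <= e.
Proof.
move=> e0; have e4 : 0 < e / 4 by rewrite divr_gt0.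
have e24 : 2 * (e / 4) <= e / 2 by lra.
have [k1 Hk1] := lift_iter_shear_approx e4.
(* This gives [4 / k <= e / 2], the cost of moving the weight; the other [e / 2] pays for the error
   in the phase. *)
pose k2 := (Num.trunc (8 / e)).+1.
exists (maxn k1 k2) => k; rewrite geq_max => /andP[kk1 kk2] u' u b.
have k0 : 0 < k%:R :> R by rewrite ltr0n (leq_trans _ kk2).
have ke : 4 / k%:R <= e / 2.
  rewrite ler_pdivrMr// -ler_pdivrMl ?divr_gt0// invf_div.
  apply: (@le_trans _ _ (8 / e)).
    by rewrite le_eqVlt; apply/orP; left; apply/eqP; field; rewrite gt_eqF.
  by apply: ltW; apply: lt_le_trans (truncnS_gt _) _; rewrite ler_nat.
have m1 : 1 <= `|m%:~R| :> R.
  by rewrite -intr_norm (ler_int R 1) -gtz0_ge1 normr_gt0.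
have m0 : m%:~R != 0 :> R by rewrite intr_eq0.
pose kap := overlap v' v; pose w := wgt u' u b.
have ckap : continuous kap by exact: overlap_continuous.
have mkap : measurable_fun [set: R] kap by exact: continuous_measurable_fun.
have bkap d (X : measurableType d) (h : X -> R) : measurable_fun setT h ->
    bounded_meas (fun x => kap (h x)).
  move=> mh; split; first exact: measurableT_comp mkap mh.
  by exists 1 => x; have /andP[h1 h2] := overlap01 v' v (h x); rewrite ger0_norm.
pose G x := kap (Phi_ k (circle_frac x)).
have bG : bounded_meas G by apply: bkap; exact: measurable_lift_iter_frac.
have bw : bounded_meas w by exact: bwgt.
have bwG : bounded_meas (fun x => w x * G x) by exact: bounded_measM.
(* The same integrand with an extra phase [z.1] in the fibre. *)
pose V2 (z : T * T) := w z.2 * kap (Phi_ k (circle_frac z.2) + circle_frac z.1).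
have bV2 : bounded_meas V2.
  apply: bounded_measM; first exact: (bounded_meas_comp (p := snd) _ bw).
  apply: bkap; apply: measurable_funD.
    exact: (measurableT_comp (measurable_lift_iter_frac k) measurable_snd).
  by apply: (measurableT_comp (f := @circle_frac R)) => //; exact: measurable_circle_frac.
pose V (c : T) := \int[mu]_x V2 (c, x).
have bV : bounded_meas V by exact: (bounded_meas_fubini mu mu bV2).
have EV : \int[mu]_c V c = fine (mu (circle_arc v')) * fine (mu (circle_arc v)) * overlap u' u b.
  transitivity (\int[(mu \x mu)%E]_z V2 z); first by rewrite [RHS]mean_fubini.
  rewrite mean_fubini2// -meanZ; last exact: bwgt.
  apply: eq_Rintegral => x _; rewrite /V2/= meanZ; last first.
    apply: bkap; apply: measurable_funD; first exact: measurable_cst.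
    exact: measurable_circle_frac.
  by rewrite mean_overlap mulrC.
have [I I_def] : exists I, I = \int[mu]_x (w x * G x) by eexists.
have E : \int[mu]_c (I - V c) = I - \int[mu]_c V c.
  by rewrite (meanB _ (bounded_meas_cst _ I) bV) mean_cst.
suff : `|\int[mu]_c (I - V c)| <= e by rewrite E EV I_def.
have bIV : bounded_meas (fun c => I - V c).
  by apply: bounded_measB => //; exact: bounded_meas_cst.
apply: le_trans (mean_norm _ bIV) _; rewrite -[leRHS](mean_cst mu).
apply: mean_le; [exact: bounded_meas_norm|exact: bounded_meas_cst|move=> c].
have km0 : k%:R * m%:~R != 0 :> R by rewrite mulf_neq0// gt_eqF.
(* [th] advances the displacement by [circle_frac c] to first order; the bound [|th| <= 1 / k] uses
   that the nonzero integer [m] has absolute value at least 1. *)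
have [th thE thk] : exists2 th, th * (k%:R * m%:~R) = circle_frac c & k%:R * `|th| <= 1.
  exists (circle_frac c / (k%:R * m%:~R)); first by rewrite divfK.
  rewrite normrM normfV normrM (ger0_norm (circle_frac_ge0 c)) (gtr0_norm k0).
  rewrite invfM mulrCA mulVKf ?gt_eqF// ler_pdivrMr ?normr_gt0// mul1r.
  exact: le_trans (ltW (circle_frac_lt1 c)) m1.
have thk4 : 4 * `|th| <= 4 / k%:R by rewrite ler_pM2l// -[leRHS]mulr1 ler_pdivlMl.
have the : k%:R * (e / 4) * `|th| <= e / 4.
  by rewrite [k%:R * _]mulrC -mulrA ler_piMr// ltW.
have IE : I = \int[mu]_x (w (x + pr th) * G (x + pr th)).
  rewrite I_def; exact: esym (mean_preserves (preserves_circle_add (pr th)) bwG).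
have bwt : bounded_meas (fun x : T => w (x + pr th)) by exact: (bounded_meas_comp (mshift _) bw).
have bGt : bounded_meas (fun x : T => G (x + pr th)) by exact: (bounded_meas_comp (mshift _) bG).
have bVc : bounded_meas (fun x => V2 (c, x)) by exact: (bounded_meas_comp (p := pair c) _ bV2).
have bwGt : bounded_meas (fun x : T => w (x + pr th) * G (x + pr th)) by exact: bounded_measM.
rewrite IE /V -meanB//; apply: le_trans (mean_norm _ _) _; first exact: bounded_measB.
have bd : bounded_meas (fun x : T => `|w (x + pr th) - w x|).
  by apply: bounded_meas_norm; exact: bounded_measB.
apply: (@le_trans _ _ (\int[mu]_x (`|w (x + pr th) - w x| + e / 2))).
  apply: mean_le.
  - by apply: bounded_meas_norm; exact: bounded_measB.
  - by apply: bounded_measD => //; exact: bounded_meas_cst.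
  move=> x; rewrite /V2/=; set K := kap _.
  have -> : w (x + pr th) * G (x + pr th) - w x * K =
      (w (x + pr th) - w x) * G (x + pr th) + w x * (G (x + pr th) - K) by ring.
  apply: le_trans (ler_normD _ _) _; rewrite (normrM (w _ - w _)) (normrM (w x)).
  apply: lerD.
    have /andP[h1 h2] := overlap01 v' v (Phi_ k (circle_frac (x + pr th))).
    by rewrite ler_piMr// ger0_norm.
  have /andP[h1 h2] : 0 <= w x <= 1 by exact: wgt01.
  rewrite (ger0_norm h1); apply: (@le_trans _ _ `|G (x + pr th) - K|).
    by rewrite ler_piMl.
  have -> : G (x + pr th) = kap (Phi_ k (circle_frac x + th)).
    (* Passing to the representative may lose an integer [n], which changes [Phi_ k] by the integer
       [k m n] and leaves the periodic [kap] unchanged. *)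
    have [n nE] : exists n : int, circle_frac (x + pr th) = circle_frac x + th + n%:~R.
      by apply: circle_proj_eq; rewrite circle_projD !circle_fracK.
    have per : (fun t => kap (Phi_ k (t + 1))) = (fun t => kap (Phi_ k t)).
      apply/funext => t; rewrite (lift_iter_deg a Phi_deg).
      have kmz : k%:R * m%:~R = (k%:Z * m)%:~R :> R by rewrite intrM.
      rewrite kmz; exact: (periodic_addz (overlap_periodic v' v)).
    rewrite /G nE.
    by rewrite (@periodic_addz _ _ (fun t => kap (Phi_ k t)) (fun t => congr1 (fun h => h t) per)).
  apply: le_trans (overlap_lipschitz _ _ _ _) _.
  have subD (A B C : R) : A - (B + C) = A - B - C by ring.
  have hh := Hk1 k kk1 (circle_frac x) th; rewrite thE in hh; rewrite subD.
  apply: (@le_trans _ _ (2 * (e / 4))); last exact: e24.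
  exact: ler_wpM2l (le_trans hh the).
rewrite meanD//; last exact: bounded_meas_cst.
rewrite mean_cst; have := wgt_shift u' u b th; rewrite -/w.
move=> h1; have {}h1 := le_trans (le_trans h1 thk4) ke.
apply: (@le_trans _ _ (e / 2 + e / 2)); first exact: lerD.
by rewrite -splitr.
Qed.

End fiber_mixing.
End overlap.

(** * Correlations of the skew shift and of the product *)

Section product_ergodicity.
Context (R : realType).
Local Notation T := (circle R).
Local Notation mu := (@circle_measure R).
Local Notation pr := (@circle_proj R).

Lemma cesaro_mean0 (t : nat -> R) : t @ \oo --> (0 : R) ->
  (fun N => N%:R^-1 * \sum_(k < N) t k) @ \oo --> (0 : R).
Proof.
move=> t0; rewrite -cvg_shiftS; have := cesaro t0.
apply: cvg_trans; apply: near_eq_cvg; apply: nearW => N.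
by rewrite /arithmetic_mean /series /= big_mkord.
Qed.

(** Here [rho] stands for correlations of [f], [lam] for those of the skew shift and [psi] for those
    of the rotation. A product of Cesaro limits is not a Cesaro limit in general; what saves it is
    that [rho] converges with absolute values inside the average. *)
Lemma cesaro_product (rho lam psi : nat -> R) (r0 k0 p0 : R) :
  0 <= r0 <= 1 -> (forall k, 0 <= lam k <= 1) ->
  (fun N => N%:R^-1 * \sum_(k < N) `|rho k - r0|) @ \oo --> (0 : R) ->
  (fun k => lam k - k0 * psi k) @ \oo --> (0 : R) ->
  (fun N => N%:R^-1 * \sum_(k < N) psi k) @ \oo --> p0 ->
  (fun N => N%:R^-1 * \sum_(k < N) (rho k * lam k)) @ \oo --> r0 * k0 * p0.
Proof.
move=> /andP[r00 r01] lam01 crho clam cpsi.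
have clam' : (fun k => `|lam k - k0 * psi k|) @ \oo --> (0 : R).
  by rewrite -(normr0 R); apply: cvg_norm.
have cC := cesaro_mean0 clam'.
have cd : (fun N => N%:R^-1 * \sum_(k < N) (rho k * lam k) -
    r0 * k0 * (N%:R^-1 * \sum_(k < N) psi k)) @ \oo --> (0 : R).
  have cs : (fun N => N%:R^-1 * (\sum_(k < N) `|rho k - r0|) +
      N%:R^-1 * (\sum_(k < N) `|lam k - k0 * psi k|)) @ \oo --> (0 + 0 : R).
    exact: cvgD.
  rewrite addr0 in cs.
  apply/cvgr0Pnorm_le => e e0; move/cvgr0Pnorm_le : cs => /(_ e e0).
  apply: filterS => N hN; apply: le_trans hN; apply: le_trans (ler_norm _).
  rewrite /= mulrCA -mulrBr -mulrDr normrM ger0_norm ?invr_ge0//.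
  apply: ler_wpM2l; first by rewrite invr_ge0.
  rewrite mulr_sumr -sumrB -big_split/=; apply: le_trans (ler_norm_sum _ _ _) _.
  apply: ler_sum => k _.
  have -> : rho k * lam k - r0 * k0 * psi k =
      (rho k - r0) * lam k + r0 * (lam k - k0 * psi k) by ring.
  apply: le_trans (ler_normD _ _) _; rewrite !normrM (ger0_norm r00).
  have /andP[l0 l1] := lam01 k.
  by rewrite lerD// ?(ger0_norm l0) ?ler_piMr// ler_piMl.
have : (fun N => (N%:R^-1 * (\sum_(k < N) (rho k * lam k)) -
    r0 * k0 * (N%:R^-1 * \sum_(k < N) psi k)) +
    r0 * k0 * (N%:R^-1 * \sum_(k < N) psi k)) @ \oo --> 0 + r0 * k0 * p0.
  by apply: cvgD => //; apply: cvgM => //; exact: cvg_cst.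
rewrite add0r.
apply: cvg_trans; apply: near_eq_cvg; apply: nearW => N.
by rewrite /= subrK.
Qed.

Section skew.
Context (a : R) (phi : T -> T) (Phi : R -> R) (m : int).
Hypothesis a_ergodic : ergodic mu (circle_rotation (pr a)).
Hypothesis Phi_lift : lifts pr pr Phi phi.
Hypothesis Phi_smooth : forall k, Ck k Phi.
Hypothesis Phi_deg : forall t, Phi (t + 1) = Phi t + m%:~R.
Hypothesis m_neq0 : m != 0.
Local Notation Phi_ k := (lift_iter a Phi k).
Local Notation S := (torus2_skew (pr a) phi).

Lemma preserves_torus2_skew : preserves (torus2_measure R) (torus2_measure R) S.
Proof.
have mphi : measurable_fun setT phi.
  have -> : phi = pr \o (fun x => Phi (circle_frac x)).
    by apply/funext => x /=; rewrite -Phi_lift circle_fracK.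
  apply: measurableT_comp; first exact: measurable_circle_proj.
  apply: (measurableT_comp (f := Phi)); last exact: measurable_circle_frac.
  exact: continuous_measurable_fun (Phi_smooth 0).
apply: (preserves_skew (s := fun x : T => x + pr a) (t := fun x : T * T => x.2 + phi x.1)).
- exact: preserves_circle_add.
- by apply: measurable_circleD => //; exact: measurableT_comp.
- by move=> x; exact: (preserves_circle_add (phi x)).
Qed.

(** Read off from the lift of the iterate at the representatives of the coordinates. *)
Lemma iter_torus2_skew k x :
  iter k S x = (x.1 + pr (k%:R * a), x.2 + pr (Phi_ k (circle_frac x.1))).
Proof.
pose u : 'rV[R]_2 := \row_i (if i == 0 then circle_frac x.1 else circle_frac x.2).
have ux : torus2_proj u = x.
  by case: x @u => x y u; rewrite /torus2_proj !mxE/= !circle_fracK.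
rewrite -{1}ux (lifts_iter_shear a k Phi_lift) torus2_proj_shear !mxE/=.
by rewrite mulr1 mulr0 addr0 !(circle_projD (circle_frac _)) !circle_fracK.
Qed.

Let lam (u v u' v' : R) k : R := fine (torus2_measure R
  (iter k S @^-1` (circle_arc u `*` circle_arc v) `&` (circle_arc u' `*` circle_arc v'))).

Let lamE u v u' v' k : lam u v u' v' k =
  \int[mu]_x (\1_(circle_arc u') x * \1_(circle_arc u) (x + pr (k%:R * a)) *
    overlap v' v (Phi_ k (circle_frac x))).
Proof.
have miter : measurable_fun setT (iter k S).
  elim: k => [|k ih]; first exact: measurable_id.
  exact: measurableT_comp preserves_torus2_skew.1 ih.
have mA (p q : R) : measurable (circle_arc p `*` circle_arc q : set (T * T)).
  by apply: measurableX; exact: measurable_circle_arc.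
have mI : measurable (iter k S @^-1` (circle_arc u `*` circle_arc v) `&`
    (circle_arc u' `*` circle_arc v')).
  by apply: measurableI => //; rewrite -[_ @^-1` _]setTI; exact: miter.
have bI := bounded_meas_indic R mI.
rewrite /lam -[LHS](mean_indic _ mI) mean_fubini//; apply: eq_Rintegral => x _.
rewrite /overlap -meanZ; last exact: bounded_meas_overlap.
apply: eq_Rintegral => y _.
have indX (p q : R) (z : T * T) :
    \1_(circle_arc p `*` circle_arc q) z = \1_(circle_arc p) z.1 * \1_(circle_arc q) z.2 :> R.
  by rewrite !indicE in_setX; case: (_ \in _); case: (_ \in _); rewrite ?mulr1 ?mulr0.
rewrite indicI /= indic_preimage_apply !indX iter_torus2_skew/=.
set A := \1_(circle_arc u) _; set B := \1_(circle_arc v) _.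
set A' := \1_(circle_arc u') _; set B' := \1_(circle_arc v') _; ring.
Qed.

Let lam_mixing u v u' v' :
  (fun k => lam u v u' v' k - fine (mu (circle_arc v')) * fine (mu (circle_arc v)) *
     overlap u' u (k%:R * a)) @ \oo --> (0 : R).
Proof.
apply/cvgr0Pnorm_le => e e0.
have [k0 Hk0] := fiber_mixing a_ergodic Phi_smooth Phi_deg m_neq0 v' v e0.
exists k0 => // k kk0; rewrite lamE; exact: Hk0.
Qed.

(** The limit is needed at the single starting point 0. The mean over all starting points is exactly
    the product of the lengths, and the oscillation of the averages tends to 0. *)
Let overlap_cesaro u' u :
  (fun N => N%:R^-1 * \sum_(k < N) overlap u' u (k%:R * a)) @ \oo -->
  fine (mu (circle_arc u')) * fine (mu (circle_arc u)).
Proof.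
apply/cvgrPdist_le => e e0.
have [|N0 HN0] := birkhoff_oscillation a_ergodic (overlap_periodic u' u)
  (fun s t => overlap_lipschitz u' u t s) (K := 1) _ e0.
  by move=> x; have /andP[h1 h2] := overlap01 u' u x; rewrite ger0_norm.
exists N0.+1 => // N NN; have N_gt0 : (0 < N)%N by exact: leq_trans NN.
pose B x := birkhoff a (overlap u' u) N x.
have B0 : N%:R^-1 * \sum_(k < N) overlap u' u (k%:R * a) = B 0.
  by rewrite /B /birkhoff; congr (_ * _); apply: eq_bigr => k _; rewrite add0r.
have bo (s : R) : bounded_meas (fun c : T => overlap u' u (circle_frac c + s)).
  split.
    apply: measurableT_comp.
      exact: continuous_measurable_fun (@overlap_continuous R u' u).
    by apply: measurable_funD => //; exact: measurable_circle_frac.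
  by exists 1 => c; have /andP[h1 h2] := overlap01 u' u (circle_frac c + s); rewrite ger0_norm.
have bB : bounded_meas (fun c : T => B (circle_frac c)).
  apply: bounded_measZ; apply: (bounded_meas_sum N (F := fun k (c : T) =>
    overlap u' u (circle_frac c + k%:R * a))) => k; exact: bo.
have EB : \int[mu]_c B (circle_frac c) =
    fine (mu (circle_arc u')) * fine (mu (circle_arc u)).
  rewrite /B /birkhoff meanZ; last first.
    by apply: (bounded_meas_sum N (F := fun k (c : T) =>
      overlap u' u (circle_frac c + k%:R * a))) => k; exact: bo.
  rewrite (mean_sum mu N (F := fun k (c : T) => overlap u' u (circle_frac c + k%:R * a)))//.
  rewrite (eq_bigr (fun=> fine (mu (circle_arc u')) * fine (mu (circle_arc u)))); last first.
    move=> k _; rewrite -(mean_overlap u' u (k%:R * a)).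
    by apply: eq_Rintegral => c _; rewrite addrC.
  by rewrite sumr_const card_ord -[X in _ * X]mulr_natl mulKf// pnatr_eq0 -lt0n.
rewrite B0 -EB.
have -> : \int[mu]_c B (circle_frac c) - B 0 = \int[mu]_c (B (circle_frac c) - B 0).
  by rewrite (meanB _ bB (bounded_meas_cst _ _)) mean_cst.
have bB0 : bounded_meas (fun c : T => B (circle_frac c) - B 0).
  by apply: bounded_measB => //; exact: bounded_meas_cst.
apply: le_trans (mean_norm _ bB0) _; rewrite -[leRHS](mean_cst mu).
apply: mean_le; [exact: bounded_meas_norm|exact: bounded_meas_cst|move=> c].
exact: HN0 (ltnW NN) _ _.
Qed.

Lemma product_skew_ergodic (f : torus2 R -> torus2 R) :
  weakly_mixing (torus2_measure R) f ->
  ergodic (torus4_measure R) (product_map f S).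
Proof.
move=> fwm; have pf : preserves (torus2_measure R) (torus2_measure R) f by exact: fwm.1.
have pF : preserves (torus4_measure R) (torus4_measure R) (product_map f S).
  apply: (preserves_skew (s := f) (t := fun x : torus4 R => S x.2) pf).
    by apply: (measurableT_comp preserves_torus2_skew.1).
  by move=> x; exact: preserves_torus2_skew.
apply: (ergodic_arc_rectangles pF) => E u v E' u' v' mE mE' A B.
pose rho k : R := fine (torus2_measure R (E' `&` iter k f @^-1` E)).
have mI (p q : R) : measurable (circle_arc p `*` circle_arc q : set (T * T)).
  by apply: measurableX; exact: measurable_circle_arc.
have pfi k : preserves (torus2_measure R) (torus2_measure R) (iter k f).
  elim: k => [|k ih]; first exact: preserves_id.
  exact: (preserves_comp ih pf).
have pSi k : preserves (torus2_measure R) (torus2_measure R) (iter k S).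
  elim: k => [|k ih]; first exact: preserves_id.
  exact: (preserves_comp ih preserves_torus2_skew).
pose M2 : probability (torus2 R) R := torus2_measure R.
have fM2 (U : set (torus2 R)) : measurable U -> M2 U \is a fin_num.
  by move=> mU; exact: fin_num_measure.
have f01 (U : set (torus2 R)) : measurable U -> 0 <= fine (M2 U) <= 1.
  move=> mU; rewrite fine_ge0//= -lee_fin fineK ?fM2//; exact: probability_le1.
have fX (U V : set (torus2 R)) : measurable U -> measurable V ->
    fine (torus4_measure R (U `*` V)) = fine (M2 U) * fine (M2 V).
  move=> mU mV; rewrite -(fineM (fM2 _ mU) (fM2 _ mV)); congr fine.
  exact: (product_measure1E M2 M2 mU mV).
(* Correlations of a product map between product sets factor, which separates [f] from the skew
   shift. *)
have term k : fine (torus4_measure R (iter k (product_map f S) @^-1` A `&` B)) =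
    rho k * lam u v u' v' k.
  rewrite iter_product_map.
  have -> : product_map (iter k f) (iter k S) @^-1` A `&` B =
      (E' `&` iter k f @^-1` E) `*` (iter k S @^-1` (circle_arc u `*` circle_arc v) `&`
        (circle_arc u' `*` circle_arc v')).
    by apply/seteqP; split=> -[x y] /=; rewrite /A /B/=; tauto.
  rewrite fX//; first by apply: measurableI => //; rewrite -[_ @^-1` _]setTI; exact: (pfi k).1.
  by apply: measurableI => //; rewrite -[_ @^-1` _]setTI; exact: (pSi k).1.
under eq_fun do under eq_bigr do rewrite term.
have -> : fine (torus4_measure R A) * fine (torus4_measure R B) =
    (fine (M2 E') * fine (M2 E)) *
    (fine (mu (circle_arc v')) * fine (mu (circle_arc v))) *
    (fine (mu (circle_arc u')) * fine (mu (circle_arc u))).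
  have fXc (p q : R) : fine (M2 (circle_arc p `*` circle_arc q)) =
      fine (mu (circle_arc p)) * fine (mu (circle_arc q)).
    have fc w : mu (circle_arc w) \is a fin_num.
      exact: fin_num_measure (measurable_circle_arc w).
    rewrite -(fineM (fc p) (fc q)).
    congr fine; exact: (product_measure1E mu mu (measurable_circle_arc p)
      (measurable_circle_arc q)).
  have EA := etrans (fX _ _ mE (mI u v)) (congr1 ( *%R _) (fXc u v)).
  have EB := etrans (fX _ _ mE' (mI u' v')) (congr1 ( *%R _) (fXc u' v')).
  apply: (etrans (congr2 *%R EA EB)).
  set x1 := fine (M2 E); set x2 := fine (M2 E').
  set x3 := fine (mu (circle_arc u)); set x4 := fine (mu (circle_arc v)).
  set x5 := fine (mu (circle_arc u')); set x6 := fine (mu (circle_arc v')); ring.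
apply: cesaro_product.
- have /andP[h1 h2] := f01 E' mE'; have /andP[h3 h4] := f01 E mE.
  by rewrite mulr_ge0//= mulr_ile1.
- move=> k; apply: f01; apply: measurableI => //.
  by rewrite -[_ @^-1` _]setTI; exact: (pSi k).1.
- exact: fwm.2.
- exact: lam_mixing.
- exact: overlap_cesaro.
Qed.

End skew.
End product_ergodicity.

Theorem theorem11 (R : realType)
    (f : torus2 R -> torus2 R)
    (f_diffeo : diffeo_Coo (@torus2_proj R) f)
    (f_area : measure_preserving (torus2_measure R) f)
    (f_wm : weakly_mixing (torus2_measure R) f)
    (f_growth : sublinear_growth (@torus2_proj R) f)
    (alpha : circle R)
    (alpha_ergodic : ergodic (@circle_measure R) (circle_rotation alpha))
    (phi : circle R -> circle R)
    (phi_smooth : class_Coo (@circle_proj R) (@circle_proj R) phi)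
    (m : int) (phi_degree : topological_degree phi m) (m_neq0 : m != 0) :
  [/\ ergodic (torus4_measure R) (product_map f (torus2_skew alpha phi)),
      linear_uniform_growth (@torus4_proj R)
        (product_map f (torus2_skew alpha phi))
    & forall G : torus4 R -> torus4 R, skew_product3 G ->
        ~ metrically_isomorphic (torus4_measure R) (torus4_measure R)
            (product_map f (torus2_skew alpha phi)) G].
Proof.
(* A real representative of [alpha] is fixed, since the iterates are computed on lifts. *)
move: alpha_ergodic; rewrite -(circle_fracK alpha) => a_ergodic.
have [Phi [lPhi Phi_smooth]] := phi_smooth.
have Phi_deg := smooth_lift_degree phi_degree lPhi (Phi_smooth 0).
split.
- exact: (product_skew_ergodic a_ergodic lPhi Phi_smooth Phi_deg m_neq0).
- exact: (product_linear_growth f_diffeo f_growth a_ergodic phi_smooth phi_degree).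
- by move=> G skG; exact: product_not_isomorphic_skew_product3.
Qed.
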